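(* Let $D\subseteq\mathbb{C}$ be a domain and $u:D\to\mathbb{R}$ a solution of $u_{z\bar z}-\tfrac12\sinh(2u)=0$. Then the $1$-parameter family of minimal immersions $\Phi_t:(D,4\cosh^2u\,|dz|^2)\to\mathbb{H}^2\times\mathbb{R}$, $t\in\mathbb{R}$, with Hopf differential $\Theta=e^{it}\,dz\otimes dz$ associated to $u$ is given by $$\Phi_t(z)=\bigl(\nu^+_{\phi_t}(z),\,2\,\mathrm{Im}(ze^{it/2})\bigr),$$ where $\phi_t:(D,e^{2u}|dz|^2)\to\mathbf{H}^3_1$ is the $1$-parameter family of isometric maximal immersions associated to $u$ with Hopf differential $\Theta_{\phi_t}=\tfrac i2e^{it}\,dz\otimes dz$.
   Context: Let $\mathbb{R}^4_2$ be $\mathbb{R}^4$ with its standard orientation and the metric $\langle\!\langle u,v\rangle\!\rangle=u_1v_1+u_2v_2-u_3v_3-u_4v_4$. Anti-De Sitter space is $\mathbf{H}^3_1=\{p\in\mathbb{R}^4_2:\langle\!\langle p,p\rangle\!\rangle=-1\}$ with the induced Lorentzian metric. A spacelike immersion into $\mathbf{H}^3_1$ is maximal if its mean curvature vanishes. For a spacelike conformal maximal immersion $\phi$ with conformal parameter $z=x+iy$, let $N$ be the unit timelike normal field ($\langle\!\langle N,N\rangle\!\rangle=-1$, $N$ tangent to $\mathbf{H}^3_1$ and orthogonal to $\phi$) such that $\{\phi_x,\phi_y,\phi,N\}$ is positively oriented in $\mathbb{R}^4_2$. Its Hopf differential is $\Theta_\phi=\langle\!\langle\phi_z,N_z\rangle\!\rangle\,dz\otimes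 dz$ (complex-bilinear extension). For a solution $u$ of the equation $u_{z\bar z}-\tfrac12\sinh(2u)=0$, the maximal immersions $\phi_t$ associated to $u$ are those with induced metric $e^{2u}|dz|^2$ and Hopf differential $\tfrac i2e^{it}dz\otimes dz$ (determined up to ambient isometry). On $\Lambda^2\mathbb{R}^4_2$ consider the metric $g(v\wedge w,v'\wedge w')=\langle\!\langle v,w'\rangle\!\rangle\langle\!\langle w,v'\rangle\!\rangle-\langle\!\langle v,v'\rangle\!\rangle\langle\!\langle w,w'\rangle\!\rangle$ and the star operator defined by $\alpha\wedge(\star\beta)=g(\alpha,\beta)\Omega$, with $\Omega$ the orientation form. Its eigenspace $\Lambda^2_+\mathbb{R}^4_2$ for the eigenvalue $+1$ is isometric to Lorentz–Minkowski 3-space, and $\mathbb{H}^2_+\equiv\mathbb{H}^2$ denotes the hyperbolic plane in it (one sheet of $\{g(\alpha,\alpha)=-1\}$, of curvature $-1$; the two sheets are identified through $\alpha\mapsto-\alpha$). The first component of the Gauss map of $\phi$ is $$\nu^+_\phi(p)=\tfrac1{\sqrt2}\bigl[e_1\wedge e_2+N(p)\wedge\phi(p)\bigr]\in\mathbb{H}^2_+,$$ where $\{e_1,e_2\}$ is an oriented orthonormal basis of the tangent plane at $p$. $\mathbb{H}^2\times\mathbb{R}$ carries the Riemannian product metric. For a conformal minimal immersion $\Phi=(F,h)$ into $\mathbb{H}^2\times\mathbb{R}$, its Hopf differential is that of its horizontal component, $\langle F_z,F_z\rangle\,dz\otimes dz$ (which equals $-h_z^2\,dz\otimes dz$). The family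 of minimal immersions in $\mathbb{H}^2\times\mathbb{R}$ associated to $u$ (Hauswirth–Sá Earp–Toubiana) consists, for each $t$, of the conformal minimal immersion of $D$, considered up to ambient isometry, with induced metric $4\cosh^2u\,|dz|^2$ and Hopf differential $e^{it}dz\otimes dz$. *)

(* Defs.v *)
From HB Require Import structures.
From mathcomp Require Import all_boot all_order all_algebra.
From mathcomp Require Import all_classical all_reals all_analysis.
From mathcomp Require Import complex.
From mathcomp Require Import ring.
Set Implicit Arguments.
Unset Strict Implicit.
Unset Printing Implicit Defensive.
Import Order.TTheory GRing.Theory Num.Theory.
Import numFieldNormedType.Exports.
Local Open Scope classical_set_scope.
Local Open Scope complex_scope.
Local Open Scope ring_scope.

(** The complex plane is identified with R * R through (x, y) |-> x + iy.
    Maps on a domain D are total functions; every condition is imposed on the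
    open set D only. *)
Notation plane R := (R * R)%type.

Definition toC (R : realType) (z : plane R) : R[i] := z.1 +i* z.2.

Definition expi (R : realType) (s : R) : R[i] := cos s +i* sin s.

Definition sinh (R : realType) (s : R) : R := (expR s - expR (- s)) / 2.
Definition cosh (R : realType) (s : R) : R := (expR s + expR (- s)) / 2.

Definition domain (R : realType) (D : set (plane R)) : Prop :=
  [/\ D !=set0, open D & connected D].

Section Calculus.
Variable R : realType.

Definition dx (V : normedModType R) (f : plane R -> V) (z : plane R) : V :=
  'D_((1, 0) : plane R) f z.
Definition dy (V : normedModType R) (f : plane R -> V) (z : plane R) : V :=
  'D_((0, 1) : plane R) f z.

Fixpoint Ck (V : normedModType R) (k : nat) (D : set (plane R))
    (f : plane R -> V) : Prop :=
  if k is k'.+1 then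
    [/\ forall z, D z -> derivable f z ((1, 0) : plane R),
        forall z, D z -> derivable f z ((0, 1) : plane R),
        Ck k' D (dx f) & Ck k' D (dy f)]
  else forall z, D z -> {for z, continuous f}.

Definition smooth (V : normedModType R) (D : set (plane R))
    (f : plane R -> V) : Prop := forall k, Ck k D f.

(** Wirtinger operators d/dz = (d/dx - i d/dy)/2 and d/dzbar = (d/dx + i d/dy)/2 *)
Definition dxC (f : plane R -> R[i]) (z : plane R) : R[i] :=
  dx (fun w => complex.Re (f w)) z +i* dx (fun w => complex.Im (f w)) z.
Definition dyC (f : plane R -> R[i]) (z : plane R) : R[i] :=
  dy (fun w => complex.Re (f w)) z +i* dy (fun w => complex.Im (f w)) z.
Definition d_z (f : plane R -> R[i]) (z : plane R) : R[i] :=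
  (dxC f z - 'i%C * dyC f z) / 2.
Definition d_zbar (f : plane R -> R[i]) (z : plane R) : R[i] :=
  (dxC f z + 'i%C * dyC f z) / 2.

(** X_z for a map X into a real space of matrices, in its complexification *)
Definition mx_z (m n : nat) (X : plane R -> 'M[R]_(m, n)) (z : plane R) :
    'M[R[i]]_(m, n) :=
  \matrix_(i < m, j < n) d_z (fun w => (X w i j)%:C) z.

Definition sinh_gordon (D : set (plane R)) (u : plane R -> R) : Prop :=
  forall z, D z ->
    d_zbar (d_z (fun w => (u w)%:C)) z - 2^-1 * (sinh (2 * u z))%:C = 0.

End Calculus.

(** Surfaces X : D -> V in a vector space V with a scalar product B.  When V
    contains the ambient manifold M with its induced metric and X takes its
    values in M, normal fields [xi] are to be tangent to M, so that B(X_ij, xi)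
    is the second fundamental form of X in M.  *)
Section Surfaces.
Variables (R : realType) (V : normedModType R) (B : V -> V -> R).
Implicit Types (X : plane R -> V) (z : plane R).

(** X is a (spacelike) conformal immersion with induced metric lam |dz|^2:
    immersivity is part of lam > 0. *)
Definition conformal_metric (D : set (plane R)) X (lam : plane R -> R) : Prop :=
  forall z, D z ->
    [/\ 0 < lam z, B (dx X z) (dx X z) = lam z,
        B (dy X z) (dy X z) = lam z & B (dx X z) (dy X z) = 0].

(** Half the trace of the second fundamental form in the direction xi with
    respect to the first one.  *)
Definition mean_curvature X z (xi : V) : R :=
  let E := B (dx X z) (dx X z) in
  let F := B (dx X z) (dy X z) in
  let G := B (dy X z) (dy X z) in
  let L := B (dx (dx X) z) xi in
  let M := B (dx (dy X) z) xi in
  let N := B (dy (dy X) z) xi in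
  (E * N - 2 * F * M + G * L) / (2 * (E * G - F ^+ 2)).

End Surfaces.

(** ** R^4_2 and its bivectors *)

(** The scalar product << , >> over any field K: for K = R[i] this is the
    complex bilinear extension. *)
Definition ip42 (K : fieldType) (v w : 'rV[K]_4) : K :=
  v 0 0 * w 0 0 + v 0 1 * w 0 1 - v 0 2 * w 0 2 - v 0 3 * w 0 3.

Definition gram42 (K : fieldType) : 'M[K]_4 :=
  diag_mx (\row_(i < 4) (if (i < 2)%N then 1 else -1)).

Definition AdS3 (R : realType) : set 'rV[R]_4 := [set p | ip42 p p = -1].

(** The 4 x 4 matrix with rows a, b, c, d *)
Definition rows4 (K : fieldType) (a b c d : 'rV[K]_4) : 'M[K]_4 :=
  \matrix_(i < 4) nth 0 [:: a; b; c; d] i.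

(** The bivector sum_(i<j) a_ij e_i /\ e_j is the antisymmetric matrix (a_ij). *)
Definition bivector (K : fieldType) : set 'M[K]_4 := [set a | a^T = - a].

Definition wedge (K : fieldType) (v w : 'rV[K]_4) : 'M[K]_4 :=
  v^T *m w - w^T *m v.

(** The metric g; see [gbiv_wedge]. *)
Definition gbiv (K : fieldType) (a b : 'M[K]_4) : K :=
  2^-1 * \tr (a *m gram42 K *m b *m gram42 K).

(** Coefficient of the 4-vector a /\ b on Omega = e_1 /\ e_2 /\ e_3 /\ e_4;
    see [wedge22_wedge]. *)
Definition wedge22 (K : fieldType) (a b : 'M[K]_4) : K :=
  a 0 1 * b 2 3 - a 0 2 * b 1 3 + a 0 3 * b 1 2
  + a 1 2 * b 0 3 - a 1 3 * b 0 2 + a 2 3 * b 0 1.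

Section BivectorFacts.
Variable K : numFieldType.
Implicit Types v w : 'rV[K]_4.

Lemma bivector_wedge v w : bivector (wedge v w).
Proof. by rewrite /bivector /wedge /= linearB /= !trmx_mul !trmxK opprB. Qed.

Local Definition coord4 v (k : nat) : K := v 0 (inord k).

Lemma wedgeE v w i j : wedge v w i j = v 0 i * w 0 j - w 0 i * v 0 j.
Proof. by rewrite /wedge !mxE !big_ord1 !mxE. Qed.

Lemma row4E v (i : 'I_4) : v 0 i = coord4 v i.
Proof. by rewrite /coord4 inord_val. Qed.

Lemma gbiv_wedge v w v' w' :
  gbiv (wedge v w) (wedge v' w') =
  ip42 v w' * ip42 w v' - ip42 v v' * ip42 w w'.
Proof.
have trE (a b : 'M[K]_4) : \tr (a *m gram42 K *m b *m gram42 K) =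
    \sum_i \sum_j (a i j * (if (j < 2)%N then 1 else -1)) *
                  (b j i * (if (i < 2)%N then 1 else -1)).
  apply: eq_bigr => i _; rewrite /gram42 mul_mx_diag !mxE mulr_suml.
  by apply: eq_bigr => j _; rewrite mul_mx_diag !mxE mulrA.
apply: (mulfI (_ : 2 != 0 :> K)); first by rewrite pnatr_eq0.
rewrite /gbiv mulrA divff ?pnatr_eq0// mul1r trE.
rewrite !big_ord_recl !big_ord0 /ip42 !wedgeE !row4E /= /bump /=.
by ring.
Qed.

Lemma wedge22_wedge v w v' w' :
  wedge22 (wedge v w) (wedge v' w') = \det (rows4 v w v' w').
Proof.
have dE n (A : 'M[K]_n.+1) : \det A =
    \sum_j A ord0 j * ((-1) ^+ (0 + j) * \det (row' ord0 (col' j A))).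
  by rewrite (expand_det_row _ ord0).
have d3E (A : 'M[K]_3) (a := fun i j => A (inord i) (inord j)) : \det A =
    a 0 0 * (a 1 1 * a 2 2 - a 1 2 * a 2 1)
    - a 0 1 * (a 1 0 * a 2 2 - a 1 2 * a 2 0)
    + a 0 2 * (a 1 0 * a 2 1 - a 1 1 * a 2 0).
  have aE i j : A i j = a i j by rewrite /a !inord_val.
  rewrite dE !big_ord_recl big_ord0 !dE !big_ord_recl !big_ord0 !det_mx11.
  by rewrite !mxE !aE /= /bump /=; ring.
rewrite /wedge22 !wedgeE !row4E /= dE !big_ord_recl big_ord0 !d3E.
rewrite !mxE /= !row4E /= /bump /= !inordK //=.
by ring.
Qed.

End BivectorFacts.

(** [is_star b c]: the bivector c is the star of b, i.e.
    a /\ c = g(a, b) Omega for all a. *)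
Definition is_star (K : fieldType) (b c : 'M[K]_4) : Prop :=
  bivector c /\ forall a, bivector a -> wedge22 a c = gbiv a b.

(** Self-dual bivectors: the eigenspace of the star operator for +1 *)
Definition Lambda_plus (K : fieldType) : set 'M[K]_4 :=
  [set a | bivector a /\ is_star a a].

Section H2xR.
Variable R : realType.

(** The two sheets of {g = -1} in Lambda_plus are told apart by the sign of the
    coefficient of e_1 /\ e_2, which does not vanish there; H^2 is the sheet
    where it is positive. *)
Definition H2 : set 'M[R]_4 :=
  [set a | [/\ Lambda_plus a, gbiv a a = -1 & 0 < a 0 1]].

(** The identification of the two sheets through a |-> - a *)
Definition to_sheet (a : 'M[R]_4) : 'M[R]_4 := if 0 < a 0 1 then a else - a.

Definition H2R : set ('M[R]_4 * R) := [set p | H2 p.1].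

(** The product metric *)
Definition gH2R (v w : 'M[R]_4 * R) : R := gbiv v.1 w.1 + v.2 * w.2.

Definition tangent_H2R (p v : 'M[R]_4 * R) : Prop :=
  Lambda_plus v.1 /\ gbiv p.1 v.1 = 0.

(** Riemannian isometries of H^2 x R: bijections preserving differentiable
    curves and the length of their velocities *)
Definition isometry_H2R (T : 'M[R]_4 * R -> 'M[R]_4 * R) : Prop :=
  set_bij H2R H2R T /\
  forall (c : R -> 'M[R]_4 * R) (s : R),
    (forall r, H2R (c r)) -> derivable c s 1 ->
    derivable (T \o c) s 1 /\
    gH2R ('D_1 (T \o c) s) ('D_1 (T \o c) s) = gH2R ('D_1 c s) ('D_1 c s).

End H2xR.

Section Families.
Variable R : realType.
Implicit Types (D : set (plane R)) (u : plane R -> R) (t : R).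

(** ** Maximal surfaces in anti-de Sitter space *)

(** The unit timelike normal field N with (phi_x, phi_y, phi, N) positive *)
Definition unit_normal D (phi N : plane R -> 'rV[R]_4) : Prop :=
  forall z, D z ->
    [/\ ip42 (N z) (N z) = -1, ip42 (N z) (phi z) = 0,
        ip42 (N z) (dx phi z) = 0, ip42 (N z) (dy phi z) = 0 &
        0 < \det (rows4 (dx phi z) (dy phi z) (phi z) (N z))].

(** phi belongs, with unit normal N, to the family of maximal immersions
    associated to u, for the parameter t. *)
Definition associated_maximal D u t (phi N : plane R -> 'rV[R]_4) : Prop :=
  [/\ smooth D phi /\ (forall z, D z -> AdS3 (phi z)),
      conformal_metric (@ip42 R) D phi (fun z => expR (2 * u z)),
      unit_normal D phi N,
      forall z, D z -> mean_curvature (@ip42 R) phi z (N z) = 0 &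
      forall z, D z -> ip42 (mx_z phi z) (mx_z N z) = 'i%C / 2 * expi t].

(** For every z in D, (e1 z, e2 z) is an oriented orthonormal basis of the
    tangent plane of phi at z; no continuity in z is needed. *)
Definition oriented_frame D (phi e1 e2 : plane R -> 'rV[R]_4) : Prop :=
  forall z, D z ->
    [/\ ip42 (e1 z) (e1 z) = 1, ip42 (e2 z) (e2 z) = 1,
        ip42 (e1 z) (e2 z) = 0 &
        exists a b c d : R,
          [/\ e1 z = a *: dx phi z + b *: dy phi z,
              e2 z = c *: dx phi z + d *: dy phi z & 0 < a * d - b * c]].

(** First component of the Gauss map, in {g = -1} in Lambda_plus *)
Definition nu_plus (phi N e1 e2 : plane R -> 'rV[R]_4) (z : plane R) : 'M[R]_4 :=
  (Num.sqrt 2)^-1 *: (wedge (e1 z) (e2 z) + wedge (N z) (phi z)).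

(** ** Minimal surfaces in H^2 x R *)

(** The mean curvature vector in H^2 x R vanishes: its component along every
    unit normal at every point does. *)
Definition minimal_H2R D (Phi : plane R -> 'M[R]_4 * R) : Prop :=
  forall z, D z -> forall xi : 'M[R]_4 * R,
    tangent_H2R (Phi z) xi -> gH2R xi xi = 1 ->
    gH2R (dx Phi z) xi = 0 -> gH2R (dy Phi z) xi = 0 ->
    mean_curvature (@gH2R R) Phi z xi = 0.

(** Phi = (F, h) belongs to the family of minimal immersions associated to u,
    for the parameter t. *)
Definition associated_minimal D u t (Phi : plane R -> 'M[R]_4 * R) : Prop :=
  [/\ smooth D Phi /\ (forall z, D z -> H2R (Phi z)),
      conformal_metric (@gH2R R) D Phi (fun z => 4 * cosh (u z) ^+ 2),
      minimal_H2R D Phi &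
      forall z, D z ->
        let F := fun w => (Phi w).1 in
        gbiv (mx_z F z) (mx_z F z) = expi t].

End Families.

(* Main.v *)
Require Import Defs.
From mathcomp Require Import all_boot all_order all_algebra.
From mathcomp Require Import all_classical all_reals all_analysis.
From mathcomp Require Import complex.
From mathcomp Require Import ring lra.
Import Order.TTheory GRing.Theory Num.Theory.
Import numFieldNormedType.Exports.
Local Open Scope classical_set_scope.
Local Open Scope complex_scope.
Local Open Scope ring_scope.
Set Implicit Arguments.
Unset Strict Implicit.
Unset Printing Implicit Defensive.

(** The Gauss map is a minimal immersion with the prescribed data.

    Write X = phi_x, Y = phi_y, E = e^(2u).  The metric, the vanishing of the
    mean curvature and the Hopf differential prescribe both fundamental forms
    of phi, hence the derivatives of the frame (X, Y, phi, N): these are the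
    Gauss-Weingarten equations [gauss_xx], ..., [weingarten_y].  Up to the
    factor 1/sqrt 2 the Gauss map is W = E^-1 X /\ Y + N /\ phi, and it lies in
    Lambda_+ because N /\ phi is the dual of the tangent plane
    ([normal_plane_dual]).  Differentiating W with the frame equations gives
    W_x and W_y as combinations of the two orthogonal bivectors
    N /\ X + phi /\ Y and N /\ Y - phi /\ X, both of square norm 2 E, and then
    W_xx + W_yy = 4 cosh(2u) W.  So the Gauss map is harmonic, its metric is
    explicit ([gauss_metric]), and adding the square of the differential of the
    harmonic function h = 2 Im(z e^(it/2)) makes it conformal with factor
    4 cosh^2 u: a conformal harmonic immersion is minimal
    ([gauss_map_minimal]).

    Every other associated immersion is congruent to it.

    Let (F, h) be associated with u.  Since F takes values in the
    three-dimensional space Lambda_+, write it in coordinates as f.  Conformality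
    and the Hopf differential determine the differential of h up to a sign.  In
    the orthonormal directions
      d_s = cos(t/2) d_x - sin(t/2) d_y,   d_r = sin(t/2) d_x + cos(t/2) d_y
    they say that h_s = 0, h_r = +-2, that f_s and f_r are orthogonal, and that
    |f_s|^2 = 4 cosh^2 u, |f_r|^2 = 4 sinh^2 u.  If Y is f_s turned by a right
    angle, then f_r = (tau / 4 cosh^2 u) Y with tau^2 = S^2, S = 2 sinh(2u).

    The sign relating tau to S could a priori change where u vanishes, and this
    is the only analytic difficulty.  By the equation of u, the function S
    solves a linear equation Delta S = q S with q smooth.  Hence so do
    tau - S and tau + S: outside a nowhere dense set each of them is locally 0
    or a multiple of S.  Where one of them is nonzero the other vanishes near
    by, since their product is 0, and then it vanishes on the whole domain by
    unique continuation ([smooth_square_root]).  So, after replacing Y by -Y if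
    necessary, f_r = (S / 4 cosh^2 u) Y.

    Unique continuation ([unique_continuation]) is proved with a frequency
    function.  On the circle of radius e^s put a = v_x, b = -v_y,
      H(s) = int (v^2 + a^2 + b^2),   M(s) = int (a b_th - b a_th).
    Up to terms controlled by H one has H' = 2 M, and the Cauchy-Schwarz
    inequality bounds (M / H)' from below.  So M / H is bounded above as s
    decreases, it bounds the logarithmic derivative of H, and H cannot leave the
    value 0 ([frequency_bound]).

    Finally minimality says that f_ss + f_rr is orthogonal to Y.  With this, the
    derivatives of the frame (f, f_s, Y) have coefficients that depend on u
    only.  For two such surfaces f and g the matrix
      - f (x) g + (f_s (x) g_s + Y (x) Y') / 4 cosh^2 u
    is therefore constant; at each point it is the linear isometry carrying the
    frame of f to that of g, so this isometry does not depend on the point and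
    maps f to g ([adapted_rigidity]).  Together with h |-> +-h + const it gives
    the isometry of H^2 x R ([minimal_congruence]). *)

(** * Mean value estimates and the chain rule in the plane *)

Section Axis.
Context {R : realType}.
Implicit Types (V : normedModType R) (z : R * R).

Lemma is_derive_xP V (f : R * R -> V) z df :
  is_derive z ((1, 0) : R * R) f df <-> is_derive z.1 1 (fun x => f (x, z.2)) df.
Proof.
suff E : (fun h : R => h^-1 *: ((f \o shift z) (h *: ((1, 0) : R * R)) - f z)) =
  (fun h : R => h^-1 *: (((fun x => f (x, z.2)) \o shift z.1) (h *: 1) - (fun x => f (x, z.2)) z.1)).
  by split=> -[d <-]; split; move: d; rewrite /derivable /derive E.
apply/funext => h /=; congr (_ *: (f _ - f _)); last by case: z.
by congr (_, _); rewrite /= ?mulr0 ?add0r ?scaler0 ?add0r.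
Qed.

Lemma is_derive_yP V (f : R * R -> V) z df :
  is_derive z ((0, 1) : R * R) f df <-> is_derive z.2 1 (fun y => f (z.1, y)) df.
Proof.
suff E : (fun h : R => h^-1 *: ((f \o shift z) (h *: ((0, 1) : R * R)) - f z)) =
  (fun h : R => h^-1 *: (((fun y => f (z.1, y)) \o shift z.2) (h *: 1) - (fun y => f (z.1, y)) z.2)).
  by split=> -[d <-]; split; move: d; rewrite /derivable /derive E.
apply/funext => h /=; congr (_ *: (f _ - f _)); last by case: z.
by congr (_, _); rewrite /= ?mulr0 ?add0r ?scaler0 ?add0r.
Qed.

Lemma MVT_between (f df : R -> R) (a b : R) :
  (forall x, Num.min a b <= x <= Num.max a b -> is_derive x 1 f (df x)) ->
  exists2 c, Num.min a b <= c <= Num.max a b & f b - f a = df c * (b - a).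
Proof.
wlog ab : a b / a <= b.
  move=> H; have /orP[|ba] := le_total a b; first exact: H.
  rewrite minC maxC => /(H _ _ ba)[c cab e]; exists c => //.
  by rewrite -opprB e -mulrN opprB.
rewrite (min_idPl ab) (max_idPr ab) => H.
have [| |c cab ->] := @MVT_segment R f df a b ab.
- by move=> x /[!in_itv]/= /andP[ax xb]; apply: H; rewrite !ltW.
- apply: derivable_within_continuous => x /[!in_itv]/= /H ?.
  exact: ex_derive.
- by exists c.
Qed.

(** Keeps the intermediate points of the mean value theorem inside a box. *)
Lemma between_ball (p e a b c : R) : `|a - p| < e -> `|b - p| < e ->
  Num.min a b <= c <= Num.max a b -> `|c - p| < e.
Proof.
by rewrite !ltr_norml /Num.min /Num.max; case: ifP => _; lra.
Qed.

Lemma MVT_x (f : R * R -> R) (a b y : R) :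
  (forall x, Num.min a b <= x <= Num.max a b -> derivable f (x, y) ((1, 0) : R * R)) ->
  exists2 c, Num.min a b <= c <= Num.max a b & f (b, y) - f (a, y) = dx f (c, y) * (b - a).
Proof.
move=> H; apply: (@MVT_between (fun x => f (x, y)) (fun x => dx f (x, y))) => x /H fx.
by have /is_derive_xP := derivableP fx.
Qed.

Lemma MVT_y (f : R * R -> R) (x a b : R) :
  (forall y, Num.min a b <= y <= Num.max a b -> derivable f (x, y) ((0, 1) : R * R)) ->
  exists2 c, Num.min a b <= c <= Num.max a b & f (x, b) - f (x, a) = dy f (x, c) * (b - a).
Proof.
move=> H; apply: (@MVT_between (fun y => f (x, y)) (fun y => dy f (x, y))) => y /H fy.
by have /is_derive_yP := derivableP fy.
Qed.

Lemma open_boxP (D : set (R * R)) z : open D -> D z ->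
  exists2 e : R, 0 < e & forall w, `|w.1 - z.1| < e -> `|w.2 - z.2| < e -> D w.
Proof.
move=> oD Dz; have /nbhs_ballP[e e0 eD] : nbhs z D by exact: open_nbhs_nbhs.
exists e => // w w1 w2; apply: eD; split; rewrite /ball/= distrC//.
Qed.

Lemma nbhs_boxP (P : set (R * R)) z : nbhs z P <->
  exists2 e : R, 0 < e & forall w, `|w.1 - z.1| < e -> `|w.2 - z.2| < e -> P w.
Proof.
split.
  move=> /nbhs_ballP[e e0 eD].
  by exists e => // w w1 w2; apply: eD; split; rewrite /ball/= distrC.
move=> [e e0 eD]; apply/nbhs_ballP; exists e => // w [/= w1 w2].
by apply: eD; rewrite distrC.
Qed.

Lemma continuous_boxP (f : R * R -> R) z : {for z, continuous f} <->
  forall eps, 0 < eps -> exists2 e : R, 0 < e &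
   forall w, `|w.1 - z.1| < e -> `|w.2 - z.2| < e -> `|f w - f z| < eps.
Proof.
split.
  move=> /cvgrPdist_lt fz eps /fz /nbhs_boxP[e e0 H]; exists e => // w w1 w2.
  by rewrite distrC; apply: H.
move=> H; apply/cvgrPdist_lt => eps /H[e e0 {}H]; apply/nbhs_boxP; exists e => // w w1 w2.
by rewrite /= distrC; apply: H.
Qed.

(** A C^1 function is differentiable: the increment is split along the two sides
    of a rectangle, and the mean value theorem is applied to each. *)
Lemma C1_growth (D : set (R * R)) (f : R * R -> R) z : open D -> Ck 1 D f -> D z ->
  forall eps, 0 < eps -> exists2 e : R, 0 < e &
   forall w, `|w.1 - z.1| < e -> `|w.2 - z.2| < e ->
   `|f w - f z - ((w.1 - z.1) * dx f z + (w.2 - z.2) * dy f z)| <=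
   eps * `|w.1 - z.1| + eps * `|w.2 - z.2|.
Proof.
move=> oD [fx fy cx cy] Dz eps eps0.
have [e1 e10 D1] := open_boxP oD Dz.
have [e2 e20 X2] := (continuous_boxP _ _).1 (cx z Dz) eps eps0.
have [e3 e30 X3] := (continuous_boxP _ _).1 (cy z Dz) eps eps0.
exists (Num.min e1 (Num.min e2 e3)) => [|[x' y'] /=]; first by rewrite !lt_min e10 e20.
rewrite !lt_min => /and3P[x1 x2 x3] /and3P[y1 y2 y3].
case: z Dz cx cy D1 X2 X3 x1 x2 x3 y1 y2 y3 => x y /= Dz _ _ D1 X2 X3 x1 x2 x3 y1 y2 y3.
have pos e : 0 < e -> `|x - x| < e by rewrite subrr normr0.
have posy e : 0 < e -> `|y - y| < e by rewrite subrr normr0.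
have [|c cxx cE] := @MVT_x f x x' y'.
  by move=> a ha; apply: fx; apply: D1 => //=; apply: between_ball ha => //; apply: pos.
have [|d dyy dE] := @MVT_y f x y y'.
  move=> a ha; apply: fy; apply: D1 => /=; first exact: pos.
  by apply: between_ball ha => //; apply: posy.
have cb p e h1 h2 := @between_ball p e x x' c h1 h2 cxx.
have db p e h1 h2 := @between_ball p e y y' d h1 h2 dyy.
have -> : f (x', y') - f (x, y) - ((x' - x) * dx f (x, y) + (y' - y) * dy f (x, y)) =
  (dx f (c, y') - dx f (x, y)) * (x' - x) + (dy f (x, d) - dy f (x, y)) * (y' - y).
  have -> : f (x', y') - f (x, y) = (f (x', y') - f (x, y')) + (f (x, y') - f (x, y)) by ring.
  by rewrite cE dE; ring.
apply: le_trans (ler_normD _ _) _; rewrite !normrM; apply: lerD; apply: ler_wpM2r => //.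
  by apply/ltW/X2 => //=; apply: cb => //; apply: pos.
by apply/ltW/X3 => /=; [exact: pos|apply: db => //; apply: posy].
Qed.

Lemma C1_continuous (D : set (R * R)) (f : R * R -> R) z : open D -> Ck 1 D f -> D z ->
  {for z, continuous f}.
Proof.
move=> oD f1 Dz; apply/continuous_boxP => eps eps0.
have [e e0 H] := C1_growth oD f1 Dz ltr01.
set K := 2 + `|dx f z| + `|dy f z|.
have K0 : 0 < K by rewrite /K -addrA ltr_wpDr ?addr_ge0.
exists (Num.min e (eps / K)) => [|w]; first by rewrite lt_min e0 divr_gt0.
rewrite !lt_min => /andP[a1 a2] /andP[b1 b2].
have := H w a1 b1; set a := w.1 - z.1 in a1 a2 *; set b := w.2 - z.2 in b1 b2 *.
set p := dx f z; set q := dy f z => {}H.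
have E : f w - f z = (f w - f z - (a * p + b * q)) + (a * p + b * q) by rewrite subrK.
rewrite E; apply: le_lt_trans (ler_normD _ _) _.
apply: le_lt_trans (lerD H (ler_normD _ _)) _; rewrite !normrM !mul1r.
have -> : eps = eps / K * K by rewrite divfK// gt_eqF.
move: a2 b2; rewrite /K -/p -/q; set t := eps / _.
move: (normr_ge0 p) (normr_ge0 q); move: (`|a|) (`|b|) (`|p|) (`|q|) t.
move=> A B P Q t P0 Q0 a2 b2; rewrite addrACA.
have -> : t * (2 + P + Q) = (t + t * P) + (t + t * Q) by ring.
by apply: ltrD; apply: ltr_leD => //; apply: ler_wpM2r => //; apply: ltW.
Qed.

Lemma Ck_le (D : set (R * R)) k (f : R * R -> R) : open D -> Ck k.+1 D f -> Ck k D f.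
Proof.
move=> oD; elim: k f => [f f1 z Dz|k IH f [fx fy /IH cx /IH cy]].
  exact: C1_continuous oD f1 Dz.
by split.
Qed.

(** Along the curve the remainder in [C1_growth] is negligible with respect to the
    increment of the parameter, because the difference quotients of the curve are
    bounded. *)
Lemma chain_curve (D : set (R * R)) (f : R * R -> R) (g1 g2 : R -> R) (s d1 d2 : R) :
  open D -> Ck 1 D f -> D (g1 s, g2 s) ->
  is_derive s 1 g1 d1 -> is_derive s 1 g2 d2 ->
  is_derive s 1 (fun r => f (g1 r, g2 r))
   (d1 * dx f (g1 s, g2 s) + d2 * dy f (g1 s, g2 s)).
Proof.
move=> oD f1 Dz G1 G2.
set z := (g1 s, g2 s).
have L (g : R -> R) d : is_derive s 1 g d -> h^-1 *: (g (h + s) - g s) @[h --> 0^'] --> d.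
  move=> [dg <-]; move: dg; rewrite /derivable /derive.
  suff -> : (fun h : R => h^-1 *: ((g \o shift s) (h *: 1) - g s)) =
            (fun h : R => h^-1 *: (g (h + s) - g s)) by [].
  by apply/funext => h /=; rewrite [h *: 1]mulr1.
suff H : h^-1 *: (f (g1 (h + s), g2 (h + s)) - f z) @[h --> 0^'] -->
    d1 * dx f z + d2 * dy f z.
  have E : (fun h : R => h^-1 *: (((fun r => f (g1 r, g2 r)) \o shift s) (h *: 1) - f z)) =
       (fun h => h^-1 *: (f (g1 (h + s), g2 (h + s)) - f z)).
    by apply/funext => h /=; rewrite [h *: 1]mulr1.
  split; first by apply/cvg_ex; exists (d1 * dx f z + d2 * dy f z); rewrite E.
  by rewrite /derive E; apply/cvg_lim.
have cg (g : R -> R) d : is_derive s 1 g d -> g (h + s) @[h --> 0^'] --> g s.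
  move=> [/derivable1_diffP/differentiable_continuous gs _].
  apply: cvg_within_filter; apply: (@cvg_comp _ _ _ (fun h => h + s) g _ (nbhs s)) => //.
  have: (fun h : R => h + s) @ nbhs (0 : R) --> (0 + s : R).
    by apply: cvgD; [exact: cvg_id|exact: cvg_cst].
  by rewrite add0r.
pose q1 h := h^-1 *: (g1 (h + s) - g1 s); pose q2 h := h^-1 *: (g2 (h + s) - g2 s).
have main : (q1 h * dx f z + q2 h * dy f z) @[h --> 0^'] --> d1 * dx f z + d2 * dy f z.
  by apply: cvgD; apply: cvgM; [exact: L|exact: cvg_cst|exact: L|exact: cvg_cst].
apply/cvgrPdist_le => eps eps0.
have eps2 : 0 < eps / 2 by rewrite divr_gt0.
pose K := `|d1| + `|d2| + 2.
have K0 : 0 < K by rewrite /K ltr_wpDl ?addr_ge0.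
have [e e0 G] := C1_growth oD f1 Dz (divr_gt0 eps2 K0).
have /cvgrPdist_le/(_ _ eps2) M := main.
have /cvgrPdist_le/(_ _ ltr01) B1 := L _ _ G1; have /cvgrPdist_le/(_ _ ltr01) B2 := L _ _ G2.
have /cvgrPdist_lt/(_ _ e0) C1 := cg _ _ G1; have /cvgrPdist_lt/(_ _ e0) C2 := cg _ _ G2.
near=> h.
have h0 : h != 0 by near: h; exact: nbhs_dnbhs_neq.
have Mh : `|d1 * dx f z + d2 * dy f z - (q1 h * dx f z + q2 h * dy f z)| <= eps / 2 by near: h.
have B1h : `|d1 - q1 h| <= 1 by near: h.
have B2h : `|d2 - q2 h| <= 1 by near: h.
have C1h : `|g1 s - g1 (h + s)| < e by near: h.
have C2h : `|g2 s - g2 (h + s)| < e by near: h.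
rewrite distrC in C1h; rewrite distrC in C2h.
have Gh := G (g1 (h + s), g2 (h + s)) C1h C2h.
clear C1h C2h.
have Q : `|h^-1 *: (f (g1 (h + s), g2 (h + s)) - f z) - (q1 h * dx f z + q2 h * dy f z)|
    <= eps / 2 / K * (`|q1 h| + `|q2 h|).
  have -> : h^-1 *: (f (g1 (h + s), g2 (h + s)) - f z) - (q1 h * dx f z + q2 h * dy f z) =
     h^-1 * (f (g1 (h + s), g2 (h + s)) - f z -
     ((g1 (h + s) - g1 s) * dx f z + (g2 (h + s) - g2 s) * dy f z)).
    rewrite /q1 /q2 /GRing.scale/=; ring.
  rewrite normrM; apply: le_trans (ler_wpM2l _ Gh) _; first exact: normr_ge0.
  by rewrite /q1 /q2 /GRing.scale/= !normrM -!mulrDr mulrCA.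
have Qb : `|q1 h| + `|q2 h| <= K.
  have := ler_normB d1 (d1 - q1 h); have := ler_normB d2 (d2 - q2 h).
  rewrite !subKr /K; move: B1h B2h; clear.
  move: (`|q1 h|) (`|q2 h|) (`|d1 - q1 h|) (`|d2 - q2 h|) (`|d1|) (`|d2|); clear.
  by move=> *; lra.
have : eps / 2 / K * (`|q1 h| + `|q2 h|) <= eps / 2.
  rewrite -[leRHS](divfK (lt0r_neq0 K0)); apply: ler_wpM2l Qb.
  by rewrite divr_ge0// ltW.
move: Mh Q; set A := d1 * _ + _; set B := q1 h * _ + _; set C := h^-1 *: _ => Mh Q.
have := ler_normB (A - B) (C - B).
have -> : A - B - (C - B) = A - C by rewrite opprB addrA subrK.
by move=> h1 h2; rewrite (splitr eps) (le_trans h1)// lerD// (le_trans Q).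
Unshelve. all: by end_near. Qed.

End Axis.

(** * Smooth functions on an open set *)

Section Rules.
Context {R : realType} {V : normedModType R}.
Implicit Types (f g : V -> R) (z v : V) (df dg : R).

Lemma dvD f g z v df dg : is_derive z v f df -> is_derive z v g dg ->
  is_derive z v (fun w => f w + g w) (df + dg).
Proof. by move=> ? ?; apply: is_deriveD. Qed.

Lemma dvN f z v df : is_derive z v f df -> is_derive z v (fun w => - f w) (- df).
Proof. by move=> ?; apply: is_deriveN. Qed.

Lemma dvC (c : R) z v : is_derive z v (fun _ => c) 0.
Proof. exact: is_derive_cst. Qed.

Lemma dvM f g z v df dg : is_derive z v f df -> is_derive z v g dg ->
  is_derive z v (fun w => f w * g w) (df * g z + f z * dg).
Proof.
move=> hf hg; have [h1 h2] : is_derive z v (f * g) (f z *: dg + g z *: df).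
  exact: is_deriveM.
split; first exact: h1.
by rewrite [LHS]h2 addrC [g z *: _]mulrC.
Qed.

Lemma dvV f z v df : f z != 0 -> is_derive z v f df ->
  is_derive z v (fun w => (f w)^-1) (- df * (f z)^-1 * (f z)^-1).
Proof.
move=> fz [f1 <-]; split; first exact: derivableV.
by rewrite deriveV// /GRing.scale/= expr2 invfM !mulNr -[in RHS]mulrA [in RHS]mulrC.
Qed.

(** Differentiation along v is differentiation at 0 of the restriction to a line,
    which reduces this chain rule to the one-variable one. *)
Lemma dv_comp (h : R -> R) f z v dh df : is_derive (f z) 1 h dh -> is_derive z v f df ->
  is_derive z v (fun w => h (f w)) (dh * df).
Proof.
move=> hd [f1 fe].
pose l (r : R) := f (r *: v + z).
have l1 : is_derive (0 : R) 1 l df.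
  split; first exact: (derivable1P _ _ _).1 f1.
  rewrite -fe /derive /l; suff -> : 
    (fun h : R => h^-1 *: (((fun r => f (r *: v + z)) \o shift 0) (h *: 1) - f (0 *: v + z)))
   = (fun h : R => h^-1 *: ((f \o shift z) (h *: v) - f z)) by [].
  by apply/funext => r /=; rewrite addr0 scale0r add0r [r *: 1]mulr1.
have lz : l 0 = f z by rewrite /l scale0r add0r.
rewrite -lz in hd.
have c := @is_derive1_comp R h l 0 dh df hd l1.
have [c1 ce] := c.
split; first exact: (derivable1P _ _ _).2 c1.
rewrite -ce /derive; suff -> : 
    (fun r : R => r^-1 *: (((h \o l) \o shift 0) (r *: 1) - (h \o l) 0))
   = (fun r : R => r^-1 *: (((fun w => h (f w)) \o shift z) (r *: v) - h (f z))) by [].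
by apply/funext => r /=; rewrite addr0 lz /l [r *: 1]mulr1.
Qed.

Lemma dv_eq f z v df dg : is_derive z v f df -> df = dg -> is_derive z v f dg.
Proof. by move=> ? <-. Qed.

End Rules.

Section Planar.
Context {R : realType}.
Implicit Types (D : set (R * R)).

Lemma dx_fst (z : R * R) : is_derive z ((1, 0) : R * R) (@fst R R) 1.
Proof. by apply/is_derive_xP. Qed.
Lemma dy_fst (z : R * R) : is_derive z ((0, 1) : R * R) (@fst R R) 0.
Proof. by apply/is_derive_yP; exact: is_derive_cst. Qed.
Lemma dx_snd (z : R * R) : is_derive z ((1, 0) : R * R) (@snd R R) 0.
Proof. by apply/is_derive_xP; exact: is_derive_cst. Qed.
Lemma dy_snd (z : R * R) : is_derive z ((0, 1) : R * R) (@snd R R) 1.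
Proof. by apply/is_derive_yP. Qed.

Section Ck.
Variable D : set (R * R).
Hypothesis oD : open D.

Lemma near_D z : D z -> \forall w \near z, D w.
Proof. by move=> Dz; apply: open_nbhs_nbhs. Qed.

Lemma dx_val {V : normedModType R} (f : R * R -> V) z d :
  is_derive z ((1, 0) : R * R) f d -> dx f z = d.
Proof. by case. Qed.
Lemma dy_val {V : normedModType R} (f : R * R -> V) z d :
  is_derive z ((0, 1) : R * R) f d -> dy f z = d.
Proof. by case. Qed.

Section Ext.
Context {V : normedModType R}.
Implicit Types f g : R * R -> V.

Lemma near_ext f g : (forall z, D z -> f z = g z) -> forall z, D z ->
  \forall w \near z, f w = g w.
Proof. by move=> fg z /near_D; apply: filterS. Qed.

Lemma dx_ext f g : (forall z, D z -> f z = g z) -> forall z, D z -> dx f z = dx g z.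
Proof. by move=> fg z Dz; apply: near_eq_derive; exact: near_ext. Qed.

Lemma dy_ext f g : (forall z, D z -> f z = g z) -> forall z, D z -> dy f z = dy g z.
Proof. by move=> fg z Dz; apply: near_eq_derive; exact: near_ext. Qed.

Lemma Ck_ext k f g : (forall z, D z -> f z = g z) -> Ck k D f -> Ck k D g.
Proof.
elim: k f g => [|k IH] f g fg.
  move=> cf z Dz; have : f @ z --> f z := cf z Dz.
  rewrite (fg _ Dz) => h; apply: cvg_trans h; apply: near_eq_cvg.
  by apply: filterS (near_ext fg Dz).
move=> [fx fy cx cy]; split.
- by move=> z Dz; apply: near_eq_derivable (fx z Dz); exact: near_ext.
- by move=> z Dz; apply: near_eq_derivable (fy z Dz); exact: near_ext.
- by apply: IH cx; exact: dx_ext.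
- by apply: IH cy; exact: dy_ext.
Qed.

Lemma smooth_ext f g : (forall z, D z -> f z = g z) -> smooth D f -> smooth D g.
Proof. by move=> fg fk k; apply: Ck_ext fg (fk k). Qed.

Lemma smooth_dx f : smooth D f -> smooth D (dx f).
Proof. by move=> fk k; case: (fk k.+1). Qed.
Lemma smooth_dy f : smooth D f -> smooth D (dy f).
Proof. by move=> fk k; case: (fk k.+1). Qed.

Lemma smooth_isdx f z : smooth D f -> D z -> is_derive z ((1, 0) : R * R) f (dx f z).
Proof. by move=> fk Dz; case: (fk 1%N) => h _ _ _; apply: derivableP; apply: h. Qed.
Lemma smooth_isdy f z : smooth D f -> D z -> is_derive z ((0, 1) : R * R) f (dy f z).
Proof. by move=> fk Dz; case: (fk 1%N) => _ h _ _; apply: derivableP; apply: h. Qed.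
Lemma smooth_cont f z : smooth D f -> D z -> {for z, continuous f}.
Proof. by move=> fk Dz; apply: (fk 0%N). Qed.

Lemma Ck_cst k (c : V) : Ck k D (fun=> c).
Proof.
elim: k c => [|k IH] c; first by move=> z _; apply: cvg_cst.
split.
- by move=> z _; exact: derivable_cst.
- by move=> z _; exact: derivable_cst.
- by apply: Ck_ext (IH 0) => z Dz; rewrite /dx derive_cst.
- by apply: Ck_ext (IH 0) => z Dz; rewrite /dy derive_cst.
Qed.

Lemma smooth_cst (c : V) : smooth D (fun=> c).
Proof. by move=> k; exact: Ck_cst. Qed.

End Ext.

Implicit Types f g : R * R -> R.

Lemma Ck_isdx k f z : Ck k.+1 D f -> D z -> is_derive z ((1, 0) : R * R) f (dx f z).
Proof. by move=> [h _ _ _] Dz; apply: derivableP; apply: h. Qed.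
Lemma Ck_isdy k f z : Ck k.+1 D f -> D z -> is_derive z ((0, 1) : R * R) f (dy f z).
Proof. by move=> [_ h _ _] Dz; apply: derivableP; apply: h. Qed.

Lemma Ck_dx k f : Ck k.+1 D f -> Ck k D (dx f). Proof. by case. Qed.
Lemma Ck_dy k f : Ck k.+1 D f -> Ck k D (dy f). Proof. by case. Qed.

(** Builds regularity of order k+1 from closed formulas for both derivatives, which
    is how all the closure properties below are proved by induction on k. *)
Lemma CkS k f (fx fy : R * R -> R) :
  (forall z, D z -> is_derive z ((1, 0) : R * R) f (fx z)) ->
  (forall z, D z -> is_derive z ((0, 1) : R * R) f (fy z)) ->
  Ck k D fx -> Ck k D fy -> Ck k.+1 D f.
Proof.
move=> hx hy cx cy; split.
- by move=> z /hx [].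
- by move=> z /hy [].
- by apply: Ck_ext cx => z /hx [_ <-].
- by apply: Ck_ext cy => z /hy [_ <-].
Qed.

Lemma CkD k f g : Ck k D f -> Ck k D g -> Ck k D (fun w => f w + g w).
Proof.
elim: k f g => [|k IH] f g.
  by move=> cf cg z Dz; apply: cvgD; [exact: cf|exact: cg].
move=> cf cg; apply: (@CkS _ _ (fun w => dx f w + dx g w) (fun w => dy f w + dy g w)).
- by move=> z Dz; apply: dvD; [exact: Ck_isdx cf Dz|exact: Ck_isdx cg Dz].
- by move=> z Dz; apply: dvD; [exact: Ck_isdy cf Dz|exact: Ck_isdy cg Dz].
- by apply: IH; exact: Ck_dx.
- by apply: IH; exact: Ck_dy.
Qed.

Lemma CkM k f g : Ck k D f -> Ck k D g -> Ck k D (fun w => f w * g w).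
Proof.
elim: k f g => [|k IH] f g.
  by move=> cf cg z Dz; apply: cvgM; [exact: cf|exact: cg].
move=> cf cg; have cf' := Ck_le oD cf; have cg' := Ck_le oD cg.
apply: (@CkS _ _ (fun w => dx f w * g w + f w * dx g w)
                 (fun w => dy f w * g w + f w * dy g w)).
- by move=> z Dz; apply: dvM; [exact: Ck_isdx cf Dz|exact: Ck_isdx cg Dz].
- by move=> z Dz; apply: dvM; [exact: Ck_isdy cf Dz|exact: Ck_isdy cg Dz].
- by apply: CkD; apply: IH => //; exact: Ck_dx.
- by apply: CkD; apply: IH => //; exact: Ck_dy.
Qed.

Lemma smoothD f g : smooth D f -> smooth D g -> smooth D (fun w => f w + g w).
Proof. by move=> hf hg k; apply: CkD. Qed.
Lemma smoothM f g : smooth D f -> smooth D g -> smooth D (fun w => f w * g w).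
Proof. by move=> hf hg k; apply: CkM. Qed.
Lemma smoothN f : smooth D f -> smooth D (fun w => - f w).
Proof.
move=> hf; apply: (@smooth_ext _ (fun w => -1 * f w)); first by move=> z _; rewrite mulN1r.
by apply: smoothM => //; exact: smooth_cst.
Qed.

Lemma smooth_expR f : smooth D f -> smooth D (fun w => expR (f w)).
Proof.
move=> hf k; elim: k => [|k IH].
  move=> z Dz; apply: continuous_comp; first exact: smooth_cont.
  exact: continuous_expR.
apply: (@CkS _ _ (fun w => expR (f w) * dx f w) (fun w => expR (f w) * dy f w)).
- by move=> z Dz; apply: dv_comp; exact: smooth_isdx.
- by move=> z Dz; apply: dv_comp; exact: smooth_isdy.
- by apply: CkM => //; exact: smooth_dx.
- by apply: CkM => //; exact: smooth_dy.
Qed.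

Lemma smoothV f : (forall z, D z -> f z != 0) -> smooth D f -> smooth D (fun w => (f w)^-1).
Proof.
move=> f0 hf k; elim: k => [|k IH].
  by move=> z Dz; apply: cvgV; [exact: f0|exact: smooth_cont].
apply: (@CkS _ _ (fun w => - dx f w * (f w)^-1 * (f w)^-1)
                 (fun w => - dy f w * (f w)^-1 * (f w)^-1)).
- by move=> z Dz; apply: dvV; [exact: f0|exact: smooth_isdx].
- by move=> z Dz; apply: dvV; [exact: f0|exact: smooth_isdy].
- by apply: CkM => //; apply: CkM => //; apply: smoothN; exact: smooth_dx.
- by apply: CkM => //; apply: CkM => //; apply: smoothN; exact: smooth_dy.
Qed.

Lemma smooth_fst : smooth D (@fst R R).
Proof.
case=> [|k]; first by move=> z _; exact: cvg_fst.
apply: (@CkS _ _ (fun=> 1) (fun=> 0)); try exact: Ck_cst.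
- by move=> z _; exact: dx_fst.
- by move=> z _; exact: dy_fst.
Qed.
Lemma smooth_snd : smooth D (@snd R R).
Proof.
case=> [|k]; first by move=> z _; exact: cvg_snd.
apply: (@CkS _ _ (fun=> 0) (fun=> 1)); try exact: Ck_cst.
- by move=> z _; exact: dx_snd.
- by move=> z _; exact: dy_snd.
Qed.

End Ck.
End Planar.

(** * Connectedness, symmetry of second derivatives, vector-valued maps *)

Section Connected.
Context {R : realType}.
Variable D : set (R * R).
Hypotheses (oD : open D) (cD : connected D).

(** P and its complement are both open in D, so P is everything: connectedness
    in the form in which local properties propagate. *)
Lemma connected_spread (P : set (R * R)) z0 : D z0 -> P z0 ->
  (forall z, D z -> P z -> \forall w \near z, P w) ->
  (forall z, D z -> ~ P z -> \forall w \near z, ~ P w) ->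
  forall z, D z -> P z.
Proof.
move=> Dz0 Pz0 Pop Pcl.
suff E : D `&` P = D by move=> z; rewrite -E => -[].
have op (Q : set (R * R)) : (forall z, D z -> Q z -> \forall w \near z, Q w) -> open (D `&` Q).
  move=> H; rewrite openE => z [Dz Qz]; apply: filterI; last exact: H.
  exact: near_D.
apply: cD; first by exists z0.
  exists (D `&` P); first exact: op.
  by rewrite setIA setIid.
exists (~` (D `&` ~` P)); first by apply: open_closedC; exact: op.
apply/seteqP; split=> z [Dz H]; split => //; first by case.
by apply: contrapT => nP; apply: H.
Qed.

Lemma constant_on_domain (f : R * R -> R) :
  (forall z, D z -> is_derive z ((1, 0) : R * R) f 0) ->
  (forall z, D z -> is_derive z ((0, 1) : R * R) f 0) ->
  forall z w, D z -> D w -> f z = f w.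
Proof.
move=> fx fy z w Dz Dw.
have loc y : D y -> \forall t \near y, f t = f y.
  case: y => y1 y2 Dy; apply/nbhs_boxP; have [e e0 H] := open_boxP oD Dy.
  exists e => // -[t1 t2] /= t1e t2e.
  have s1 : `|y1 - y1| < e by rewrite subrr normr0.
  have s2 : `|y2 - y2| < e by rewrite subrr normr0.
  have [|c cx E1] := @MVT_x _ f y1 t1 t2.
    by move=> x hx; apply: ex_derive; apply: fx; apply: H => //=; exact: between_ball hx.
  have [|d dy_ E2] := @MVT_y _ f y1 y2 t2.
    by move=> x hx; apply: ex_derive; apply: fy; apply: H => //=; exact: between_ball hx.
  apply/eqP; rewrite -subr_eq0; apply/eqP.
  have -> : f (t1, t2) - f (y1, y2) = (f (t1, t2) - f (y1, t2)) + (f (y1, t2) - f (y1, y2)).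
    by rewrite addrA subrK.
  rewrite E1 E2 /dx /dy.
  have [_ ->] : is_derive (c, t2) ((1, 0) : R * R) f 0.
    by apply: fx; apply: H => //=; exact: between_ball cx.
  have [_ ->] : is_derive (y1, d) ((0, 1) : R * R) f 0.
    by apply: fy; apply: H => //=; exact: between_ball dy_.
  by rewrite !mul0r addr0.
apply: (@connected_spread (fun t => f t = f w) w Dw) => // t Dt ft.
  by apply: filterS (loc t Dt) => x ->.
by apply: filterS (loc t Dt) => x ->.
Qed.

Lemma no_common_half (p q r : R) : `|p - r| < `|q - r| / 2 -> `|p - q| < `|q - r| / 2 -> False.
Proof.
move=> h1; rewrite distrC => h2; have := ltrD h2 h1; rewrite -splitr => /(le_lt_trans (ler_normD _ _)).
by rewrite addrA subrK ltxx.
Qed.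

(** The second difference of f over a small square is, by two applications of the
    mean value theorem in either order, both dx (dy f) and dy (dx f) at nearby
    points. *)
Lemma Schwarz (f : R * R -> R) z : Ck 2 D f -> D z -> dx (dy f) z = dy (dx f) z.
Proof.
case: z => x y f2 Dz.
have fx := Ck_dx f2; have fy := Ck_dy f2; have f1 := Ck_le oD f2.
have cA := Ck_dy fx; have cB := Ck_dx fy.
apply/eqP; apply: contraT => ne.
have eps0 : 0 < `|dx (dy f) (x, y) - dy (dx f) (x, y)| / 2.
  by rewrite divr_gt0// normr_gt0 subr_eq0.
set eps := `|dx (dy f) (x, y) - dy (dx f) (x, y)| / 2 in eps0.
have [e1 e10 D1] := open_boxP oD Dz.
have [e2 e20 A2] := (continuous_boxP _ _).1 (cA _ Dz) eps eps0.
have [e3 e30 B3] := (continuous_boxP _ _).1 (cB _ Dz) eps eps0.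
pose e := Num.min e1 (Num.min e2 e3).
have e0 : 0 < e by rewrite !lt_min e10 e20.
pose h := e / 2.
have h0 : 0 < h by rewrite divr_gt0.
have he : h < e by rewrite /h ltr_pdivrMr// mulr_natr mulr2n ltrDl.
have sx : `|x - x| < e by rewrite subrr normr0.
have sy : `|y - y| < e by rewrite subrr normr0.
have hx : `|(x + h) - x| < e by rewrite addrAC subrr add0r gtr0_norm.
have hy : `|(y + h) - y| < e by rewrite addrAC subrr add0r gtr0_norm.
have De a b : `|a - x| < e -> `|b - y| < e -> D (a, b).
  by rewrite !lt_min => /and3P[a1 _ _] /and3P[b1 _ _]; apply: D1.
clearbody h.
(* the second difference, read by rows and by columns *)
pose S := f (x + h, y + h) - f (x + h, y) - (f (x, y + h) - f (x, y)).
have [c [d [cb db SA]]] : exists c d, [/\ `|c - x| < e, `|d - y| < e & S = dy (dx f) (c, d) * h * h].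
  have [|c cb E] := @MVT_between _ (fun t => f (t, y + h) - f (t, y))
     (fun t => dx f (t, y + h) - dx f (t, y)) x (x + h).
    move=> t tb; have tx := between_ball sx hx tb.
    by apply: is_deriveB; apply: ((is_derive_xP f (t, _) _).1);
      apply: Ck_isdx f1 _ => //; exact: De.
  have cx := between_ball sx hx cb.
  have [|d db E2] := @MVT_y _ (dx f) c y (y + h).
    by move=> t tb; apply: ex_derive; apply: Ck_isdy fx _; apply: De => //; exact: between_ball tb.
  exists c, d; split; [exact: cx|exact: between_ball db|].
  rewrite /S E E2; congr (_ * _ * _); by rewrite addrAC subrr add0r.
have [c' [d' [cb' db' SB]]] : exists c d, [/\ `|c - x| < e, `|d - y| < e & S = dx (dy f) (c, d) * h * h].
  have [|d' db' E] := @MVT_between _ (fun t => f (x + h, t) - f (x, t))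
     (fun t => dy f (x + h, t) - dy f (x, t)) y (y + h).
    move=> t tb; have tx := between_ball sy hy tb.
    by apply: is_deriveB; apply: ((is_derive_yP f (_, t) _).1);
      apply: Ck_isdy f1 _ => //; exact: De.
  have cx := between_ball sy hy db'.
  have [|c' cb' E2] := @MVT_x _ (dy f) x (x + h) d'.
    by move=> t tb; apply: ex_derive; apply: Ck_isdx fy _; apply: De => //; exact: between_ball tb.
  exists c', d'; split; [exact: between_ball cb'|exact: cx|].
  have -> : S = f (x + h, y + h) - f (x, y + h) - (f (x + h, y) - f (x, y)).
    by rewrite /S !opprB !addrA; ring.
  rewrite E E2; congr (_ * _ * _); by rewrite addrAC subrr add0r.
clearbody S.
have AB : dy (dx f) (c, d) = dx (dy f) (c', d').
  have hn := lt0r_neq0 h0; move: SA; rewrite SB => /(mulIf hn)/(mulIf hn) /esym.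
  exact.
have {cb db}cA' : `|dy (dx f) (c, d) - dy (dx f) (x, y)| < eps.
  by move: cb db; rewrite !lt_min => /and3P[_ a2 _] /and3P[_ b2 _]; apply: A2.
have {cb' db'}cB' : `|dx (dy f) (c', d') - dx (dy f) (x, y)| < eps.
  by move: cb' db'; rewrite !lt_min => /and3P[_ _ a2] /and3P[_ _ b2]; apply: B3.
rewrite AB in cA'; by case: (no_common_half cA' cB').
Qed.

Lemma smooth_Schwarz (f : R * R -> R) z : smooth D f -> D z -> dx (dy f) z = dy (dx f) z.
Proof. by move=> /(_ 2%N); exact: Schwarz. Qed.

End Connected.

Section Components.
Context {R : realType}.

Lemma is_derive_mxP {V : normedModType R} m n (M : V -> 'M[R]_(m, n)) z v d :
  is_derive z v M d <-> forall i j, is_derive z v (fun w => M w i j) (d i j).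
Proof.
split=> [[M1 M2] i j|H].
  split; first by apply: (derivable_mxP _ _ _).1.
  by rewrite -M2 derive_mx// mxE.
have M1 : derivable M z v by apply/derivable_mxP => i j; case: (H i j).
split=> //; rewrite derive_mx//; apply/matrixP => i j; rewrite mxE.
by case: (H i j).
Qed.

Lemma is_derive_pairP {V W1 W2 : normedModType R} (P : V -> W1 * W2) z v d :
  is_derive z v P d <-> is_derive z v (fun w => (P w).1) d.1 /\ is_derive z v (fun w => (P w).2) d.2.
Proof.
have L (W : normedModType R) (f : V -> W) e : is_derive z v f e <->
    h^-1 *: ((f \o shift z) (h *: v) - f z) @[h --> 0^'] --> e.
  split=> [[f1 <-]|h]; first exact: f1.
  split; first exact: (cvgP e h).
  by apply: cvg_lim.
split=> [/L H|[/L H1 /L H2]].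
- split; apply/L.
  + have c : (@fst W1 W2) @ d --> d.1 by case: (d) => d1 d2; exact: cvg_fst.
    exact: (cvg_comp _ _ H c).
  + have c : (@snd W1 W2) @ d --> d.2 by case: (d) => d1 d2; exact: cvg_snd.
    exact: (cvg_comp _ _ H c).
- apply/L; case: d H1 H2 => d1 d2 /= H1 H2.
  exact: cvg_pair H1 H2.
Qed.

Lemma continuous_mxP m n (T : topologicalType) (M : T -> 'M[R]_(m, n)) z :
  {for z, continuous M} <-> forall i j, {for z, continuous (fun w => M w i j)}.
Proof.
split=> [c i j|H].
  apply: (@continuous_comp _ _ _ M (fun A : 'M[R]_(m, n) => A i j)) => //.
  exact: coord_continuous.
apply/cvgrPdist_le => /= e e0.
near=> x.
rewrite /Num.Def.normr/= mx_normrE (bigmax_le _ (ltW e0))//= => i _.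
rewrite !mxE/=.
move: i; near: x; apply: filter_forall => /= i.
exact: ((cvgrPdist_le _ _).1 (H i.1 i.2)).
Unshelve. all: by end_near. Qed.

Variable D : set (R * R).
Hypothesis oD : open D.

Lemma smooth_mxP m n (M : R * R -> 'M[R]_(m, n)) :
  smooth D M <-> forall i j, smooth D (fun w => M w i j).
Proof.
suff H k : forall M : R * R -> 'M[R]_(m, n), 
    Ck k D M <-> forall i j, Ck k D (fun w => M w i j).
  by split=> [h i j k|h k]; [apply: (H k M).1|apply/H => i j; apply: h].
elim: k {M} => [|k IH] M.
  split=> [h i j z Dz|h z Dz]; first by apply: (continuous_mxP _ _).1; exact: h.
  by apply/continuous_mxP => i j; apply: h.
have E1 (v : R * R) z i j : derivable M z v -> 'D_v (fun w => M w i j) z = 'D_v M z i j.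
  by move=> h; rewrite derive_mx// mxE.
split=> [[fx fy cx cy] i j|H].
  split.
  - by move=> z Dz; apply: (derivable_mxP _ _ _).1; exact: fx.
  - by move=> z Dz; apply: (derivable_mxP _ _ _).1; exact: fy.
  - have := (IH _).1 cx i j; apply: Ck_ext => // z Dz; rewrite /dx E1//; exact: fx.
  - have := (IH _).1 cy i j; apply: Ck_ext => // z Dz; rewrite /dy E1//; exact: fy.
have fx z : D z -> derivable M z ((1, 0) : R * R).
  by move=> Dz; apply/derivable_mxP => i j; case: (H i j) => h _ _ _; exact: h.
have fy z : D z -> derivable M z ((0, 1) : R * R).
  by move=> Dz; apply/derivable_mxP => i j; case: (H i j) => _ h _ _; exact: h.
split=> //.
- apply/IH => i j; have := Ck_dx (H i j); apply: Ck_ext => // z Dz; rewrite /dx E1//; exact: fx.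
- apply/IH => i j; have := Ck_dy (H i j); apply: Ck_ext => // z Dz; rewrite /dy E1//; exact: fy.
Qed.

Lemma smooth_pairP {W1 W2 : normedModType R} (P : R * R -> W1 * W2) :
  smooth D P <-> smooth D (fun w => (P w).1) /\ smooth D (fun w => (P w).2).
Proof.
suff H k : forall P : R * R -> W1 * W2,
    Ck k D P <-> Ck k D (fun w => (P w).1) /\ Ck k D (fun w => (P w).2).
  by split=> [h|[h1 h2] k]; [split=> k; have [] := (H k P).1 (h k)|apply/H].
elim: k {P} => [|k IH] P.
  split=> [h|[h1 h2] z Dz].
    split=> z Dz; apply: (@continuous_comp _ _ _ P); [exact: h|exact: cvg_fst|exact: h|exact: cvg_snd].
  have : (fun w => ((P w).1, (P w).2)) @ z --> ((P z).1, (P z).2).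
    by apply: cvg_pair; [exact: h1|exact: h2].
  rewrite -surjective_pairing; suff -> : (fun w => ((P w).1, (P w).2)) = P by [].
  by apply/funext => w; rewrite -surjective_pairing.
have E (v z : R * R) : derivable P z v -> 
   [/\ derivable (fun w => (P w).1) z v, derivable (fun w => (P w).2) z v,
     'D_v (fun w => (P w).1) z = ('D_v P z).1 & 'D_v (fun w => (P w).2) z = ('D_v P z).2].
  by move=> /derivableP/is_derive_pairP[[a b] [c d]].
split=> [[fx fy cx cy]|[[fx fy cx cy] [gx gy dx_ dy_]]].
  have [c1 c2] := (IH _).1 cx; have [c3 c4] := (IH _).1 cy.
  by split; split; [move=> z /fx/E[]//|move=> z /fy/E[]//|
     apply: Ck_ext c1 => // z /fx/E[]|apply: Ck_ext c3 => // z /fy/E[]|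
     move=> z /fx/E[]//|move=> z /fy/E[]//|
     apply: Ck_ext c2 => // z /fx/E[]|apply: Ck_ext c4 => // z /fy/E[]].
have px z : D z -> derivable P z ((1, 0) : R * R).
  move=> Dz; have [] // : is_derive z ((1, 0) : R * R) P
    ('D_((1, 0) : R * R) (fun w => (P w).1) z, 'D_((1, 0) : R * R) (fun w => (P w).2) z).
  by apply/is_derive_pairP; split; apply: derivableP; [exact: fx|exact: gx].
have py z : D z -> derivable P z ((0, 1) : R * R).
  move=> Dz; have [] // : is_derive z ((0, 1) : R * R) P
    ('D_((0, 1) : R * R) (fun w => (P w).1) z, 'D_((0, 1) : R * R) (fun w => (P w).2) z).
  by apply/is_derive_pairP; split; apply: derivableP; [exact: fy|exact: gy].
split=> //; apply/IH; split.
- by apply: Ck_ext cx => // z /px/E[].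
- by apply: Ck_ext dx_ => // z /px/E[].
- by apply: Ck_ext cy => // z /py/E[].
- by apply: Ck_ext dy_ => // z /py/E[].
Qed.

End Components.

(** * Integrals over circles *)

Section CircleMeans.
Context {R : realType}.
Variables (D : set (R * R)) (p : R * R) (s1 : R).
Hypothesis oD : open D.

(** The radius is e^s: the derivative along s is then the Euler field, which commutes
    with rotations. *)
Definition circ (p : R * R) (s th : R) : R * R :=
  (p.1 + expR s * cos th, p.2 + expR s * sin th).

Hypothesis circD : forall s th, s < s1 -> D (circ p s th).

Definition period : set R := `[0, 2 * pi]%classic.

Definition cmean (f : R * R -> R) (s : R) : R :=
  \int[lebesgue_measure]_(th in period) f (circ p s th).

(** Derivative along s of the restriction to circles, see [circ_ds]. *)
Definition radial (f : R * R -> R) (w : R * R) : R :=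
  (w.1 - p.1) * dx f w + (w.2 - p.2) * dy f w.
(** Derivative along the angle, see [circ_dth]. *)
Definition angular (f : R * R -> R) (w : R * R) : R :=
  (w.1 - p.1) * dy f w - (w.2 - p.2) * dx f w.

Lemma smooth_radial (f : R * R -> R) : smooth D f -> smooth D (radial f).
Proof.
move=> hf; apply: smoothD => //; apply: smoothM => //.
- by apply: smoothD => //; [exact: smooth_fst|exact: smooth_cst].
- exact: smooth_dx.
- by apply: smoothD => //; [exact: smooth_snd|exact: smooth_cst].
- exact: smooth_dy.
Qed.

Lemma smooth_angular (f : R * R -> R) : smooth D f -> smooth D (angular f).
Proof.
move=> hf; apply: smoothD => //; last apply: smoothN => //; apply: smoothM => //.
- by apply: smoothD => //; [exact: smooth_fst|exact: smooth_cst].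
- exact: smooth_dy.
- by apply: smoothD => //; [exact: smooth_snd|exact: smooth_cst].
- exact: smooth_dx.
Qed.

Lemma circ_ds (f : R * R -> R) (s th : R) : smooth D f -> s < s1 ->
  is_derive s 1 (fun r => f (circ p r th)) (radial f (circ p s th)).
Proof.
move=> hf ss; have := @chain_curve R D f (fun r => p.1 + expR r * cos th)
  (fun r => p.2 + expR r * sin th) s (expR s * cos th) (expR s * sin th) oD (hf 1%N)
  (circD th ss).
rewrite /radial /circ /= ![_ + _ - _]addrAC !subrr !add0r; apply.
  have h := dvD (dvC p.1 s 1) (dvM (is_derive_expR s) (dvC (cos th) s 1)).
  by apply: dv_eq h _; rewrite mulr0 addr0 add0r.
have h := dvD (dvC p.2 s 1) (dvM (is_derive_expR s) (dvC (sin th) s 1)).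
by apply: dv_eq h _; rewrite mulr0 addr0 add0r.
Qed.

Lemma circ_dth (f : R * R -> R) (s th : R) : smooth D f -> s < s1 ->
  is_derive th 1 (fun r => f (circ p s r)) (angular f (circ p s th)).
Proof.
move=> hf ss; have := @chain_curve R D f (fun r => p.1 + expR s * cos r)
  (fun r => p.2 + expR s * sin r) th (- (expR s * sin th)) (expR s * cos th) oD (hf 1%N)
  (circD th ss).
rewrite /angular /circ /= ![_ + _ - _]addrAC !subrr !add0r mulNr addrC; apply.
  have h := dvD (dvC p.1 th 1) (dvM (dvC (expR s) th 1) (is_derive_cos th)).
  by apply: dv_eq h _; rewrite mul0r !add0r mulrN.
have h := dvD (dvC p.2 th 1) (dvM (dvC (expR s) th 1) (is_derive_sin th)).
by apply: dv_eq h _; rewrite mul0r !add0r.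
Qed.

Lemma circ_continuous (f : R * R -> R) (x : R * R) : smooth D f -> x.1 < s1 ->
  {for x, continuous (fun x : R * R => f (circ p x.1 x.2))}.
Proof.
move=> hf xs; apply: (@continuous_comp _ _ _ (fun x : R * R => circ p x.1 x.2) f).
  have e1 : {for x, continuous (fun y : R * R => expR y.1)}.
    by apply: (@continuous_comp _ _ _ fst expR); [exact: cvg_fst|exact: continuous_expR].
  have h1 : (fun y : R * R => p.1 + expR y.1 * cos y.2) @ x --> p.1 + expR x.1 * cos x.2.
    apply: cvgD; first exact: cvg_cst.
    apply: cvgM; first exact: e1.
    by apply: (@continuous_comp _ _ _ snd cos); [exact: cvg_snd|exact: continuous_cos].
  have h2 : (fun y : R * R => p.2 + expR y.1 * sin y.2) @ x --> p.2 + expR x.1 * sin x.2.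
    apply: cvgD; first exact: cvg_cst.
    apply: cvgM; first exact: e1.
    by apply: (@continuous_comp _ _ _ snd sin); [exact: cvg_snd|exact: continuous_sin].
  exact: cvg_pair h1 h2.
by apply: smooth_cont => //; exact: circD.
Qed.

Lemma circ_continuous_th (f : R * R -> R) (s : R) : smooth D f -> s < s1 ->
  continuous (fun th => f (circ p s th)).
Proof.
move=> hf ss th; have [d _] := circ_dth th hf ss.
exact/differentiable_continuous/derivable1_diffP.
Qed.

Lemma circ_integrable (f : R * R -> R) (s : R) : smooth D f -> s < s1 ->
  lebesgue_measure.-integrable period (EFin \o (fun th => f (circ p s th))).
Proof.
move=> hf ss; apply: continuous_compact_integrable; first exact: segment_compact.
by apply: continuous_subspaceT; exact: circ_continuous_th.
Qed.

Lemma period_gt0 : 0 < 2 * pi :> R.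
Proof. by rewrite mulr_gt0// pi_gt0. Qed.

Lemma measurable_period : measurable (period : set (measurableTypeR R)).
Proof. exact: measurable_itv. Qed.

(** Compactness of [s0, s2] x [0, 2 pi]. *)
Lemma circ_bound (f : R * R -> R) (s0 s2 : R) : smooth D f -> s0 <= s2 -> s2 < s1 ->
  exists Q, forall s th, s0 <= s <= s2 -> period th -> `|f (circ p s th)| <= Q.
Proof.
move=> hf s02 s21.
pose K := (`[s0, s2]%classic `*` period) : set (R * R).
have cK : compact K by apply: compact_setX; exact: segment_compact.
have K0 : K !=set0.
  by exists (s0, 0); split; rewrite /period /= in_itv/= lexx// (ltW period_gt0).
have cnK : {within K, continuous (fun x : R * R => `|f (circ p x.1 x.2)|)}.
  apply: continuous_in_subspaceT => x; rewrite inE => -[].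
  rewrite /= in_itv/= => /andP[_ xm] _.
  apply: (@continuous_comp _ _ _ (fun x : R * R => f (circ p x.1 x.2)) Num.norm).
    by apply: circ_continuous => //; exact: le_lt_trans xm s21.
  exact: norm_continuous.
have [c _ cmax] := compact_EVT_max K0 cK cnK.
exists `|f (circ p c.1 c.2)| => s th ss pth; apply: (cmax (s, th)); rewrite inE.
by split => //=; rewrite in_itv.
Qed.

(** Differentiation under the integral sign; the derivative is dominated on a
    neighbourhood of s by compactness. *)
Lemma cmean_derive (f : R * R -> R) (s : R) : smooth D f -> s < s1 ->
  is_derive s 1 (cmean f) (cmean (radial f) s).
Proof.
move=> hf ss; have hr := smooth_radial hf.
pose m := (s + s1) / 2.
have sm : s < m by rewrite midf_lt.
have ms1 : m < s1 by rewrite midf_lt.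
have [|Q QP] := @circ_bound _ (s - 1) m hr _ ms1.
  by apply: ltW; apply: lt_trans sm; rewrite gtrBl.
pose G := fun _ : measurableTypeR R => `|Q|.
have derE x y : x < s1 -> partial1of2 (fun r th => f (circ p r th)) x y = radial f (circ p x y).
  by move=> xs; rewrite partial1of2E; have [_ ->] := circ_ds y hf xs.
have uI : forall x, `]s - 1, m[%classic x -> x < s1.
  by move=> x /=; rewrite in_itv/= => /andP[_ xm]; exact: lt_trans xm ms1.
have Ia : `]s - 1, m[%classic s by rewrite /= in_itv/= sm ltrBlDr ltrDl ltr01.
have intf : forall x, `]s - 1, m[%classic x ->
   (@lebesgue_measure R).-integrable period (EFin \o (fun th => f (circ p x th))).
  by move=> x /uI; exact: circ_integrable.
have derf : forall x y, `]s - 1, m[%classic x -> period y -> 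
    derivable (fun r => f (circ p r y)) x 1.
  by move=> x y /uI xs _; have [] := circ_ds y hf xs.
have G0 : forall y, 0 <= G y by move=> y; exact: normr_ge0.
have intG : (@lebesgue_measure R).-integrable period (EFin \o G).
  apply: continuous_compact_integrable; first exact: segment_compact.
  by apply: continuous_subspaceT; exact: cst_continuous.
have Gub : forall x y, `]s - 1, m[%classic x -> period y ->
   `|partial1of2 (fun r th => f (circ p r th)) x y| <= G y.
  move=> x y xI yP; rewrite derE; last exact: uI.
  apply: le_trans (ler_norm Q); apply: QP => //.
  by move: xI; rewrite /= !in_itv/= => /andP[/ltW -> /ltW ->].
have E := @differentiation_under_integral R _ _ (@lebesgue_measure R)
  (fun r th => f (circ p r th)) period measurable_period s (s - 1) m Ia intf derf G G0 intG Gub.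
have d := @derivable_under_integral R _ _ (@lebesgue_measure R)
  (fun r th => f (circ p r th)) period measurable_period s (s - 1) m Ia intf derf G G0 intG Gub.
split; first exact: d.
rewrite -derive1E [LHS]E; apply: eq_Rintegral => y _.
exact: derE.
Qed.

(** The integrand is the derivative of a periodic function of the angle. *)
Lemma cmean_angular (f : R * R -> R) (s : R) : smooth D f -> s < s1 -> cmean (angular f) s = 0.
Proof.
move=> hf ss; rewrite /cmean /Rintegral.
rewrite (@continuous_FTC2 R (fun th => angular f (circ p s th)) (fun th => f (circ p s th))
   0 (2 * pi) period_gt0).
- by rewrite /circ mulr_natl cos2pi sin2pi cos0 sin0 -EFinD subrr.
- apply: continuous_subspaceT; apply: circ_continuous_th => //; exact: smooth_angular.
- have c := circ_continuous_th hf ss; split.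
  + by move=> th _; have [] := circ_dth th hf ss.
  + by apply: cvg_at_right_filter; exact: c.
  + by apply: cvg_at_left_filter; exact: c.
- by move=> th _; rewrite derive1E; have [_ ->] := circ_dth th hf ss.
Qed.

Lemma eq_cmean (f g : R * R -> R) (s : R) : (forall th, f (circ p s th) = g (circ p s th)) -> cmean f s = cmean g s.
Proof. by move=> fg; apply: eq_Rintegral => th _. Qed.

Lemma cmeanD (f g : R * R -> R) (s : R) : smooth D f -> smooth D g -> s < s1 ->
  cmean (fun w => f w + g w) s = cmean f s + cmean g s.
Proof.
by move=> hf hg ss; apply: RintegralD; [exact: measurable_period|exact: circ_integrable..].
Qed.

Lemma cmeanZ (f : R * R -> R) (k s : R) : smooth D f -> s < s1 ->
  cmean (fun w => k * f w) s = k * cmean f s.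
Proof.
by move=> hf ss; apply: RintegralZl; [exact: measurable_period|exact: circ_integrable].
Qed.

Lemma le_cmean (f g : R * R -> R) (s : R) : smooth D f -> smooth D g -> s < s1 ->
  (forall th, period th -> f (circ p s th) <= g (circ p s th)) -> cmean f s <= cmean g s.
Proof.
move=> hf hg ss fg; apply: le_Rintegral.
- exact: measurable_period.
- exact: circ_integrable.
- exact: circ_integrable.
- by move=> th /fg.
Qed.

Lemma cmean_ge0 (f : R * R -> R) (s : R) : (forall th, 0 <= f (circ p s th)) -> 0 <= cmean f s.
Proof. by move=> f0; apply: Rintegral_ge0. Qed.

(** A positive value would persist on a segment by continuity and contribute to the
    integral. *)
Lemma cmean_eq0 (f : R * R -> R) (s : R) : smooth D f -> s < s1 -> (forall th, 0 <= f (circ p s th)) ->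
  cmean f s = 0 -> forall th, 0 <= th <= 2 * pi -> f (circ p s th) = 0.
Proof.
move=> hf ss f0 c0 th /andP[th0 th1]; apply/eqP; rewrite eq_le f0 andbT leNgt; apply/negP => fth.
set c := f (circ p s th) in fth.
have cc := circ_continuous_th hf ss.
have /cvgrPdist_lt/(_ (c / 2))/(_ (divr_gt0 fth (ltr0Sn R 1)))/nbhs_ballP[d d0 Hd] := cc th.
pose a := Num.max 0 (th - d / 2); pose b := Num.min (2 * pi) (th + d / 2).
have d2 : 0 < d / 2 by rewrite divr_gt0.
have dd : d / 2 < d by rewrite ltr_pdivrMr// mulr_natr mulr2n ltrDl.
have ab : a < b.
  rewrite /a /b gt_max !lt_min period_gt0 (ltr_wpDl th0 d2) (lt_le_trans _ th1) ?gtrBl//=.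
  by apply: (@lt_trans _ _ th); rewrite ?gtrBl ?ltrDl.
have sub : `[a, b]%classic `<=` (period : set (measurableTypeR R)).
  move=> x; rewrite /period /= !in_itv/= /a /b ge_max le_min.
  by move=> /andP[/andP[-> _] /andP[-> _]].
have low x : `[a, b]%classic x -> c / 2 <= f (circ p s x).
  rewrite /= in_itv/= /a /b ge_max le_min => /andP[/andP[_ h1] /andP[_ h2]].
  have : ball th d x.
    rewrite /ball/= distrC ltr_norml ltrBlDl; apply/andP; split.
      by rewrite ltrBrDl; apply: lt_le_trans h1; rewrite ltrD2l ltrN2.
    by apply: le_lt_trans h2 _; rewrite ltrD2l.
  move=> /Hd; rewrite /= -/c => /ltr_normlW; rewrite ltrBlDr -ltrBlDl => /ltW.
  by rewrite {1}(splitr c) addrK.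
have iP : (\int[lebesgue_measure]_(x in period) (f (circ p s x))%:E)%E = 0%E.
  have fin := integrable_fin_num measurable_period (circ_integrable hf ss).
  rewrite -(fineK fin); congr (_%:E); exact: c0.
have iab : (\int[lebesgue_measure]_(x in `[a, b]%classic) (f (circ p s x))%:E <=
            \int[lebesgue_measure]_(x in period) (f (circ p s x))%:E)%E.
  apply: ge0_subset_integral => //=; first exact: measurable_period.
  - exact: measurable_int (circ_integrable hf ss).
  - by move=> x _; rewrite lee_fin.
have ilow : (\int[lebesgue_measure]_(x in `[a, b]%classic) (cst (c / 2)%:E x) <=
             \int[lebesgue_measure]_(x in `[a, b]%classic) (f (circ p s x))%:E)%E.
  apply: ge0_le_integral => //=.
  - by move=> x _; rewrite lee_fin divr_ge0// ltW.
  - exact: measurable_funS measurable_period sub (measurable_int _ (circ_integrable hf ss)).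
have := le_trans ilow iab; rewrite iP integral_cst//= lebesgue_measure_itv/= lte_fin ab -EFinD -EFinM lee_fin.
by apply/negP; rewrite -ltNge mulr_gt0// ?divr_gt0// subr_gt0.
Qed.

End CircleMeans.

(** * Frequency functions and calculus in polar directions *)

Ltac smooth_tac :=
  lazymatch goal with
  | |- smooth ?D (fun w => (@?f w + @?g w)%R) =>
      refine (@smoothD _ D _ f g _ _); [assumption|smooth_tac|smooth_tac]
  | |- smooth ?D (fun w => (@?f w * @?g w)%R) =>
      refine (@smoothM _ D _ f g _ _); [assumption|smooth_tac|smooth_tac]
  | |- smooth ?D (fun w => (- @?f w)%R) =>
      refine (@smoothN _ D _ f _); [assumption|smooth_tac]
  | |- smooth ?D (fun w => expR (@?f w)) =>
      refine (@smooth_expR _ D _ f _); [assumption|smooth_tac]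
  | |- smooth ?D (fun w => ?f w) => change (smooth D f); smooth_tac
  | |- smooth ?D (fun _ => ?c) => refine (@smooth_cst _ D _ _ c); assumption
  | |- smooth ?D fst => refine (@smooth_fst _ D _); assumption
  | |- smooth ?D snd => refine (@smooth_snd _ D _); assumption
  | |- smooth ?D (dx ?f) => refine (@smooth_dx _ D _ f _); smooth_tac
  | |- smooth ?D (dy ?f) => refine (@smooth_dy _ D _ f _); smooth_tac
  | |- smooth ?D (radial ?p ?f) => refine (@smooth_radial _ D p _ f _); [assumption|smooth_tac]
  | |- smooth ?D (angular ?p ?f) => refine (@smooth_angular _ D p _ f _); [assumption|smooth_tac]
  | |- smooth ?D ?f => match goal with
      | H : smooth D f |- _ => exact H
      | H : context [smooth D] |- _ => solve [apply H]
      end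
  end.

Section Monotone.
Context {R : realType}.

Lemma derive_ge0_le (f df : R -> R) (a b : R) : a <= b ->
  (forall x, a <= x <= b -> is_derive x 1 f (df x)) ->
  (forall x, a <= x <= b -> 0 <= df x) -> f a <= f b.
Proof.
move=> ab fx df0.
have [|c] := @MVT_between _ f df a b; rewrite (min_idPl ab) (max_idPr ab)//.
by move=> cab e; rewrite -subr_ge0 e mulr_ge0 ?subr_ge0 ?df0.
Qed.

(** The frequency M / (H + d) almost increases, by the hypothesis on
    k M' - M H' at k = H + d; so it is bounded on [s0, st] in terms of its value at
    st, which bounds the logarithmic derivative of H + d uniformly in d > 0.  Hence
    H(st) + d <= d e^(L (st - s0)), and d -> 0 contradicts H(st) > 0. *)
Lemma frequency_bound (H M dH dM : R -> R) (s0 s2 K : R) : 0 <= K ->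
  (forall s, s0 <= s <= s2 -> is_derive s 1 H (dH s)) ->
  (forall s, s0 <= s <= s2 -> is_derive s 1 M (dM s)) ->
  (forall s, s0 <= s <= s2 -> 0 <= H s) ->
  (forall s, s0 <= s <= s2 -> dH s - 2 * M s <= K * H s) ->
  (forall s k, s0 <= s <= s2 -> H s < k -> - K * (k * k) <= k * dM s - M s * dH s) ->
  H s0 = 0 -> forall s, s0 <= s <= s2 -> H s = 0.
Proof.
move=> K0 Hd Md Hge Hle freq H0 st /andP[st1 st2].
have stI : s0 <= st <= s2 by rewrite st1.
apply/eqP; rewrite eq_le Hge// andbT leNgt; apply/negP => Hst.
pose C := `|M st| / H st + K * (st - s0).
pose L := 2 * C + K.
have C0 : 0 <= C by rewrite addr_ge0 ?divr_ge0 ?mulr_ge0 ?subr_ge0 // ltW.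
suff key : forall d, 0 < d -> H st + d <= d * expR (L * (st - s0)).
  pose E := expR (L * (st - s0)).
  have E0 : 0 < E by exact: expR_gt0.
  have := key (H st / (2 * E)) (divr_gt0 Hst (mulr_gt0 (ltr0Sn _ 1) E0)).
  rewrite -/E; set d := H st / _ => kd.
  have d0 : 0 < d by rewrite divr_gt0 ?mulr_gt0.
  have : d * E = H st / 2 by rewrite /d; field; rewrite gt_eqF.
  have aux (h e t : R) : 0 < h -> 0 < e -> h + e <= t -> t = h / 2 -> False by clear; move=> *; lra.
  exact: aux Hst d0 kd.
move=> d d0.
have sub s : s0 <= s <= st -> s0 <= s <= s2 by move=> /andP[-> /le_trans ->].
have k0 s : s0 <= s <= st -> 0 < H s + d by move=> /sub/Hge h; rewrite ltr_wpDl.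
have Nle s : s0 <= s <= st -> M s / (H s + d) <= C.
  move=> ss; have /andP[ss0 sst] := ss.
  have [kt0 kn] := (k0 st, k0 s).
  pose df s := (dM s * (H s + d)^-1 + M s * (- (dH s + 0) * (H s + d)^-1 * (H s + d)^-1)) + (0 * s + K * 1).
  have := @derive_ge0_le (fun s => M s * (H s + d)^-1 + K * s) df s st sst.
  have dfd x : s <= x <= st -> is_derive x 1 (fun s => M s * (H s + d)^-1 + K * s) (df x).
    move=> /andP[sx xst]; have xs : s0 <= x <= st by rewrite (le_trans ss0).
    have n0 : H x + d != 0 by rewrite gt_eqF// k0.
    exact: (dvD (dvM (Md _ (sub _ xs)) (dvV (f := fun s => H s + d) (z := x) n0 (dvD (Hd _ (sub _ xs)) (dvC d x 1))))
                (dvM (dvC K x 1) (is_derive_id x 1))).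
  have df0 x : s <= x <= st -> 0 <= df x.
    move=> /andP[sx xst]; have xs : s0 <= x <= st by rewrite (le_trans ss0).
    have kx := k0 _ xs; have := freq x (H x + d) (sub _ xs); rewrite ltrDl => /(_ d0).
    rewrite /df; move: (H x + d) kx => k kx f1.
    have -> : dM x / k + M x * (- (dH x + 0) / k / k) + (0 * x + K * 1) =
      (k * dM x - M x * dH x + K * (k * k)) / (k * k) by field; rewrite gt_eqF.
    by rewrite divr_ge0 ?mulr_ge0 ?(ltW kx)// -lerBlDr sub0r -mulNr.
  move=> /(_ dfd df0) le1.
  have le2 : M st / (H st + d) <= `|M st| / H st.
    rewrite ler_pdivrMr ?k0 ?lexx ?andbT ?(le_trans ss0)//.
    apply: le_trans (ler_norm _) _; rewrite -mulrA ler_peMr//.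
    by rewrite mulrC ler_pdivlMr// mul1r lerDl ltW.
  rewrite /C mulrBr; have : K * s0 <= K * s by exact: ler_wpM2l.
  move: le1 le2; move: (M s / _) (M st / _) (_ / H st) (K * s) (K * st) (K * s0); clear.
  by move=> *; lra.
pose df s := (dH s + 0) * expR (- L * s) + (H s + d) * (expR (- L * s) * (0 * s + - L * 1)).
have := @derive_ge0_le (fun s => - ((H s + d) * expR (- L * s))) (fun s => - df s) s0 st st1.
have dfd x : s0 <= x <= st -> is_derive x 1 (fun s => - ((H s + d) * expR (- L * s))) (- df x).
  move=> xs; exact: (dvN (dvM (dvD (Hd _ (sub _ xs)) (dvC d x 1))
    (dv_comp (is_derive_expR _) (dvM (dvC (- L) x 1) (is_derive_id x 1))))).
have df0 x : s0 <= x <= st -> 0 <= - df x.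
  move=> xs; have -> : - df x = (L * (H x + d) - dH x) * expR (- L * x) by rewrite /df; ring.
  apply: mulr_ge0; last exact: expR_ge0.
  rewrite subr_ge0; have := Hle x (sub _ xs); have := Nle x xs.
  rewrite ler_pdivrMr ?k0// => h2 h1.
  have h3 : K * H x <= K * (H x + d) by rewrite ler_wpM2l// lerDl ltW.
  have -> : L * (H x + d) = 2 * (C * (H x + d)) + K * (H x + d) by rewrite /L; ring.
  have aux (a b c e m : R) : a - 2 * m <= b -> m <= c -> b <= e -> a <= 2 * c + e.
    by clear; move=> *; lra.
  exact: aux h1 h2 h3.
move=> /(_ dfd df0); rewrite H0 add0r lerN2 => h.
have -> : expR (L * (st - s0)) = expR (- L * s0) / expR (- L * st).
  by rewrite -expRB; congr expR; ring.
by rewrite mulrA ler_pdivlMr ?expR_gt0.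
Qed.

End Monotone.

Section FieldCalculus.
Context {R : realType}.
Variables (D : set (R * R)) (p : R * R).
Hypothesis oD : open D.
Implicit Types (f g : R * R -> R) (w : R * R).
Local Notation radial := (radial p).
Local Notation angular := (angular p).

Section Derivation.
Variables (f g : R * R -> R) (w : R * R).
Hypotheses (hf : smooth D f) (hg : smooth D g) (Dw : D w).

Lemma dxM : dx (fun w => f w * g w) w = dx f w * g w + f w * dx g w.
Proof. by have [_] := dvM (smooth_isdx hf Dw) (smooth_isdx hg Dw). Qed.
Lemma dyM : dy (fun w => f w * g w) w = dy f w * g w + f w * dy g w.
Proof. by have [_] := dvM (smooth_isdy hf Dw) (smooth_isdy hg Dw). Qed.
Lemma dxD : dx (fun w => f w + g w) w = dx f w + dx g w.
Proof. by have [_] := dvD (smooth_isdx hf Dw) (smooth_isdx hg Dw). Qed.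
Lemma dyD : dy (fun w => f w + g w) w = dy f w + dy g w.
Proof. by have [_] := dvD (smooth_isdy hf Dw) (smooth_isdy hg Dw). Qed.
Lemma dxN : dx (fun w => - f w) w = - dx f w.
Proof. by have [_] := dvN (smooth_isdx hf Dw). Qed.
Lemma dyN : dy (fun w => - f w) w = - dy f w.
Proof. by have [_] := dvN (smooth_isdy hf Dw). Qed.

Lemma radialM : radial (fun w => f w * g w) w = radial f w * g w + f w * radial g w.
Proof. by rewrite /radial dxM dyM; ring. Qed.
Lemma angularM : angular (fun w => f w * g w) w = angular f w * g w + f w * angular g w.
Proof. by rewrite /angular dxM dyM; ring. Qed.
Lemma radialD : radial (fun w => f w + g w) w = radial f w + radial g w.
Proof. by rewrite /radial dxD dyD; ring. Qed.
Lemma angularD : angular (fun w => f w + g w) w = angular f w + angular g w.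
Proof. by rewrite /angular dxD dyD; ring. Qed.
Lemma radialN : radial (fun w => - f w) w = - radial f w.
Proof. by rewrite /radial dxN dyN; ring. Qed.
Lemma angularN : angular (fun w => - f w) w = - angular f w.
Proof. by rewrite /angular dxN dyN; ring. Qed.
End Derivation.

Lemma dx_cst (c : R) w : dx (fun=> c) w = 0.
Proof. by rewrite /dx derive_cst. Qed.
Lemma dy_cst (c : R) w : dy (fun=> c) w = 0.
Proof. by rewrite /dy derive_cst. Qed.

Lemma dxZ (c : R) f w : smooth D f -> D w -> dx (fun w => c * f w) w = c * dx f w.
Proof.
move=> hf Dw; have [_ e] := dvM (dvC c _ _) (smooth_isdx hf Dw).
by apply: etrans e _; rewrite mul0r add0r.
Qed.
Lemma dyZ (c : R) f w : smooth D f -> D w -> dy (fun w => c * f w) w = c * dy f w.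
Proof.
move=> hf Dw; have [_ e] := dvM (dvC c _ _) (smooth_isdy hf Dw).
by apply: etrans e _; rewrite mul0r add0r.
Qed.

(** The coordinate fields d_s and d_th commute; in cartesian coordinates this is the
    symmetry of second derivatives. *)
Lemma radial_angular f w : smooth D f -> D w ->
  radial (angular f) w = angular (radial f) w.
Proof.
move=> hf Dw.
have hx := smooth_dx hf; have hy := smooth_dy hf.
have X : is_derive w ((1, 0) : R * R) (fun w => w.1 - p.1) (1 + 0) by exact: dvD (dx_fst w) (dvC _ _ _).
have X' : is_derive w ((0, 1) : R * R) (fun w => w.1 - p.1) (0 + 0) by exact: dvD (dy_fst w) (dvC _ _ _).
have Y : is_derive w ((1, 0) : R * R) (fun w => w.2 - p.2) (0 + 0) by exact: dvD (dx_snd w) (dvC _ _ _).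
have Y' : is_derive w ((0, 1) : R * R) (fun w => w.2 - p.2) (1 + 0) by exact: dvD (dy_snd w) (dvC _ _ _).
have hxx := smooth_isdx hx Dw; have hxy := smooth_isdy hx Dw.
have hyx := smooth_isdx hy Dw; have hyy := smooth_isdy hy Dw.
have e1 : dx (angular f) w = dy f w + (w.1 - p.1) * dx (dy f) w - (w.2 - p.2) * dx (dx f) w.
  have [_ e] := dvD (dvM X hyx) (dvN (dvM Y hxx)); apply: etrans e _.
  cbv beta; move: (dx f w) (dy f w) (dx (dx f) w) (dy (dx f) w) (dx (dy f) w) (dy (dy f) w) (w.1 - p.1) (w.2 - p.2).
  by clear => *; ring.
have e2 : dy (angular f) w = (w.1 - p.1) * dy (dy f) w - dx f w - (w.2 - p.2) * dy (dx f) w.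
  have [_ e] := dvD (dvM X' hyy) (dvN (dvM Y' hxy)); apply: etrans e _.
  cbv beta; move: (dx f w) (dy f w) (dx (dx f) w) (dy (dx f) w) (dx (dy f) w) (dy (dy f) w) (w.1 - p.1) (w.2 - p.2).
  by clear => *; ring.
have e3 : dx (radial f) w = dx f w + (w.1 - p.1) * dx (dx f) w + (w.2 - p.2) * dx (dy f) w.
  have [_ e] := dvD (dvM X hxx) (dvM Y hyx); apply: etrans e _.
  cbv beta; move: (dx f w) (dy f w) (dx (dx f) w) (dy (dx f) w) (dx (dy f) w) (dy (dy f) w) (w.1 - p.1) (w.2 - p.2).
  by clear => *; ring.
have e4 : dy (radial f) w = (w.1 - p.1) * dy (dx f) w + (dy f w + (w.2 - p.2) * dy (dy f) w).
  have [_ e] := dvD (dvM X' hxy) (dvM Y' hyy); apply: etrans e _.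
  cbv beta; move: (dx f w) (dy f w) (dx (dx f) w) (dy (dx f) w) (dx (dy f) w) (dy (dy f) w) (w.1 - p.1) (w.2 - p.2).
  by clear => *; ring.
rewrite {1}/radial {3}/angular e1 e2 e3 e4 (smooth_Schwarz oD hf Dw).
move: (dx f w) (dy f w) (dx (dx f) w) (dy (dx f) w) (dy (dy f) w) (w.1 - p.1) (w.2 - p.2).
by clear => *; ring.
Qed.

End FieldCalculus.

(** * Unique continuation across circles *)

Section Estimates.
Variable R : realFieldType.
Implicit Types X Y a b v q rho Q : R.

(** Cauchy-Schwarz inequality for X a - Y b, the radial derivative of v. *)
Lemma sq_lin X Y a b rho : X * X + Y * Y <= rho ->
  (X * a - Y * b) * (X * a - Y * b) <= rho * (a * a + b * b).
Proof.
move=> h; have ab : 0 <= a * a + b * b by rewrite addr_ge0// -expr2 sqr_ge0.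
apply: le_trans (ler_wpM2r ab h); rewrite -subr_ge0.
have -> : (X * X + Y * Y) * (a * a + b * b) - (X * a - Y * b) * (X * a - Y * b) =
  (X * b + Y * a) ^+ 2 by ring.
exact: sqr_ge0.
Qed.

(** Bounds H' - 2 M, the error in the first-order relation between H and M. *)
Lemma frequency_drift X Y a b v q rho Q : 1 <= rho -> X * X + Y * Y <= rho -> `|q| <= Q ->
  2 * (v * (X * a - Y * b) * (1 + q)) <= (1 + Q) * rho * (v * v + a * a + b * b).
Proof.
move=> r1 r qQ; have := sq_lin a b r; set t := X * a - Y * b => ht.
have Q1 : `|1 + q| <= 1 + Q by apply: le_trans (ler_normD _ _) _; rewrite normr1 lerD2l.
have Q0 : 0 <= 1 + Q by exact: le_trans (normr_ge0 _) Q1.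
have -> : 2 * (v * t * (1 + q)) = (1 + q) * (2 * (v * t)) by ring.
have -> : (1 + Q) * rho * (v * v + a * a + b * b) = (1 + Q) * (rho * (v * v + a * a + b * b)) by ring.
apply: le_trans (ler_norm _) _; rewrite normrM.
apply: ler_pM => //; apply: (@le_trans _ _ (v * v + t * t)).
  have -> : `|2 * (v * t)| = 2 * (`|v| * `|t|) by rewrite !normrM (ger0_norm (ler0n _ 2)).
  have -> : v * v + t * t = `|v| * `|v| + `|t| * `|t| by rewrite -!normrM !ger0_norm// -expr2 sqr_ge0.
  rewrite -subr_ge0; have -> : `|v| * `|v| + `|t| * `|t| - 2 * (`|v| * `|t|) = (`|v| - `|t|) ^+ 2 by ring.
  exact: sqr_ge0.
have -> : rho * (v * v + a * a + b * b) = rho * (v * v) + rho * (a * a + b * b) by ring.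
by apply: lerD => //; apply: ler_peMl => //; rewrite -expr2 sqr_ge0.
Qed.

(** The squares left over by completing the squares in [frequency_sos] are of the
    order of H. *)
Lemma frequency_source X Y a b v q rho Q : 1 <= rho -> X * X + Y * Y <= rho -> `|q| <= Q ->
  (X * a - Y * b) * (X * a - Y * b) + (X * (q * v) * (X * (q * v)) + Y * (q * v) * (Y * (q * v)))
   <= (1 + Q * Q) * rho * (v * v + a * a + b * b).
Proof.
move=> r1 r qQ.
have rho0 : 0 <= rho by exact: le_trans r1.
have q2 : q * q <= Q * Q.
  by rewrite -[q * q]ger0_norm ?normrM -?expr2 ?sqr_ge0// lerXn2r// nnegrE ?(le_trans _ qQ).
have v0 : 0 <= v * v by rewrite -expr2 sqr_ge0.
have ab0 : 0 <= a * a + b * b by rewrite addr_ge0// -expr2 sqr_ge0.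
have h1 := sq_lin a b r.
have h2 : X * (q * v) * (X * (q * v)) + Y * (q * v) * (Y * (q * v)) <= rho * (Q * Q) * (v * v).
  have -> : X * (q * v) * (X * (q * v)) + Y * (q * v) * (Y * (q * v)) = (X * X + Y * Y) * (q * q) * (v * v) by ring.
  apply: ler_wpM2r => //; apply: ler_pM => //; last by rewrite -expr2 sqr_ge0.
  by rewrite addr_ge0// -expr2 sqr_ge0.
have Q0 : 0 <= Q * Q by rewrite -expr2 sqr_ge0.
have -> : (1 + Q * Q) * rho * (v * v + a * a + b * b) =
  rho * (a * a + b * b) + (rho * (Q * Q) * (v * v) + (rho * (v * v) + Q * Q * (rho * (a * a + b * b)))) by ring.
apply: lerD => //; apply: le_trans h2 _; rewrite lerDl.
by apply: addr_ge0; [exact: mulr_ge0|apply: mulr_ge0 => //; exact: mulr_ge0].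
Qed.

(** The Cauchy-Schwarz inequality for M and H in the form of a sum of squares: for
    q = 0 the last two squares are those of the components of
    2 k (a, b)_th - 2 m (- b, a).  The other terms absorb the zeroth order part q v
    of the equation. *)
Lemma frequency_sos X Y A B a b v q k m :
  ((((4 * (k * k)) * (A * A + B * B + q * v * (X * B + Y * A))
   + (- (8 * (k * m))) * (a * B + - (b * A))) + (4 * (m * m)) * (v * v + a * a + b * b))
   + (- (4 * (k * m))) * (v * (X * a + - (Y * b)) * (1 + q)))
   + (k * k) * ((X * a + - (Y * b)) * (X * a + - (Y * b)) +
     (X * (q * v) * (X * (q * v)) + Y * (q * v) * (Y * (q * v)))) =
  (k * (X * a - Y * b) - 2 * (m * v)) ^+ 2 + (k * (2 * B + X * (q * v)) - 2 * (m * a)) ^+ 2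
   + (k * (2 * A + Y * (q * v)) + 2 * (m * b)) ^+ 2.
Proof. by ring. Qed.

(** Extracts from the integrated sum of squares, where m is the integral of P2 and
    h that of P3, the lower bound on k M' - M H' required by [frequency_bound]. *)
Lemma frequency_arith (p1 p4 p5 h m k K1 K2 : R) :
  0 <= 4 * (k * k) * p1 - 8 * (k * m) * m + 4 * (m * m) * h - 4 * (k * m) * p4 + k * k * p5 ->
  p5 <= K2 * h -> h < k -> 0 <= h -> 0 < k -> 0 <= K1 -> 0 <= K2 ->
  - (K1 + K2) * (k * k) <= 2 * (k * p1) - 2 * (m * m) - 2 * (m * p4).
Proof.
move=> F0 p5h hk h0 k0 K10 K20; set E := leRHS.
suff : 0 <= k * (2 * E + K2 * (k * k)).
  rewrite pmulr_rge0// => h1.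
  have h2 : 0 <= K1 * (k * k) by rewrite !mulr_ge0// ltW.
  have h3 : 0 <= K2 * (k * k) by rewrite !mulr_ge0// ltW.
  rewrite mulNr mulrDl; move: h1 h2 h3; move: (K1 * _) (K2 * _) E; clear=> *; lra.
have -> : k * (2 * E + K2 * (k * k)) =
  (4 * (k * k) * p1 - 8 * (k * m) * m + 4 * (m * m) * h - 4 * (k * m) * p4 + k * k * p5)
  + 4 * ((m * m) * (k - h)) + (k * k) * ((K2 * h - p5) + K2 * (k - h)) by rewrite /E; ring.
have mm : 0 <= m * m by rewrite -expr2 sqr_ge0.
have kk : 0 <= k * k by rewrite -expr2 sqr_ge0.
have kh : 0 <= k - h by rewrite subr_ge0 ltW.
have p50 : 0 <= K2 * h - p5 by rewrite subr_ge0.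
apply: addr_ge0; first by apply: addr_ge0 => //; apply: mulr_ge0 => //; exact: mulr_ge0.
by apply: mulr_ge0 => //; apply: addr_ge0 => //; exact: mulr_ge0.
Qed.

End Estimates.

Section UniqueContinuation.
Context {R : realType}.
Variable D : set (R * R).
Hypothesis oD : open D.
Variables (v q : R * R -> R).
Hypotheses (hv : smooth D v) (hq : smooth D q).
Hypothesis pde : forall w, D w -> dx (dx v) w + dy (dy v) w = q w * v w.

Section Disc.
Variables (p : R * R) (s1 : R).
Hypothesis circD : forall s th, s < s1 -> D (circ p s th).

Let a := dx v.
Let b := fun w => - dy v w.
Let X : R * R -> R := fun w => w.1 - p.1.
Let Y : R * R -> R := fun w => w.2 - p.2.
Let A := angular p a.
Let B := angular p b.
Let P1 := fun w => A w * A w + B w * B w + q w * v w * (X w * B w + Y w * A w).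
Let P2 := fun w => a w * B w + - (b w * A w).
Let P3 := fun w => v w * v w + a w * a w + b w * b w.
Let P4 := fun w => v w * (X w * a w + - (Y w * b w)) * (1 + q w).
Let P5 := fun w => (X w * a w + - (Y w * b w)) * (X w * a w + - (Y w * b w)) + 
  (X w * (q w * v w) * (X w * (q w * v w)) + Y w * (q w * v w) * (Y w * (q w * v w))).
Let P6 := fun w => a w * radial p b w + - (b w * radial p a w).

Let ha : smooth D a. Proof. exact: smooth_dx. Qed.
Let hb : smooth D b. Proof. rewrite /b; smooth_tac. Qed.
Let hX : smooth D X. Proof. exact: (smoothD oD (smooth_fst oD) (smooth_cst oD _)). Qed.
Let hY : smooth D Y. Proof. by apply: smoothD => //; [exact: smooth_snd|exact: smooth_cst]. Qed.
Let hA : smooth D A. Proof. exact: smooth_angular. Qed.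
Let hB : smooth D B. Proof. exact: smooth_angular. Qed.
Let h1 : smooth D P1. Proof. rewrite /P1; smooth_tac. Qed.
Let h2 : smooth D P2. Proof. rewrite /P2; smooth_tac. Qed.
Let h3 : smooth D P3. Proof. rewrite /P3; smooth_tac. Qed.
Let h4 : smooth D P4. Proof. rewrite /P4; smooth_tac. Qed.
Let h5 : smooth D P5. Proof. rewrite /P5; smooth_tac. Qed.
Let h6 : smooth D P6. Proof. rewrite /P6; smooth_tac. Qed.

Let radial_v w : radial p v w = X w * a w - Y w * b w.
Proof. by rewrite /radial /b mulrN opprK. Qed.

Let radial_a w : D w -> radial p a w = B w + X w * (q w * v w).
Proof.
move=> Dw; rewrite -pde// /B /radial /angular -/(X w) -/(Y w).
have hy := smooth_dy hv.
rewrite (dyN hy Dw) (dxN hy Dw) (smooth_Schwarz oD hv Dw) /a.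
move: (X w) (Y w) (dx (dx v) w) (dy (dx v) w) (dy (dy v) w); clear => *; ring.
Qed.

Let radial_b w : D w -> radial p b w = - A w - Y w * (q w * v w).
Proof.
move=> Dw; rewrite -pde// /A /radial /angular -/(X w) -/(Y w).
have hy := smooth_dy hv.
rewrite (dyN hy Dw) (dxN hy Dw) (smooth_Schwarz oD hv Dw) /a.
move: (X w) (Y w) (dx (dx v) w) (dy (dx v) w) (dy (dy v) w); clear => *; ring.
Qed.

Let radial_P3 w : D w -> radial p P3 w = 2 * P2 w + 2 * P4 w.
Proof.
move=> Dw; rewrite /P3.
have hvv := smoothM oD hv hv; have haa := smoothM oD ha ha; have hbb := smoothM oD hb hb.
rewrite (radialD _ (smoothD oD hvv haa) hbb Dw) (radialD _ hvv haa Dw).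
rewrite (radialM _ hv hv Dw) (radialM _ ha ha Dw) (radialM _ hb hb Dw).
rewrite (radial_a Dw) (radial_b Dw) radial_v /P2 /P4.
move: (X w) (Y w) (A w) (B w) (q w) (v w) (a w) (b w); clear => *; ring.
Qed.

Let radial_P2 w : D w -> radial p P2 w = 2 * P1 w + angular p P6 w.
Proof.
move=> Dw.
have hrb : smooth D (radial p b) by exact: smooth_radial.
have hra : smooth D (radial p a) by exact: smooth_radial.
have haB := smoothM oD ha hB; have hbA := smoothM oD hb hA.
have har := smoothM oD ha hrb; have hbr := smoothM oD hb hra.
rewrite /P2 (radialD _ haB (smoothN oD hbA) Dw) (radialN _ hbA Dw).
rewrite (radialM _ ha hB Dw) (radialM _ hb hA Dw).
rewrite /P6 (angularD _ har (smoothN oD hbr) Dw) (angularN _ hbr Dw).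
rewrite (angularM _ ha hrb Dw) (angularM _ hb hra Dw).
rewrite -(radial_angular p oD hb Dw) -(radial_angular p oD ha Dw) -/A -/B.
rewrite (radial_a Dw) (radial_b Dw) /P1.
move: (X w) (Y w) (A w) (B w) (q w) (v w) (a w) (b w) (radial p A w) (radial p B w); clear => *; ring.
Qed.

Let circ_norm s th : X (circ p s th) * X (circ p s th) + Y (circ p s th) * Y (circ p s th)
  = expR s * expR s.
Proof.
rewrite /X /Y /circ /= ![_ + _ - _]addrAC !subrr !add0r.
have -> : expR s * cos th * (expR s * cos th) + expR s * sin th * (expR s * sin th) =
  expR s * expR s * (cos th ^+ 2 + sin th ^+ 2) by ring.
by rewrite cos2Dsin2 mulr1.
Qed.

(** The frequency argument between a small radius, where v and its gradient vanish,
    and the radius of the given circle. *)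
Lemma ucp_circle (U : set (R * R)) : open U -> U p -> U `<=` D ->
  (forall w, U w -> v w = 0) ->
  forall s th, s < s1 -> 0 <= th <= 2 * pi -> v (circ p s th) = 0.
Proof.
move=> oU Up UD vU s2 th2 s21 th2I.
have [e e0 eU] := open_boxP oU Up.
(* the circle of radius e^s0 lies in U *)
pose s0 := Num.min s2 (ln (e / 2)).
have e20 : 0 < e / 2 by rewrite divr_gt0.
have s02 : s0 <= s2 by rewrite /s0 ge_min lexx.
have s0e : expR s0 < e.
  apply: (@le_lt_trans _ _ (e / 2)); last by rewrite ltr_pdivrMr// mulr_natr mulr2n ltrDl.
  by rewrite -[leRHS]lnK ?posrE// ler_expR /s0 ge_min lexx orbT.
have U0 th : U (circ p s0 th).
  apply: eU; rewrite /circ /= addrAC subrr add0r normrM ger0_norm ?expR_ge0//;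
    apply: le_lt_trans s0e; rewrite ler_piMr ?expR_ge0//.
  - by rewrite ler_norml cos_geN1 cos_le1.
  - by rewrite ler_norml sin_geN1 sin_le1.
have [Q QP] := circ_bound circD hq s02 s21.
pose rho := 1 + expR s2 * expR s2.
have rho1 : 1 <= rho by rewrite /rho lerDl mulr_ge0// expR_ge0.
have rhoP s th : s0 <= s <= s2 ->
    X (circ p s th) * X (circ p s th) + Y (circ p s th) * Y (circ p s th) <= rho.
  move=> /andP[_ ss]; rewrite circ_norm; apply: (@le_trans _ _ (expR s2 * expR s2)).
    by apply: ler_pM; rewrite ?expR_ge0// ler_expR.
  by rewrite lerDr.
have Q0 : 0 <= Q.
  have := QP s0 0; rewrite lexx s02 => /(_ isT); rewrite /period /= in_itv/= lexx (ltW period_gt0) => /(_ isT).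
  exact: le_trans (normr_ge0 _).
have P30 w : 0 <= P3 w by rewrite /P3 !addr_ge0// -expr2 sqr_ge0.
pose K1 := (1 + Q) * rho; pose K2 := (1 + Q * Q) * rho.
have rho0 : 0 <= rho by exact: le_trans rho1.
have K10 : 0 <= K1 by rewrite mulr_ge0// addr_ge0.
have K20 : 0 <= K2 by rewrite mulr_ge0// addr_ge0// mulr_ge0.
pose H := cmean p P3; pose M := cmean p P2.
pose dH := cmean p (radial p P3); pose dM := cmean p (radial p P2).
have lt1 s : s0 <= s <= s2 -> s < s1 by move=> /andP[_ ss]; exact: le_lt_trans s21.
have dHE s : s0 <= s <= s2 -> dH s = 2 * M s + 2 * cmean p P4 s.
  move=> /lt1 ss; rewrite /dH (eq_cmean (g := fun w => 2 * P2 w + 2 * P4 w)); last first.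
    by move=> th; apply: radial_P3; exact: circD.
  have hc := smooth_cst oD (2 : R).
  rewrite (cmeanD oD circD (smoothM oD hc h2) (smoothM oD hc h4) ss).
  by rewrite (cmeanZ oD circD 2 h2 ss) (cmeanZ oD circD 2 h4 ss).
have dME s : s0 <= s <= s2 -> dM s = 2 * cmean p P1 s.
  move=> /lt1 ss; rewrite /dM (eq_cmean (g := fun w => 2 * P1 w + angular p P6 w)); last first.
    by move=> th; apply: radial_P2; exact: circD.
  have hc := smooth_cst oD (2 : R).
  rewrite (cmeanD oD circD (smoothM oD hc h1) (smooth_angular p oD h6) ss).
  by rewrite (cmeanZ oD circD 2 h1 ss) (cmean_angular oD circD h6 ss) addr0.
have Hge s : s0 <= s <= s2 -> 0 <= H s by move=> _; apply: cmean_ge0.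
have Hle s : s0 <= s <= s2 -> dH s - 2 * M s <= (K1 + K2) * H s.
  move=> sI; have ss := lt1 _ sI; rewrite dHE// [2 * M s + _]addrC addrK.
  apply: (@le_trans _ _ (K1 * H s)); last by rewrite ler_wpM2r ?Hge// lerDl.
  rewrite /H -(cmeanZ oD circD 2 h4 ss) -(cmeanZ oD circD K1 h3 ss).
  apply: (le_cmean oD circD) => //; [exact: smoothM (smooth_cst _ _) h4|exact: smoothM (smooth_cst _ _) h3|].
  move=> t tP; rewrite /P4 /K1 /P3.
  by apply: frequency_drift => //; [exact: rhoP|exact: QP].
have freq s k : s0 <= s <= s2 -> H s < k -> - (K1 + K2) * (k * k) <= k * dM s - M s * dH s.
  move=> sI Hk; have ss := lt1 _ sI.
  have k0 : 0 < k by exact: le_lt_trans (Hge _ sI) Hk.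
  set m := M s.
  pose F w := ((((4 * (k * k)) * P1 w + (- (8 * (k * m))) * P2 w) + (4 * (m * m)) * P3 w)
     + (- (4 * (k * m))) * P4 w) + (k * k) * P5 w.
  have F0 w : 0 <= F w.
    by rewrite /F /P1 /P2 /P3 /P4 /P5 frequency_sos !addr_ge0// sqr_ge0.
  have hc (c : R) (P : R * R -> R) : smooth D P -> smooth D (fun w => c * P w).
    by move=> hP; apply: smoothM => //; exact: smooth_cst.
  have F0' : 0 <= cmean p F s by apply: cmean_ge0.
  have c12 := smoothD oD (hc (4 * (k * k)) _ h1) (hc (- (8 * (k * m))) _ h2).
  have c123 := smoothD oD c12 (hc (4 * (m * m)) _ h3).
  have c1234 := smoothD oD c123 (hc (- (4 * (k * m))) _ h4).
  have FE : cmean p F s = 4 * (k * k) * cmean p P1 s - 8 * (k * m) * m + 4 * (m * m) * H s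
     - 4 * (k * m) * cmean p P4 s + k * k * cmean p P5 s.
    rewrite /F (cmeanD oD circD c1234 (hc _ _ h5) ss) (cmeanD oD circD c123 (hc _ _ h4) ss).
    rewrite (cmeanD oD circD c12 (hc _ _ h3) ss) (cmeanD oD circD (hc _ _ h1) (hc _ _ h2) ss).
    rewrite !(cmeanZ oD circD _ _ ss)//.
    by rewrite !mulNr.
  have P5le : cmean p P5 s <= K2 * H s.
    rewrite /H -(cmeanZ oD circD K2 h3 ss).
    apply: (le_cmean oD circD) => //; first exact: hc.
    move=> t tP; rewrite /P5 /K2 /P3.
    by apply: frequency_source => //; [exact: rhoP|exact: QP].
  have E1 : k * dM s - m * dH s = 2 * (k * cmean p P1 s) - 2 * (m * m) - 2 * (m * cmean p P4 s).
    by rewrite dHE// dME// -/m; ring.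
  rewrite E1; rewrite FE in F0'.
  exact: (frequency_arith F0' P5le Hk (Hge _ sI) k0 K10 K20).
have Hs0 : H s0 = 0.
  have s0I : s0 <= s0 <= s2 by rewrite lexx.
  have ax w : U w -> a w = 0.
    by move=> Uw; rewrite /a (dx_ext oU (g := fun=> 0) vU Uw) dx_cst.
  have bx w : U w -> b w = 0.
    by move=> Uw; rewrite /b (dy_ext oU (g := fun=> 0) vU Uw) dy_cst oppr0.
  rewrite /H (eq_cmean (g := fun w => 0 * P3 w)).
    by rewrite (cmeanZ oD circD 0 h3 (lt1 _ s0I)) mul0r.
  by move=> th; have Uth := U0 th; rewrite /P3 (vU _ Uth) (ax _ Uth) (bx _ Uth) !mulr0 !addr0 mul0r.
have Hd s : s0 <= s <= s2 -> is_derive s 1 H (dH s).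
  by move=> /lt1 ss; exact: (cmean_derive oD circD h3 ss).
have Md s : s0 <= s <= s2 -> is_derive s 1 M (dM s).
  by move=> /lt1 ss; exact: (cmean_derive oD circD h2 ss).
have K0 : 0 <= K1 + K2 by exact: addr_ge0.
have s2I : s0 <= s2 <= s2 by rewrite s02 lexx.
have Hz := frequency_bound K0 Hd Md Hge Hle freq Hs0 s2I.
have P3z := cmean_eq0 oD circD h3 s21 (fun t => P30 _) Hz th2I.
apply/eqP; rewrite -sqrf_eq0 eq_le sqr_ge0 andbT -P3z /P3 expr2 -addrA lerDl.
by rewrite addr_ge0// -expr2 sqr_ge0.
Qed.

End Disc.
End UniqueContinuation.

(** * Unique continuation and smooth square roots *)

Section Polar.
Context {R : realType}.

Lemma half_quarter (a b e : R) : a < e / 2 -> b < e / 4 -> 0 < e -> a + b < e.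
Proof. by move=> *; lra. Qed.

Lemma sixteenth_quarter (a b e : R) : a < e / 16 -> b < e / 4 -> a + b < 5 / 16 * e.
Proof. by move=> *; lra. Qed.

Lemma polar_angle (x y : R) : x ^+ 2 + y ^+ 2 = 1 ->
  exists2 th, 0 <= th <= 2 * pi & cos th = x /\ sin th = y.
Proof.
move=> xy1.
have y2 : 1 - x ^+ 2 = y ^+ 2 by rewrite -xy1 addrAC subrr add0r.
have x1 : -1 <= x <= 1.
  by rewrite -ler_norml -sqr_norm_le1 || rewrite -ler_norml -(@ler_sqr _ `|x|) ?nnegrE// expr1n real_normK ?num_real// -xy1 lerDl sqr_ge0.
have c := acosK x1; have s := sin_acos x1; rewrite y2 sqrtr_sqr in s.
have a0 := acos_ge0 x1; have a1 := acos_lepi x1.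
have [y0|y0] := leP 0 y.
  exists (acos x); last by rewrite s ger0_norm.
  by rewrite a0 (le_trans a1)// ler_pMl ?pi_gt0// ler1n.
exists (2 * pi - acos x).
  by rewrite subr_ge0 gerBl a0 andbT (le_trans a1)// ler_pMl ?pi_gt0// ler1n.
rewrite mulr_natl addrC cosD2pi sinD2pi cosN sinN s c ltr0_norm// opprK.
by [].
Qed.

Lemma circ_polar (p w : R * R) : (0 < (w.1 - p.1) ^+ 2 + (w.2 - p.2) ^+ 2) ->
  exists th, 0 <= th <= 2 * pi /\
   w = circ p (ln (Num.sqrt ((w.1 - p.1) ^+ 2 + (w.2 - p.2) ^+ 2))) th.
Proof.
set n := _ + _ => n0.
have r0 : 0 < Num.sqrt n by rewrite sqrtr_gt0.
have [|th thI [ct st]] := @polar_angle ((w.1 - p.1) / Num.sqrt n) ((w.2 - p.2) / Num.sqrt n).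
  by rewrite !expr_div_n -mulrDl -/n sqr_sqrtr ?divff ?gt_eqF// ltW.
exists th; split => //; rewrite /circ lnK ?posrE// ct st.
have rn : Num.sqrt n != 0 by rewrite gt_eqF.
rewrite [LHS]surjective_pairing; congr (_, _).
  by rewrite mulrC divfK// addrC subrK.
by rewrite mulrC divfK// addrC subrK.
Qed.

End Polar.

Section Global.
Context {R : realType}.
Variable D : set (R * R).
Hypothesis oD : open D.

Section UC.
Variables (v q : R * R -> R).
Hypotheses (hv : smooth D v) (hq : smooth D q).
Hypothesis pde : forall w, D w -> dx (dx v) w + dy (dy v) w = q w * v w.

Lemma ucp_disc (p : R * R) (r : R) : 0 < r ->
  (forall w : R * R, (w.1 - p.1) ^+ 2 + (w.2 - p.2) ^+ 2 < r ^+ 2 -> D w) ->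
  (\forall w \near p, v w = 0) ->
  forall w : R * R, (w.1 - p.1) ^+ 2 + (w.2 - p.2) ^+ 2 < r ^+ 2 -> v w = 0.
Proof.
move=> r0 discD vp w wr.
have [n0|] := ltP 0 ((w.1 - p.1) ^+ 2 + (w.2 - p.2) ^+ 2); last first.
  move=> h; have z1 : (w.1 - p.1) ^+ 2 = 0.
    apply/eqP; rewrite eq_le sqr_ge0 andbT; apply: le_trans h; by rewrite lerDl sqr_ge0.
  have z2 : (w.2 - p.2) ^+ 2 = 0.
    apply/eqP; rewrite eq_le sqr_ge0 andbT; apply: le_trans h; by rewrite lerDr sqr_ge0.
  move: z1 z2 => /eqP + /eqP; rewrite !sqrf_eq0 !subr_eq0 => /eqP z1 /eqP z2.
  have -> : w = p by rewrite (surjective_pairing w) (surjective_pairing p) z1 z2.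
  exact: nbhs_singleton vp.
have [th [thI we]] := circ_polar n0.
have circD s t : s < ln r -> D (circ p s t).
  move=> sr; apply: discD; rewrite /circ /= ![_ + _ - _]addrAC !subrr !add0r !exprMn -mulrDr cos2Dsin2 mulr1.
  by rewrite ltr_pXn2r ?nnegrE ?expR_ge0 ?(ltW r0)// -[ltRHS]lnK ?posrE// ltr_expR.
have Dp : D p by apply: discD; rewrite !subrr expr0n addr0 exprn_gt0.
pose U := (fun z => nbhs z [set w | v w = 0]) `&` D.
have oU : open U.
  rewrite openE => z [vz Dz]; apply: filterI; last exact: near_D.
  by apply: nbhs_interior.
rewrite we; apply: (ucp_circle oD hv hq pde circD oU) => //.
- by move=> z [].
- by move=> z [/nbhs_singleton].
- rewrite ltr_ln ?posrE ?sqrtr_gt0//.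
  by rewrite -[ltRHS]ger0_norm ?ltW// -sqrtr_sqr ltr_sqrt// exprn_gt0.
Qed.

Hypothesis cD : connected D.

(** The set of points near which v vanishes is open, and also closed in D: a point
    of its closure lies in a disc that is centred in the set and contained in D. *)
Lemma unique_continuation z0 : D z0 -> (\forall w \near z0, v w = 0) ->
  forall z, D z -> v z = 0.
Proof.
move=> Dz0 v0 z Dz; suff : \forall w \near z, v w = 0 by move/nbhs_singleton.
move: z Dz; apply: (@connected_spread _ _ oD cD (fun z => \forall w \near z, v w = 0) z0 Dz0 v0).
  by move=> z _ /nbhs_interior.
move=> z Dz nz; have [e e0 eD] := open_boxP oD Dz.
have e4 : 0 < e / 4 by rewrite divr_gt0.
(* A point w at distance less than e/4 near which v vanishes is the centre of a
   disc of radius e/2 contained in D; as 2 (5/16)^2 < (1/2)^2, it contains all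
   points at distance less than e/16 from z. *)
apply/nbhs_boxP; exists (e / 4) => // w w1 w2 vw; apply: nz.
apply/nbhs_boxP; exists (e / 16) => [|y y1 y2]; first by rewrite divr_gt0.
have key (t : R * R) : (t.1 - w.1) ^+ 2 + (t.2 - w.2) ^+ 2 < (e / 2) ^+ 2 -> D t.
  move=> ht; have [a b] : `|t.1 - w.1| < e / 2 /\ `|t.2 - w.2| < e / 2.
    have e2 : 0 <= e / 2 by rewrite divr_ge0 ?ltW.
    split; rewrite -(@ltr_pXn2r _ 2) ?nnegrE//; apply: le_lt_trans ht;
    by rewrite real_normK ?num_real// ?lerDl ?lerDr sqr_ge0.
  apply: eD.
    have -> : t.1 - z.1 = (t.1 - w.1) + (w.1 - z.1) by rewrite addrA subrK.
    apply: le_lt_trans (ler_normD _ _) _; exact: half_quarter.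
  have -> : t.2 - z.2 = (t.2 - w.2) + (w.2 - z.2) by rewrite addrA subrK.
  apply: le_lt_trans (ler_normD _ _) _; exact: half_quarter.
apply: (ucp_disc _ key vw); first by rewrite divr_gt0.
have [a b] : `|y.1 - w.1| < 5 / 16 * e /\ `|y.2 - w.2| < 5 / 16 * e.
  split.
    have -> : y.1 - w.1 = (y.1 - z.1) + (z.1 - w.1) by rewrite addrA subrK.
    apply: le_lt_trans (ler_normD _ _) _; rewrite distrC in w1; exact: sixteenth_quarter.
  have -> : y.2 - w.2 = (y.2 - z.2) + (z.2 - w.2) by rewrite addrA subrK.
  apply: le_lt_trans (ler_normD _ _) _; rewrite distrC in w2; exact: sixteenth_quarter.
have sq (t : R) : `|t| < 5 / 16 * e -> t ^+ 2 < (5 / 16 * e) ^+ 2.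
  by move=> ht; rewrite -[t ^+ 2]real_normK ?num_real// ltr_pXn2r ?nnegrE// mulr_ge0 ?ltW.
apply: lt_trans (ltrD (sq _ a) (sq _ b)) _; rewrite -subr_gt0.
have -> : (e / 2) ^+ 2 - ((5 / 16 * e) ^+ 2 + (5 / 16 * e) ^+ 2) = 14 / 256 * e ^+ 2 by field.
by rewrite mulr_gt0 ?exprn_gt0// divr_gt0.
Qed.

End UC.

Section SquareRoot.
Variables (S q : R * R -> R).
Hypotheses (hS : smooth D S) (hq : smooth D q).
Hypothesis pdeS : forall w, D w -> dx (dx S) w + dy (dy S) w = q w * S w.

Lemma laplacian_multiple (c : R) (v : R * R -> R) (U : set (R * R)) : open U -> U `<=` D ->
  (forall w, U w -> v w = c * S w) ->
  forall w, U w -> dx (dx v) w + dy (dy v) w = q w * v w.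
Proof.
move=> oU UD vS w Uw.
have hc := smooth_cst oD c.
have e1 z : U z -> dx v z = c * dx S z.
  by move=> Uz; rewrite (dx_ext oU vS Uz) (dxZ c hS (UD _ Uz)).
have e2 z : U z -> dy v z = c * dy S z.
  by move=> Uz; rewrite (dy_ext oU vS Uz) (dyZ c hS (UD _ Uz)).
rewrite (dx_ext oU e1 Uw) (dy_ext oU e2 Uw).
rewrite (dxZ c (smooth_dx hS) (UD _ Uw)) (dyZ c (smooth_dy hS) (UD _ Uw)).
by rewrite -mulrDr (pdeS (UD _ Uw)) (vS _ Uw) mulrCA.
Qed.

Lemma nonzero_near (f : R * R -> R) z : {for z, continuous f} -> f z != 0 ->
  \forall w \near z, f w != 0.
Proof.
move=> cf fz; have o : open [set x : R | x != 0] by exact: open_neq.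
exact: (cf _ (open_nbhs_nbhs (conj o fz))).
Qed.

(** The defect of the equation is 0 where v = tau - S does not vanish, because
    v = -2 S there, and where v vanishes identically nearby; these points are dense
    in D and the defect is continuous. *)
Lemma laplacian_difference (tau : R * R -> R) : smooth D tau ->
  (forall z, D z -> tau z ^+ 2 = S z ^+ 2) ->
  let v := fun w => tau w + - S w in
  forall z, D z -> dx (dx v) z + dy (dy v) z = q z * v z.
Proof.
move=> ht tS v z Dz.
have hv : smooth D v by rewrite /v; smooth_tac.
(* the defect of the equation for v *)
pose k := fun w => (dx (dx v) w + dy (dy v) w) + - (q w * v w).
have hk : smooth D k by rewrite /k; smooth_tac.
have kz w : D w -> v w != 0 -> k w = 0.
  move=> Dw vw; pose U := [set w | v w != 0] `&` D.
  have oU : open U.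
    rewrite openE => y [vy Dy]; apply: filterI; last exact: near_D.
    by apply: nonzero_near => //; exact: smooth_cont.
  apply/eqP; rewrite subr_eq0; apply/eqP.
  apply: (@laplacian_multiple (-2) v U) => //; first by move=> y [].
  move=> y [vy Dy].
  have : v y * (tau y + S y) = 0 by rewrite /v -subr_sqr tS ?subrr.
  move/eqP; rewrite mulf_eq0 (negbTE vy)/= addr_eq0 => /eqP tE.
  by rewrite /v tE mulNr mulr_natl mulr2n opprD.
apply/eqP; rewrite -subr_eq0; apply: contraT => kz0.
have kn : \forall w \near z, k w != 0 by apply: nonzero_near => //; exact: smooth_cont.
have vn : \forall w \near z, v w = 0.
  near=> w; apply/eqP; apply: contraT => vw.
  have kw : k w != 0 by near: w.
  by rewrite kz ?eqxx in kw => //; near: w; exact: near_D.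
pose U := (fun z => nbhs z [set w | v w = 0]) `&` D.
have oU : open U.
  rewrite openE => y [vy Dy]; apply: filterI; last exact: near_D.
  by apply: nbhs_interior.
have Uz : U z by [].
rewrite (@laplacian_multiple 0 v U)// ?subrr ?eqxx// in kz0.
- by move=> y [].
- by move=> y [/nbhs_singleton -> _]; rewrite mul0r.
Unshelve. all: by end_near. Qed.

End SquareRoot.

(** If tau differs from S at one point, then tau + S vanishes near that point, and it
    is a solution of the same equation. *)
Lemma smooth_square_root (S q tau : R * R -> R) : connected D -> smooth D S -> smooth D q ->
  (forall w, D w -> dx (dx S) w + dy (dy S) w = q w * S w) ->
  smooth D tau -> (forall z, D z -> tau z ^+ 2 = S z ^+ 2) ->
  (forall z, D z -> tau z = S z) \/ (forall z, D z -> tau z = - S z).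
Proof.
move=> cD hS hq pdeS ht tS.
have [tE|/existsNP[z1 /not_implyP[Dz1 tz1]]] := pselect (forall z, D z -> tau z = S z); first by left.
right=> z Dz.
pose v := fun w => tau w + - S w.
have hv : smooth D v by rewrite /v; smooth_tac.
have vz1 : v z1 != 0 by rewrite subr_eq0; apply/eqP.
pose T := fun w => - S w.
have hT : smooth D T by rewrite /T; smooth_tac.
have pdeT w : D w -> dx (dx T) w + dy (dy T) w = q w * T w.
  apply: (laplacian_multiple hS pdeS (c := -1) oD) => // y _.
  by rewrite mulN1r.
have tT w : D w -> tau w ^+ 2 = T w ^+ 2 by move=> Dw; rewrite sqrrN tS.
have pde := laplacian_difference hT hq pdeT ht tT.
have hw : smooth D (fun w => tau w + - T w) by smooth_tac.
have near1 : \forall w \near z1, tau w + - T w = 0.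
  near=> w.
  have vw : v w != 0 by near: w; apply: nonzero_near => //; exact: smooth_cont.
  have Dw : D w by near: w; exact: near_D.
  have : v w * (tau w + S w) = 0 by rewrite /v -subr_sqr tS ?subrr.
  by move/eqP; rewrite mulf_eq0 (negbTE vw)/= /T opprK => /eqP.
have := unique_continuation hw hq pde cD Dz1 near1 Dz.
by move/eqP; rewrite subr_eq0 => /eqP.
Unshelve. all: by end_near. Qed.

End Global.

(** * Bivectors and diagonal scalar products *)

Section Ord4.

Lemma ord4P (P : 'I_4 -> Prop) : P 0 -> P 1 -> P 2 -> P 3 -> forall i, P i.
Proof.
move=> p0 p1 p2 p3 [[|[|[|[|//]]]] h].
- by rewrite (_ : Ordinal h = 0)//; apply: val_inj.
- by rewrite (_ : Ordinal h = 1)//; apply: val_inj.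
- by rewrite (_ : Ordinal h = 2)//; apply: val_inj.
- by rewrite (_ : Ordinal h = 3)//; apply: val_inj.
Qed.

Lemma ord3P (P : 'I_3 -> Prop) : P 0 -> P 1 -> P 2 -> forall i, P i.
Proof.
move=> p0 p1 p2 [[|[|[|//]]] h].
- by rewrite (_ : Ordinal h = 0)//; apply: val_inj.
- by rewrite (_ : Ordinal h = 1)//; apply: val_inj.
- by rewrite (_ : Ordinal h = 2)//; apply: val_inj.
Qed.

Lemma sum4 (V : nmodType) (f : 'I_4 -> V) : \sum_i f i = f 0 + f 1 + f 2 + f 3.
Proof.
rewrite !big_ord_recl big_ord0 addr0 !addrA.
by do ![congr (_ + _)]; congr f; apply: val_inj.
Qed.

Lemma sum3 (V : nmodType) (f : 'I_3 -> V) : \sum_i f i = f 0 + f 1 + f 2.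
Proof.
rewrite !big_ord_recl big_ord0 addr0 !addrA.
by do ![congr (_ + _)]; congr f; apply: val_inj.
Qed.

End Ord4.

Section Bivectors.
Variable K : numFieldType.
Implicit Types (a b c : 'M[K]_4) (v w : 'rV[K]_4).

Lemma bivectorE a : bivector a -> forall i j, a j i = - a i j.
Proof. by move=> h i j; have := congr1 (fun (m : 'M[K]_4) => m i j) h; rewrite !mxE. Qed.

Lemma bivector_diag a : bivector a -> forall i, a i i = 0.
Proof.
move=> h i; have /eqP := bivectorE h i i; rewrite -addr_eq0 -mulr2n mulrn_eq0/= => /eqP.
exact.
Qed.

Lemma gbiv_sum a b : gbiv a b = 2^-1 * \sum_i \sum_j
  (a i j * (if (j < 2)%N then 1 else -1)) * (b j i * (if (i < 2)%N then 1 else -1)).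
Proof.
congr (_ * _); apply: eq_bigr => i _; rewrite /gram42 mul_mx_diag !mxE mulr_suml.
by apply: eq_bigr => j _; rewrite mul_mx_diag !mxE mulrA.
Qed.

Lemma gbivDl a b c : gbiv (a + b) c = gbiv a c + gbiv b c.
Proof. by rewrite /gbiv !mulmxDl mxtraceD mulrDr. Qed.
Lemma gbivDr a b c : gbiv a (b + c) = gbiv a b + gbiv a c.
Proof. by rewrite /gbiv !mulmxDr !mulmxDl mxtraceD mulrDr. Qed.
Lemma gbivZl k a b : gbiv (k *: a) b = k * gbiv a b.
Proof. by rewrite /gbiv -!scalemxAl mxtraceZ mulrCA. Qed.
Lemma gbivZr k a b : gbiv a (k *: b) = k * gbiv a b.
Proof. by rewrite /gbiv -!scalemxAr -!scalemxAl mxtraceZ mulrCA. Qed.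
Lemma gbivNr a b : gbiv a (- b) = - gbiv a b.
Proof. by rewrite -scaleN1r gbivZr mulN1r. Qed.
Lemma gbivC a b : gbiv a b = gbiv b a.
Proof.
rewrite !gbiv_sum exchange_big; congr (_ * _); apply: eq_bigr => i _.
by apply: eq_bigr => j _; rewrite mulrC.
Qed.

Lemma gbiv_bivector a b : bivector a -> bivector b -> gbiv a b =
  - (a 0 1 * b 0 1) + a 0 2 * b 0 2 + a 0 3 * b 0 3 + a 1 2 * b 1 2 + a 1 3 * b 1 3 - a 2 3 * b 2 3.
Proof.
move=> ha hb; rewrite gbiv_sum !sum4 /=.
rewrite !(bivector_diag ha) !(bivectorE hb 0 1) !(bivectorE hb 0 2) !(bivectorE hb 0 3).
rewrite !(bivectorE hb 1 2) !(bivectorE hb 1 3) !(bivectorE hb 2 3).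
rewrite !(bivectorE ha 0 1) !(bivectorE ha 0 2) !(bivectorE ha 0 3).
rewrite !(bivectorE ha 1 2) !(bivectorE ha 1 3) !(bivectorE ha 2 3).
by field.
Qed.

Definition basis_biv (i j : 'I_4) : 'M[K]_4 := wedge (delta_mx 0 i) (delta_mx 0 j).

Lemma basis_bivE i j k l : basis_biv i j k l = ((k == i) && (l == j))%:R - ((k == j) && (l == i))%:R.
Proof.
rewrite wedgeE !mxE !eqxx /= -!natrM !mulnb; congr (_ - _).
Qed.

(** Testing self-duality on the basis bivectors. *)
Lemma Lambda_plusP a : Lambda_plus a <->
  bivector a /\ [/\ a 2 3 = - a 0 1, a 1 3 = - a 0 2 & a 1 2 = a 0 3].
Proof.
split=> [[ba [_ star]]|[ba [e23 e13 e12]]].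
  split=> //.
  have bb i j : bivector (basis_biv i j) by exact: bivector_wedge.
  have s01 := star _ (bb 0 1); have s02 := star _ (bb 0 2); have s03 := star _ (bb 0 3).
  rewrite (gbiv_bivector (bb _ _) ba) /wedge22 !basis_bivE /= in s01.
  rewrite (gbiv_bivector (bb _ _) ba) /wedge22 !basis_bivE /= in s02.
  rewrite (gbiv_bivector (bb _ _) ba) /wedge22 !basis_bivE /= in s03.
  move: s01 s02 s03; rewrite ?subr0 ?mul1r ?mul0r ?subrr ?addr0 ?add0r ?oppr0 ?add0r ?addr0 ?subr0.
  by move=> s01 /eqP; rewrite eqr_oppLR => /eqP s02 s03; split.
split=> //; split=> // b bb; rewrite gbiv_bivector// /wedge22 e23 e13 e12.
by ring.
Qed.

Lemma Lambda_plusZ (k : K) a : Lambda_plus a -> Lambda_plus (k *: a).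
Proof.
move=> /Lambda_plusP[ba [h1 h2 h3]]; apply/Lambda_plusP; split.
  have ba' : a^T = - a := ba.
  by rewrite /bivector /= linearZ /= ba' scalerN.
by rewrite !mxE h1 h2 h3 !mulrN.
Qed.

Lemma gbiv_Lambda a b : Lambda_plus a -> Lambda_plus b ->
  gbiv a b = 2 * (- (a 0 1 * b 0 1) + a 0 2 * b 0 2 + a 0 3 * b 0 3).
Proof.
move=> /Lambda_plusP[ba [e1 e2 e3]] /Lambda_plusP[bb [f1 f2 f3]].
by rewrite gbiv_bivector// e1 e2 e3 f1 f2 f3; ring.
Qed.

End Bivectors.

Section Orthogonal.
Variables (K : fieldType) (n : nat) (eta : 'I_n -> K).

Definition ipw (v w : 'rV[K]_n) : K := \sum_i eta i * v 0 i * w 0 i.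

Lemma ipwC v w : ipw v w = ipw w v.
Proof. by apply: eq_bigr => i _; rewrite mulrAC. Qed.

(** The matrix of the basis is invertible because its Gram matrix is diagonal. *)
Lemma ortho_expansion (b : 'I_n -> 'rV[K]_n) (d : 'I_n -> K) (v : 'rV[K]_n) :
  (forall i j, ipw (b i) (b j) = d i *+ (i == j)) -> (forall i, d i != 0) ->
  v = \sum_i (ipw v (b i) / d i) *: b i.
Proof.
move=> bd d0.
pose M := \matrix_(i, j) b i 0 j : 'M[K]_n.
pose T := \matrix_(i, j) (b i 0 j * eta j / d i) : 'M[K]_n.
have TM : T *m M^T = 1%:M.
  apply/matrixP => i j; rewrite !mxE.
  transitivity (ipw (b i) (b j) / d i).
    by rewrite mulr_suml; apply: eq_bigr => k _; rewrite !mxE; rewrite mulrAC [b i 0 k * _]mulrC.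
  by rewrite bd -mulr_natr mulrAC divff ?mul1r// eq_sym.
have MT := mulmx1C TM.
apply/trmx_inj; rewrite -[LHS]mul1mx -MT -mulmxA.
apply/matrixP => i j; rewrite !mxE summxE ord1; apply: eq_bigr => k _.
rewrite !mxE mulrC; congr (_ * _).
rewrite /ipw mulr_suml; apply: eq_bigr => l _; rewrite !mxE.
by ring.
Qed.

End Orthogonal.

Lemma ip42_ipw (K : fieldType) (v w : 'rV[K]_4) :
  ip42 v w = ipw (fun i : 'I_4 => if (i < 2)%N then 1 else -1) v w.
Proof. by rewrite /ipw sum4 /ip42 /= !mul1r !mulN1r !mulNr. Qed.

(** * Calculus of vector-valued maps *)

Section VectorCalculus.
Context {R : realType}.
Variable D : set (R * R).
Hypothesis oD : open D.

Lemma dvsum {V : normedModType R} n (h : 'I_n -> V -> R) z v (dh : 'I_n -> R) :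
  (forall i, is_derive z v (h i) (dh i)) ->
  is_derive z v (fun w => \sum_i h i w) (\sum_i dh i).
Proof.
move=> H; have -> : (fun w => \sum_i h i w) = \sum_i h i.
  by apply/funext => w; rewrite fct_sumE.
exact: is_derive_sum.
Qed.

Lemma smooth_sum n (h : 'I_n -> R * R -> R) :
  (forall i, smooth D (h i)) -> smooth D (fun w => \sum_i h i w).
Proof.
elim: n h => [|n IH] h H.
  by apply: smooth_ext (smooth_cst oD 0) => // z _; rewrite big_ord0.
apply: (smooth_ext oD (f := fun w => h ord0 w + \sum_i h (lift ord0 i) w)).
  by move=> z _; rewrite big_ord_recl.
by apply: smoothD => //; apply: IH => i; apply: H.
Qed.

Section Mx.
Variables (m n : nat) (M : R * R -> 'M[R]_(m, n)).
Hypothesis hM : smooth D M.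

Lemma smooth_entry i j : smooth D (fun w => M w i j).
Proof. exact: (smooth_mxP oD M).1. Qed.

Lemma dx_mx z i j : D z -> dx M z i j = dx (fun w => M w i j) z.
Proof. by move=> Dz; have [_ <-] := (is_derive_mxP _ _ _ _).1 (smooth_isdx hM Dz) i j. Qed.
Lemma dy_mx z i j : D z -> dy M z i j = dy (fun w => M w i j) z.
Proof. by move=> Dz; have [_ <-] := (is_derive_mxP _ _ _ _).1 (smooth_isdy hM Dz) i j. Qed.

End Mx.

Lemma mx_Schwarz m n (M : R * R -> 'M[R]_(m, n)) z : smooth D M -> D z ->
  dx (dy M) z = dy (dx M) z.
Proof.
move=> hM Dz; apply/matrixP => i j.
have hx := smooth_dx hM; have hy := smooth_dy hM.
have e1 : dx (dy M) z i j = dx (dy (fun w => M w i j)) z.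
  apply: etrans (dx_mx hy i j Dz) _; apply: (dx_ext oD) Dz => w Dw; exact: dy_mx.
have e2 : dy (dx M) z i j = dy (dx (fun w => M w i j)) z.
  apply: etrans (dy_mx hx i j Dz) _; apply: (dy_ext oD) Dz => w Dw; exact: dx_mx.
apply: etrans e1 _; apply: etrans _ (esym e2).
exact (smooth_Schwarz oD (smooth_entry hM i j) Dz).
Qed.

Section Product.
Variables (n : nat) (eta : 'I_n -> R) (f g : R * R -> 'rV[R]_n).
Hypotheses (hf : smooth D f) (hg : smooth D g).

Lemma smooth_ipw : smooth D (fun w => ipw eta (f w) (g w)).
Proof.
apply: smooth_sum => i; apply: smoothM => //; last exact: smooth_entry.
by apply: smoothM => //; [exact: smooth_cst|exact: smooth_entry].
Qed.

Lemma isd_ipw (v z : R * R) (df dg : 'rV[R]_n) :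
  is_derive z v f df -> is_derive z v g dg ->
  is_derive z v (fun w => ipw eta (f w) (g w)) (ipw eta df (g z) + ipw eta (f z) dg).
Proof.
move=> /is_derive_mxP Hf /is_derive_mxP Hg.
have -> : ipw eta df (g z) + ipw eta (f z) dg =
  \sum_i ((0 * f z 0 i + eta i * df 0 i) * g z 0 i + eta i * f z 0 i * dg 0 i).
  by rewrite /ipw -big_split; apply: eq_bigr => i _; rewrite mul0r add0r.
by apply: dvsum => i; exact: (dvM (dvM (dvC (eta i) z v) (Hf 0 i)) (Hg 0 i)).
Qed.

Lemma dx_ipw z : D z ->
  dx (fun w => ipw eta (f w) (g w)) z = ipw eta (dx f z) (g z) + ipw eta (f z) (dx g z).
Proof. by move=> Dz; have [_] := isd_ipw (smooth_isdx hf Dz) (smooth_isdx hg Dz). Qed.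
Lemma dy_ipw z : D z ->
  dy (fun w => ipw eta (f w) (g w)) z = ipw eta (dy f z) (g z) + ipw eta (f z) (dy g z).
Proof. by move=> Dz; have [_] := isd_ipw (smooth_isdy hf Dz) (smooth_isdy hg Dz). Qed.
End Product.

Lemma d_zE (f : R * R -> R) z :
  d_z (fun w => (f w)%:C) z = (dx f z / 2) +i* (- (dy f z / 2)).
Proof.
rewrite /d_z /dxC /dyC /=.
have -> : dx (fun w : plane R => 0 : R) z = 0 by rewrite /dx derive_cst.
have -> : dy (fun w : plane R => 0 : R) z = 0 by rewrite /dy derive_cst.
have h2 : (2 : R[i])^-1 = (2^-1)%:C by rewrite -(rmorph_nat (real_complex R)) fmorphV.
by rewrite h2; simpc; congr (_ +i* _); rewrite /=; ring.
Qed.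

Lemma sinh_gordon_laplacian (u : R * R -> R) z : smooth D u -> sinh_gordon D u -> D z ->
  dx (dx u) z + dy (dy u) z = 2 * sinh (2 * u z).
Proof.
move=> hu sg Dz; have := sg z Dz.
have E : d_z (fun w => (u w)%:C) = (fun w => (dx u w / 2) +i* (- (dy u w / 2))).
  by apply/funext => w; exact: d_zE.
rewrite E /d_zbar /dxC /dyC /=.
have hx := smooth_dx hu; have hy := smooth_dy hu.
have e1 (f : R * R -> R) : smooth D f -> dx (fun w => f w / 2) z = dx f z / 2.
  by move=> hf; have [_] := dvM (smooth_isdx hf Dz) (dvC (2^-1) _ _); rewrite mulr0 addr0.
have e2 (f : R * R -> R) : smooth D f -> dy (fun w => f w / 2) z = dy f z / 2.
  by move=> hf; have [_] := dvM (smooth_isdy hf Dz) (dvC (2^-1) _ _); rewrite mulr0 addr0.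
have e3 : dx (fun w => - (dy u w / 2)) z = - (dx (dy u) z / 2).
  have [_] := dvN (dvM (smooth_isdx hy Dz) (dvC (2^-1) _ _)); by rewrite mulr0 addr0.
have e4 : dy (fun w => - (dy u w / 2)) z = - (dy (dy u) z / 2).
  have [_] := dvN (dvM (smooth_isdy hy Dz) (dvC (2^-1) _ _)); by rewrite mulr0 addr0.
rewrite (e1 _ hx) (e2 _ hx) e3 e4.
move: (dx (dx u) z) (dy (dy u) z) (dx (dy u) z) (dy (dx u) z) (sinh _) => p q r1 r2 r.
have h2 : (2 : R[i])^-1 = (2^-1)%:C by rewrite -(rmorph_nat (real_complex R)) fmorphV.
rewrite h2; simpc => /eqP; rewrite eq_complex /= => /andP[/eqP h _].
apply/eqP; rewrite -subr_eq0; apply/eqP; rewrite -[RHS](mulr0 4) -h.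
by field.
Qed.

End VectorCalculus.

(** * Surfaces in anti-de Sitter space: pointwise algebra *)

Section Conformal.
Context {R : realType} {V : normedModType R}.
Variables (B : V -> V -> R) (F : R * R -> V) (z : R * R) (xi : V) (lam : R).

Lemma mean_curvature_conformal : 0 < lam ->
  B (dx F z) (dx F z) = lam -> B (dy F z) (dy F z) = lam -> B (dx F z) (dy F z) = 0 ->
  mean_curvature B F z xi = (B (dx (dx F) z) xi + B (dy (dy F) z) xi) / (2 * lam).
Proof.
rewrite /mean_curvature.
move: (dx (dx F) z) (dx (dy F) z) (dy (dy F) z) (dx F z) (dy F z) => a b c p q l0 -> -> ->.
move: (B a xi) (B b xi) (B c xi) => a' b' c'; field.
by rewrite gt_eqF.
Qed.

End Conformal.

Section SecondFormArith.
Variable K : realFieldType.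

(** The second fundamental form (L, M, P) is trace-free and its two remaining
    coefficients are read off from the Hopf differential. *)
Lemma second_form_arith (k L M P s c n1 n2 n3 n4 : K) : 0 < k ->
  n1 + L = 0 -> n2 + M = 0 -> n3 + M = 0 -> n4 + P = 0 ->
  (L + P) / (2 * k) = 0 -> (n1 - n4) / 4 = - (s / 2) -> - ((n2 + n3) / 4) = c / 2 ->
  [/\ L = s, M = c & P = - s].
Proof.
move=> k0 a1 a2 a3 a4 h h1 h2.
have LP : L + P = 0.
  by move: h => /eqP; rewrite mulf_eq0 invr_eq0 mulf_eq0 (gt_eqF k0) (pnatr_eq0 K 2) !orbF => /eqP.
by split; lra.
Qed.

End SecondFormArith.

Notation eta4 R := (fun i : 'I_4 => if (i < 2)%N then 1 else -1 : R).

Lemma ip42E (K : fieldType) (v w : 'rV[K]_4) :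
  ip42 v w = v 0 0 * w 0 0 + v 0 1 * w 0 1 - v 0 2 * w 0 2 - v 0 3 * w 0 3.
Proof. by []. Qed.

Section Frame4.
Variable K : numFieldType.
Variables (X Y p N : 'rV[K]_4) (E : K).
Hypotheses (E0 : E != 0) (XX : ip42 X X = E) (YY : ip42 Y Y = E) (XY : ip42 X Y = 0)
  (pp : ip42 p p = -1) (NN : ip42 N N = -1) (Np : ip42 N p = 0)
  (NX : ip42 N X = 0) (NY : ip42 N Y = 0) (pX : ip42 p X = 0) (pY : ip42 p Y = 0).

Lemma ip42C (v w : 'rV[K]_4) : ip42 v w = ip42 w v.
Proof. by rewrite !ip42_ipw ipwC. Qed.

Lemma frame4_expansion v : v = (ip42 v X / E) *: X + (ip42 v Y / E) *: Y
   - ip42 v p *: p - ip42 v N *: N.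
Proof.
have [XN YN Xp Yp pN] : [/\ ip42 X N = 0, ip42 Y N = 0, ip42 X p = 0, ip42 Y p = 0 & ip42 p N = 0].
  by split; rewrite ip42C.
have YX : ip42 Y X = 0 by rewrite ip42C.
pose b (i : 'I_4) := nth 0 [:: X; Y; p; N] i.
pose d (i : 'I_4) := nth 0 [:: E; E; -1; -1] i.
have bd : forall i j, ipw (eta4 K) (b i) (b j) = d i *+ (i == j).
  apply: (@ord4P (fun i => forall j, ipw (eta4 K) (b i) (b j) = d i *+ (i == j)));
    apply: (@ord4P (fun j => ipw (eta4 K) (b _) (b j) = d _ *+ (_ == j)));
    by rewrite -ip42_ipw /b /d /= ?mulr1n ?mulr0n.
have d0 : forall i, d i != 0.
  by apply: (@ord4P (fun i => d i != 0)); rewrite /d /= ?oppr_eq0 ?oner_eq0.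
rewrite {1}(ortho_expansion v bd d0) sum4 -!ip42_ipw /b /d /=.
by rewrite invrN1 !mulrN1 !scaleNr.
Qed.

(** The Gram determinant of the frame is the square of its determinant, [gram42]
    having determinant 1. *)
Lemma det_frame4 : \det (rows4 X Y p N) ^+ 2 = E ^+ 2.
Proof.
have [XN YN Xp Yp pN] : [/\ ip42 X N = 0, ip42 Y N = 0, ip42 X p = 0, ip42 Y p = 0 & ip42 p N = 0].
  by split; rewrite ip42C.
have YX : ip42 Y X = 0 by rewrite ip42C.
have bd : forall i j : 'I_4, ip42 (nth 0 [:: X; Y; p; N] i) (nth 0 [:: X; Y; p; N] j) = nth 0 [:: E; E; -1; -1] i *+ (i == j).
  apply: (@ord4P (fun i => forall j : 'I_4, ip42 (nth 0 [:: X; Y; p; N] i) (nth 0 [:: X; Y; p; N] j) = nth 0 [:: E; E; -1; -1] i *+ (i == j)));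
    apply: (@ord4P (fun j => ip42 (nth 0 [:: X; Y; p; N] _) (nth 0 [:: X; Y; p; N] j) = nth 0 [:: E; E; -1; -1] _ *+ (_ == j)));
    by rewrite /= ?mulr1n ?mulr0n.
pose d : 'rV[K]_4 := \row_i nth 0 [:: E; E; -1; -1] i.
have G : rows4 X Y p N *m gram42 K *m (rows4 X Y p N)^T = diag_mx d.
  apply/matrixP => i j; rewrite /gram42 mul_mx_diag !mxE.
  transitivity (ip42 (nth 0 [:: X; Y; p; N] i) (nth 0 [:: X; Y; p; N] j)).
    rewrite ip42_ipw; apply: eq_bigr => k _; rewrite !mxE; congr (_ * _); rewrite mulrC; congr (_ * _).
  exact: bd.
have := congr1 (@determinant K 4) G.
rewrite !det_mulmx det_tr /gram42 !det_diag.
rewrite !big_ord_recl !big_ord0 !mxE /=.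
by rewrite !(mul1r, mulr1, mulN1r, mulrN1, opprK) -!expr2.
Qed.

Lemma wedgeNC (v w : 'rV[K]_4) : wedge v w = - wedge w v.
Proof. by rewrite /wedge opprB. Qed.

End Frame4.

Section Duality.
Variable K : realFieldType.
Variables (X Y p N : 'rV[K]_4) (E : K).
Hypotheses (E0 : 0 < E) (XX : ip42 X X = E) (YY : ip42 Y Y = E) (XY : ip42 X Y = 0)
  (pp : ip42 p p = -1) (NN : ip42 N N = -1) (Np : ip42 N p = 0)
  (NX : ip42 N X = 0) (NY : ip42 N Y = 0) (pX : ip42 p X = 0) (pY : ip42 p Y = 0)
  (det0 : 0 < \det (rows4 X Y p N)).

(** Both sides only see the tangential components of v and w, and they agree for
    v = X and w = Y. *)
Lemma wedge22_normal v w : wedge22 (wedge v w) (wedge N p) = gbiv (wedge v w) (E^-1 *: wedge X Y).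
Proof.
have En : E != 0 by rewrite gt_eqF.
have dE : \det (rows4 X Y p N) = E.
  have := det_frame4 XX YY XY pp NN Np NX NY pX pY.
  move/eqP; rewrite eqf_sqr => /orP[/eqP//|/eqP h].
  by move: det0; rewrite h oppr_gt0 ltNge (ltW E0).
have D1 : wedge22 (wedge X Y) (wedge N p) = - E.
  rewrite -dE -wedge22_wedge [wedge N p]wedgeNC /wedge22 !mxE; ring.
rewrite gbivZr gbiv_wedge.
have vE := frame4_expansion En XX YY XY pp NN Np NX NY pX pY v.
have wE := frame4_expansion En XX YY XY pp NN Np NX NY pX pY w.
have -> : E^-1 * (ip42 v Y * ip42 w X - ip42 v X * ip42 w Y) =
  (ip42 v X / E * (ip42 w Y / E) - ip42 v Y / E * (ip42 w X / E)) * (- E).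
  by field.
rewrite -D1; move: vE wE.
move: (ip42 v X / E) (ip42 v Y / E) (ip42 v p) (ip42 v N) => v1 v2 v3 v4.
move: (ip42 w X / E) (ip42 w Y / E) (ip42 w p) (ip42 w N) => w1 w2 w3 w4 -> ->.
rewrite /wedge22 !wedgeE !mxE; clear.
move: (X 0 0) (X 0 1) (X 0 2) (X 0 3) (Y 0 0) (Y 0 1) (Y 0 2) (Y 0 3).
move: (p 0 0) (p 0 1) (p 0 2) (p 0 3) (N 0 0) (N 0 1) (N 0 2) (N 0 3); clear => *.
ring.
Qed.

Let b := E^-1 *: wedge X Y.
Let c := wedge N p.

(** The oriented normal plane N /\ p is the dual of the oriented tangent plane
    E^-1 X /\ Y.  This is where the orientation of N enters. *)
Lemma normal_plane_dual :
  [/\ c 0 1 = - b 2 3, c 0 2 = - b 1 3 & c 0 3 = b 1 2] /\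
  [/\ c 1 2 = b 0 3, c 1 3 = - b 0 2 & c 2 3 = - b 0 1].
Proof.
have bb : bivector b.
  by rewrite /b /bivector /= linearZ /= (bivector_wedge X Y) scalerN.
have bi i j : bivector (basis_biv K i j) by exact: bivector_wedge.
have H i j := wedge22_normal (delta_mx 0 i) (delta_mx 0 j).
have h01 := H 0 1; have h02 := H 0 2; have h03 := H 0 3.
have h12 := H 1 2; have h13 := H 1 3; have h23 := H 2 3.
rewrite -/(basis_biv K _ _) -/b -/c (gbiv_bivector (bi _ _) bb) /wedge22 !basis_bivE /= in h01.
rewrite -/(basis_biv K _ _) -/b -/c (gbiv_bivector (bi _ _) bb) /wedge22 !basis_bivE /= in h02.
rewrite -/(basis_biv K _ _) -/b -/c (gbiv_bivector (bi _ _) bb) /wedge22 !basis_bivE /= in h03.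
rewrite -/(basis_biv K _ _) -/b -/c (gbiv_bivector (bi _ _) bb) /wedge22 !basis_bivE /= in h12.
rewrite -/(basis_biv K _ _) -/b -/c (gbiv_bivector (bi _ _) bb) /wedge22 !basis_bivE /= in h13.
rewrite -/(basis_biv K _ _) -/b -/c (gbiv_bivector (bi _ _) bb) /wedge22 !basis_bivE /= in h23.
move: h01 h02 h03 h12 h13 h23.
rewrite ?(subr0, mul1r, mul0r, subrr, addr0, add0r, oppr0, sub0r).
by move=> -> /eqP + -> -> /eqP + ->; rewrite !eqr_oppLR => /eqP -> /eqP ->.
Qed.

Lemma gauss_Lambda_plus : Lambda_plus (b + c).
Proof.
apply/Lambda_plusP; split.
  apply/matrixP => i j; rewrite !mxE !big_ord1 !mxE; ring.
have [[h01 h02 h03] [h12 h13 h23]] := normal_plane_dual.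
rewrite ![(b + c) _ _]mxE h01 h02 h03 h12 h13 h23.
by split; ring.
Qed.

End Duality.

(** * Derivatives of the Gauss map: pointwise algebra *)

Section GaussMapAlgebra.
Variable K : numFieldType.
Variables (X Y p N : 'rV[K]_4) (ux uy E e s c : K).
Hypothesis Ee : E * e = 1.

Let Xx := ux *: X - uy *: Y + E *: p - s *: N.
Let Xy := uy *: X + ux *: Y - c *: N.
Let Yy := - ux *: X + uy *: Y + E *: p + s *: N.
Let Nx := - (e * s) *: X - (e * c) *: Y.
Let Ny := - (e * c) *: X + (e * s) *: Y.
Let W := e *: wedge X Y + wedge N p.
Let A1 := wedge N X + wedge p Y.
Let A2 := wedge N Y - wedge p X.

Local Ltac entries i j x x' y y' q q' n n' :=
  apply/matrixP => i j; rewrite !mxE !big_ord1 !mxE;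
  move: (X 0 i) (X 0 j) (Y 0 i) (Y 0 j) (p 0 i) (p 0 j) (N 0 i) (N 0 j) => x x' y y' q q' n n'.

(** In this and the following identities the frame (X, Y, p, N) is formal: both sides
    are equal once its derivatives are replaced by the Gauss-Weingarten expressions
    Xx, ..., Ny. *)
Lemma gauss_dx_alg : (- (2 * ux) * e) *: wedge X Y + e *: (wedge Xx Y + wedge X Xy) +
  (wedge Nx p + wedge N X) = (1 + e * c) *: A1 - (e * s) *: A2.
Proof.
entries i j x x' y y' q q' n n'.
apply/eqP; rewrite -subr_eq0; apply/eqP.
rewrite (_ : _ - _ = (E * e - 1) * (q * y' - y * q')); last by ring.
by rewrite Ee subrr mul0r.
Qed.

Lemma gauss_dy_alg : (- (2 * uy) * e) *: wedge X Y + e *: (wedge Xy Y + wedge X Yy) +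
  (wedge Ny p + wedge N Y) = - (e * s) *: A1 + (1 - e * c) *: A2.
Proof.
entries i j x x' y y' q q' n n'.
apply/eqP; rewrite -subr_eq0; apply/eqP.
rewrite (_ : _ - _ = (E * e - 1) * (x * q' - q * x')); last by ring.
by rewrite Ee subrr mul0r.
Qed.

Lemma A1_dx_alg : (wedge Nx X + wedge N Xx) + (wedge X Y + wedge p Xy) =
  ux *: A1 - uy *: A2 + (E + c) *: W.
Proof.
entries i j x x' y y' q q' n n'.
apply/eqP; rewrite -subr_eq0; apply/eqP.
rewrite (_ : _ - _ = (1 - E * e) * (x * y' - y * x')); last by ring.
by rewrite Ee subrr mul0r.
Qed.

Lemma A2_dx_alg : (wedge Nx Y + wedge N Xy) - (wedge X X + wedge p Xx) =
  uy *: A1 + ux *: A2 - s *: W.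
Proof.
entries i j x x' y y' q q' n n'.
ring.
Qed.

Lemma A1_dy_alg : (wedge Ny X + wedge N Xy) + (wedge Y Y + wedge p Yy) =
  uy *: A1 + ux *: A2 - s *: W.
Proof.
entries i j x x' y y' q q' n n'.
ring.
Qed.

Lemma A2_dy_alg : (wedge Ny Y + wedge N Yy) - (wedge Y X + wedge p Xy) =
  - ux *: A1 + uy *: A2 + (E - c) *: W.
Proof.
entries i j x x' y y' q q' n n'.
apply/eqP; rewrite -subr_eq0; apply/eqP.
rewrite (_ : _ - _ = (1 - E * e) * (x * y' - y * x')); last by ring.
by rewrite Ee subrr mul0r.
Qed.

(** The coefficients of A1 and A2 cancel between the two second derivatives. *)
Lemma laplacian_alg (D1x D2x D1y D2y : 'M[K]_4) : c ^+ 2 + s ^+ 2 = 1 ->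
  D1x = ux *: A1 - uy *: A2 + (E + c) *: W -> D2x = uy *: A1 + ux *: A2 - s *: W ->
  D1y = uy *: A1 + ux *: A2 - s *: W -> D2y = - ux *: A1 + uy *: A2 + (E - c) *: W ->
  ((- (2 * ux) * e * c) *: A1 + (1 + e * c) *: D1x - ((- (2 * ux) * e * s) *: A2 + (e * s) *: D2x))
  + (- ((- (2 * uy) * e * s) *: A1 + (e * s) *: D1y) + ((- (- (2 * uy) * e * c)) *: A2 + (1 - e * c) *: D2y))
  = (2 * (E + e)) *: W.
Proof.
move=> cs -> -> -> ->; apply/matrixP => i j; rewrite !mxE.
move: (A1 i j) (A2 i j) => a1 a2.
rewrite !big_ord1 !mxE; set w := (e * _ + _).
have -> : 2 * (E + e) * w = 2 * (E + e * (c ^+ 2 + s ^+ 2)) * w by rewrite cs mulr1.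
ring.
Qed.

Section Metric.
Hypotheses (XX : ip42 X X = E) (YY : ip42 Y Y = E) (XY : ip42 X Y = 0)
  (pp : ip42 p p = -1) (NN : ip42 N N = -1) (Np : ip42 N p = 0)
  (NX : ip42 N X = 0) (NY : ip42 N Y = 0) (pX : ip42 p X = 0) (pY : ip42 p Y = 0).

Let YX : ip42 Y X = 0. Proof. by rewrite ip42C. Qed.
Let pN : ip42 p N = 0. Proof. by rewrite ip42C. Qed.
Let XN : ip42 X N = 0. Proof. by rewrite ip42C. Qed.
Let YN : ip42 Y N = 0. Proof. by rewrite ip42C. Qed.
Let Xp : ip42 X p = 0. Proof. by rewrite ip42C. Qed.
Let Yp : ip42 Y p = 0. Proof. by rewrite ip42C. Qed.
Let gram := (XX, YY, XY, pp, NN, Np, NX, NY, pX, pY, YX, pN, XN, YN, Xp, Yp).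

Let B1 a : gbiv a A1 = gbiv a (wedge N X) + gbiv a (wedge p Y).
Proof. exact: gbivDr. Qed.
Let B2 a : gbiv a A2 = gbiv a (wedge N Y) - gbiv a (wedge p X).
Proof. by rewrite /A2 (gbivDr a (wedge N Y)) (gbivNr a (wedge p X)). Qed.
Let BW a : gbiv a W = e * gbiv a (wedge X Y) + gbiv a (wedge N p).
Proof. by rewrite /W (gbivDr a (e *: _)) (gbivZr e a). Qed.
Let C1 a : gbiv A1 a = gbiv (wedge N X) a + gbiv (wedge p Y) a.
Proof. by rewrite gbivC B1 ![gbiv a _]gbivC. Qed.
Let C2 a : gbiv A2 a = gbiv (wedge N Y) a - gbiv (wedge p X) a.
Proof. by rewrite gbivC B2 ![gbiv a _]gbivC. Qed.
Let CW a : gbiv W a = e * gbiv (wedge X Y) a + gbiv (wedge N p) a.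
Proof. by rewrite gbivC BW ![gbiv a _]gbivC. Qed.

Lemma gbiv_A1A1 : gbiv A1 A1 = 2 * E.
Proof. rewrite B1 !C1 !gbiv_wedge !gram; ring. Qed.
Lemma gbiv_A1A2 : gbiv A1 A2 = 0.
Proof. rewrite B2 !C1 !gbiv_wedge !gram; ring. Qed.
Lemma gbiv_A2A2 : gbiv A2 A2 = 2 * E.
Proof. rewrite B2 !C2 !gbiv_wedge !gram; ring. Qed.
Lemma gbiv_WW : gbiv W W = -2.
Proof.
rewrite BW !CW !gbiv_wedge !gram.
transitivity (- ((E * e) * (E * e)) - 1); first by ring.
rewrite Ee; ring.
Qed.

Lemma gbiv_combination (a b a' b' : K) :
  gbiv (a *: A1 + b *: A2) (a' *: A1 + b' *: A2) = 2 * E * (a * a' + b * b').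
Proof.
rewrite gbivDl !(gbivDr _ (a' *: A1)) !(gbivZl _ A1) !(gbivZl _ A2) !(gbivZr _ _ A1) !(gbivZr _ _ A2).
rewrite gbiv_A1A1 gbiv_A2A2 [gbiv A2 A1]gbivC gbiv_A1A2; ring.
Qed.
End Metric.

End GaussMapAlgebra.

(** * Hopf differentials and calculus of bivector fields *)

(* From here on [dx] and [dy] are only handled through the rules above. *)
Opaque dx dy.

Section HopfBivector.
Context {R : realType}.
Variable D : set (R * R).
Hypothesis oD : open D.

Lemma gbiv_map (a b : 'M[R]_4) :
  gbiv (map_mx (real_complex R) a) (map_mx (real_complex R) b) = (gbiv a b)%:C.
Proof.
rewrite !gbiv_sum [RHS]rmorphM fmorphV rmorph_nat; congr (_ * _).
rewrite rmorph_sum; apply: eq_bigr => i _; rewrite rmorph_sum; apply: eq_bigr => j _.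
rewrite !mxE !rmorphM; congr (_ * _ * (_ * _)).
  by case: ifP; rewrite ?rmorphN ?rmorph1.
by case: ifP; rewrite ?rmorphN ?rmorph1.
Qed.

Lemma gbiv_mx_z (f : R * R -> 'M[R]_4) z : smooth D f -> D z ->
  gbiv (mx_z f z) (mx_z f z) = ((gbiv (dx f z) (dx f z) - gbiv (dy f z) (dy f z)) / 4) +i*
    (- (gbiv (dx f z) (dy f z) / 2)).
Proof.
move=> hf Dz.
have h2 : (2 : R[i])^-1 = (2^-1)%:C by rewrite -(rmorph_nat (real_complex R)) fmorphV.
have E : mx_z f z = (2^-1)%:C *: map_mx (real_complex R) (dx f z) +
   (0 +i* (- 2^-1)) *: map_mx (real_complex R) (dy f z).
  apply/matrixP => i j.
  have -> : mx_z f z i j = (dx f z i j / 2) +i* (- (dy f z i j / 2)).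
    by rewrite /mx_z mxE d_zE -(dx_mx hf i j Dz) -(dy_mx hf i j Dz).
  move: (dx f z) (dy f z) => a b; rewrite !mxE; move: (a i j) (b i j) => {}a {}b.
  by simpc; congr (_ +i* _); rewrite mulrC.
rewrite E; move: (dx f z) (dy f z) => a b.
set a' := map_mx _ a; set b' := map_mx _ b.
rewrite gbivDl !(gbivDr _ (_ *: a')) !(gbivZl _ a') !(gbivZl _ b') !(gbivZr _ _ a') !(gbivZr _ _ b').
rewrite /a' /b' !gbiv_map [gbiv b a]gbivC.
move: (gbiv a a) (gbiv a b) (gbiv b b) => p q r; simpc.
by congr (_ +i* _); rewrite /=; field.
Qed.

Lemma isd_wedge (f g : R * R -> 'rV[R]_4) (z v : R * R) df dg :
  is_derive z v f df -> is_derive z v g dg ->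
  is_derive z v (fun w => wedge (f w) (g w)) (wedge df (g z) + wedge (f z) dg).
Proof.
move=> /is_derive_mxP Hf /is_derive_mxP Hg; apply/is_derive_mxP => i j.
have -> : (wedge df (g z) + wedge (f z) dg) i j =
  (df 0 i * g z 0 j + f z 0 i * dg 0 j) + - (dg 0 i * f z 0 j + g z 0 i * df 0 j).
  by rewrite mxE !wedgeE; ring.
have -> : (fun w => wedge (f w) (g w) i j) = (fun w => f w 0 i * g w 0 j + - (g w 0 i * f w 0 j)).
  by apply/funext => w; rewrite wedgeE.
exact: (dvD (dvM (Hf 0 i) (Hg 0 j)) (dvN (dvM (Hg 0 i) (Hf 0 j)))).
Qed.

Lemma isd_scale m n (k : R * R -> R) (M : R * R -> 'M[R]_(m, n)) (z v : R * R) dk dM :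
  is_derive z v k dk -> is_derive z v M dM ->
  is_derive z v (fun w => k w *: M w) (dk *: M z + k z *: dM).
Proof.
move=> Hk /is_derive_mxP HM; apply/is_derive_mxP => i j.
have -> : (fun w => (k w *: M w) i j) = (fun w => k w * M w i j).
  by apply/funext => w; rewrite mxE.
have -> : (dk *: M z + k z *: dM) i j = dk * M z i j + k z * dM i j by rewrite !mxE.
exact: (dvM Hk (HM i j)).
Qed.

Lemma isd_add m n (M P : R * R -> 'M[R]_(m, n)) (z v : R * R) dM dP :
  is_derive z v M dM -> is_derive z v P dP ->
  is_derive z v (fun w => M w + P w) (dM + dP).
Proof. by move=> ? ?; exact: is_deriveD. Qed.

Lemma isd_opp m n (M : R * R -> 'M[R]_(m, n)) (z v : R * R) dM :
  is_derive z v M dM -> is_derive z v (fun w => - M w) (- dM).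
Proof. by move=> ?; exact: is_deriveN. Qed.

Lemma smooth_scale m n (k : R * R -> R) (M : R * R -> 'M[R]_(m, n)) :
  smooth D k -> smooth D M -> smooth D (fun w => k w *: M w).
Proof.
move=> hk hM; apply/(smooth_mxP oD) => i j.
apply: (smooth_ext oD (f := fun w => k w * M w i j)); first by move=> z _; rewrite mxE.
exact: (smoothM oD hk (smooth_entry oD hM i j)).
Qed.

Lemma smooth_add m n (M P : R * R -> 'M[R]_(m, n)) :
  smooth D M -> smooth D P -> smooth D (fun w => M w + P w).
Proof.
move=> hk hM; apply/(smooth_mxP oD) => i j.
apply: (smooth_ext oD (f := fun w => M w i j + P w i j)); first by move=> z _; rewrite mxE.
exact: (smoothD oD (smooth_entry oD hk i j) (smooth_entry oD hM i j)).
Qed.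

Lemma mean_curvature_ext (V : normedModType R) (B : V -> V -> R) (F G : R * R -> V) z xi :
  (forall w, D w -> F w = G w) -> D z -> mean_curvature B F z xi = mean_curvature B G z xi.
Proof.
move=> FG Dz; have ex := dx_ext oD FG; have ey := dy_ext oD FG.
have exx := dx_ext oD ex Dz; have exy := dx_ext oD ey Dz; have eyy := dy_ext oD ey Dz.
by rewrite /mean_curvature exx exy eyy (ex _ Dz) (ey _ Dz).
Qed.

Lemma associated_minimal_ext (u : R * R -> R) t (Phi Psi : R * R -> 'M[R]_4 * R) :
  (forall z, D z -> Phi z = Psi z) -> associated_minimal D u t Phi -> associated_minimal D u t Psi.
Proof.
move=> PP [[sm inH] cf mn hf].
have ex := dx_ext oD PP; have ey := dy_ext oD PP.
split.
- split; first exact: smooth_ext sm.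
  by move=> z Dz; rewrite -PP//; exact: inH.
- by move=> z Dz; rewrite -(ex _ Dz) -(ey _ Dz); exact: cf.
- move=> z Dz xi; rewrite -(PP _ Dz) -(ex _ Dz) -(ey _ Dz) => h1 h2 h3 h4.
  exact (etrans (esym (mean_curvature_ext (@gH2R R) xi PP Dz)) (mn z Dz xi h1 h2 h3 h4)).
- move=> z Dz; rewrite -(hf z Dz) /=.
  have -> : mx_z (fun w => (Psi w).1) z = mx_z (fun w => (Phi w).1) z; last by [].
  apply/matrixP => i j; rewrite /mx_z !mxE !d_zE.
  rewrite (dx_ext oD (f := fun w => (Phi w).1 i j) (g := fun w => (Psi w).1 i j) _ Dz); last by move=> w /PP ->.
  by rewrite (dy_ext oD (f := fun w => (Phi w).1 i j) (g := fun w => (Psi w).1 i j) _ Dz)// => w /PP ->.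
Qed.

End HopfBivector.

(** * Maps into a product and the function sinh(2u) *)

Section Pairs.
Context {R : realType} {W1 W2 : normedModType R}.
Variables (D : set (R * R)) (P : R * R -> W1 * W2).
Hypotheses (oD : open D) (hP : smooth D P).
Local Notation F := (fun w => (P w).1).
Local Notation h := (fun w => (P w).2).

Lemma pair_dx z : D z -> dx P z = (dx F z, dx h z).
Proof.
move=> Dz; have [/dx_val a /dx_val b] := (is_derive_pairP _ _ _ _).1 (smooth_isdx hP Dz).
exact: etrans (surjective_pairing _) (congr2 pair (esym a) (esym b)).
Qed.
Lemma pair_dy z : D z -> dy P z = (dy F z, dy h z).
Proof.
move=> Dz; have [/dy_val a /dy_val b] := (is_derive_pairP _ _ _ _).1 (smooth_isdy hP Dz).
exact: etrans (surjective_pairing _) (congr2 pair (esym a) (esym b)).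
Qed.
End Pairs.

Section SecondPairs.
Context {R : realType} {W1 W2 : normedModType R}.
Variables (D : set (R * R)) (P : R * R -> W1 * W2).
Hypotheses (oD : open D) (hP : smooth D P).
Local Notation F := (fun w => (P w).1).
Local Notation h := (fun w => (P w).2).

Lemma pair_dxx z : D z -> dx (dx P) z = (dx (dx F) z, dx (dx h) z).
Proof.
move=> Dz; apply: etrans (pair_dx (smooth_dx hP) Dz) _.
have a : forall w, D w -> (dx P w).1 = dx F w by move=> w Dw; exact: (congr1 fst (pair_dx hP Dw)).
have b : forall w, D w -> (dx P w).2 = dx h w by move=> w Dw; exact: (congr1 snd (pair_dx hP Dw)).
exact (congr2 pair (dx_ext oD a Dz) (dx_ext oD b Dz)).
Qed.
Lemma pair_dyy z : D z -> dy (dy P) z = (dy (dy F) z, dy (dy h) z).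
Proof.
move=> Dz; apply: etrans (pair_dy (smooth_dy hP) Dz) _.
have a : forall w, D w -> (dy P w).1 = dy F w by move=> w Dw; exact: (congr1 fst (pair_dy hP Dw)).
have b : forall w, D w -> (dy P w).2 = dy h w by move=> w Dw; exact: (congr1 snd (pair_dy hP Dw)).
exact (congr2 pair (dy_ext oD a Dz) (dy_ext oD b Dz)).
Qed.
End SecondPairs.

Section SinhLaplacian.
Context {R : realType}.
Variables (D : set (R * R)) (u : R * R -> R).
Hypotheses (oD : open D) (hu : smooth D u) (sg : sinh_gordon D u).

(** [exp_sum] and [exp_diff] are 2 cosh(2u) and 2 sinh(2u). *)
Definition exp_sum (w : R * R) : R := expR (2 * u w) + expR (- (2 * u w)).
Definition exp_diff (w : R * R) : R := expR (2 * u w) + - expR (- (2 * u w)).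

Lemma smooth_exp_sum : smooth D exp_sum. Proof. rewrite /exp_sum; smooth_tac. Qed.
Lemma smooth_exp_diff : smooth D exp_diff. Proof. rewrite /exp_diff; smooth_tac. Qed.

Let isd_diff z v d : is_derive z v u d -> is_derive z v exp_diff (2 * d * exp_sum z).
Proof.
move=> h; apply: dv_eq (dvD (dv_comp (is_derive_expR _) (dvM (dvC 2 z _) h))
  (dvN (dv_comp (is_derive_expR _) (dvN (dvM (dvC 2 z _) h))))) _.
by rewrite /exp_sum; ring.
Qed.
Let isd_sum z v d : is_derive z v u d -> is_derive z v exp_sum (2 * d * exp_diff z).
Proof.
move=> h; apply: dv_eq (dvD (dv_comp (is_derive_expR _) (dvM (dvC 2 z _) h))
  (dv_comp (is_derive_expR _) (dvN (dvM (dvC 2 z _) h)))) _.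
by rewrite /exp_diff; ring.
Qed.

(** The function q of the linear equation solved by 2 sinh(2u). *)
Definition potential (w : R * R) : R := 2 * exp_sum w + 4 * (dx u w * dx u w + dy u w * dy u w).

Lemma smooth_potential : smooth D potential.
Proof. have h := smooth_exp_sum; rewrite /potential; smooth_tac. Qed.

Let potential_arith (a b p q c d : R) : a + b = 2 * (d / 2) ->
  ((0 * p + 2 * a) * c + 2 * p * (2 * p * d)) + ((0 * q + 2 * b) * c + 2 * q * (2 * q * d)) =
  (2 * c + 4 * (p * p + q * q)) * d.
Proof.
move=> ab; transitivity (2 * (a + b) * c + 4 * (p * p + q * q) * d); first by ring.
by rewrite ab; field.
Qed.

(** Delta (2 sinh 2u) = 4 cosh(2u) Delta u + 8 |du|^2 sinh(2u), with
    Delta u = 2 sinh(2u). *)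
Lemma laplacian_exp_diff w : D w ->
  dx (dx exp_diff) w + dy (dy exp_diff) w = potential w * exp_diff w.
Proof.
move=> Dw.
have ex : forall w, D w -> dx exp_diff w = 2 * dx u w * exp_sum w.
  by move=> y Dy; exact: (dx_val (isd_diff (smooth_isdx hu Dy))).
have ey : forall w, D w -> dy exp_diff w = 2 * dy u w * exp_sum w.
  by move=> y Dy; exact: (dy_val (isd_diff (smooth_isdy hu Dy))).
have exx := dx_val (dvM (dvM (dvC 2 w _) (smooth_isdx (smooth_dx hu) Dw)) (isd_sum (smooth_isdx hu Dw))).
have eyy := dy_val (dvM (dvM (dvC 2 w _) (smooth_isdy (smooth_dy hu) Dw)) (isd_sum (smooth_isdy hu Dw))).
have lap := sinh_gordon_laplacian hu sg Dw.
apply: etrans (congr2 +%R (etrans (dx_ext oD ex Dw) exx) (etrans (dy_ext oD ey Dw) eyy)) _.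
exact: potential_arith lap.
Qed.

Lemma cosh_sq_exp_sum w : 4 * cosh (u w) ^+ 2 = exp_sum w + 2.
Proof.
have -> : exp_sum w = expR (u w) * expR (u w) + expR (- u w) * expR (- u w).
  by rewrite -!expRD /exp_sum; congr (expR _ + expR _); ring.
have h1 : expR (u w) * expR (- u w) = 1 by rewrite -expRD subrr expR0.
rewrite /cosh; move: (expR (u w)) (expR (- u w)) h1 => p q pq.
transitivity (p * p + q * q + 2 * (p * q)); first by field.
by rewrite pq mulr1.
Qed.

Lemma exp_diff_sq w : (exp_sum w + 2) * (exp_sum w + 2 - 4) = exp_diff w ^+ 2.
Proof.
have h1 : expR (2 * u w) * expR (- (2 * u w)) = 1 by rewrite -expRD subrr expR0.
rewrite /exp_sum /exp_diff; move: (expR (2 * u w)) (expR (- (2 * u w))) h1 => p q pq.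
transitivity ((p + - q) ^+ 2 + 4 * (p * q - 1)); first by ring.
by rewrite pq subrr mulr0 addr0.
Qed.

Lemma exp_sum_gt0 w : 0 < exp_sum w + 2.
Proof. by rewrite !addr_gt0// expR_gt0. Qed.

End SinhLaplacian.

(** * The Gauss map of a maximal surface *)

Opaque ip42 gbiv.

Lemma complex_inj (R : realType) (a b c d : R) : a +i* b = c +i* d -> a = c /\ b = d.
Proof. by move=> [-> ->]. Qed.

Section MetricArith.
Variable R : realFieldType.
Implicit Types p q c s : R.
Lemma metric_arith1 p q c : 2^-1 * (2 * (p + q + 2 * c)) + (2 - 2 * c) = p + q + 2.
Proof. by field. Qed.
Lemma metric_arith2 p q c : 2^-1 * (2 * (p + q - 2 * c)) + (2 + 2 * c) = p + q + 2.
Proof. by field. Qed.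
Lemma metric_arith3 s : 2^-1 * (- (4 * s)) + 2 * s = 0.
Proof. by field. Qed.
Lemma metric_arith4 p q c :
  (2^-1 * (2 * (p + q + 2 * c)) - 2^-1 * (2 * (p + q - 2 * c))) / 4 = c.
Proof. by field. Qed.
Lemma metric_arith5 s : - (2^-1 * (- (4 * s)) / 2) = s.
Proof. by field. Qed.
End MetricArith.

Section TangentFrame.
Context {R : realType}.

Lemma ip42_comb (a b a' b' : R) (v w : 'rV[R]_4) :
  ip42 (a *: v + b *: w) (a' *: v + b' *: w) =
  a * a' * ip42 v v + (a * b' + b * a') * ip42 v w + b * b' * ip42 w w.
Proof. by rewrite !ip42E !mxE; ring. Qed.

Lemma wedge_comb (a b a' b' : R) (v w : 'rV[R]_4) :
  wedge (a *: v + b *: w) (a' *: v + b' *: w) = (a * b' - b * a') *: wedge v w.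
Proof. by apply/matrixP => i j; rewrite [RHS]mxE !wedgeE !mxE; ring. Qed.

(** An oriented change of orthonormal bases has determinant 1. *)
Lemma frame_jacobian (v w f1 f2 : 'rV[R]_4) (E a b c d : R) : 0 < E ->
  ip42 v v = E -> ip42 w w = E -> ip42 v w = 0 ->
  ip42 f1 f1 = 1 -> ip42 f2 f2 = 1 -> ip42 f1 f2 = 0 ->
  f1 = a *: v + b *: w -> f2 = c *: v + d *: w -> 0 < a * d - b * c -> a * d - b * c = E^-1.
Proof.
move=> E0 vv ww vw + + + h1 h2; rewrite h1 h2 !ip42_comb vv ww vw !mulr0 !addr0 => g1 g2 g3 pos.
have sq : ((a * d - b * c) * E) ^+ 2 = 1.
  transitivity ((a * a * E + b * b * E) * (c * c * E + d * d * E) -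
     (a * c * E + b * d * E) ^+ 2); first by ring.
  by rewrite g1 g2 g3; ring.
have p1 : 0 < (a * d - b * c) * E by rewrite mulr_gt0.
have one : (a * d - b * c) * E = 1.
  move/eqP: sq; rewrite sqrf_eq1 => /orP[/eqP//|/eqP h']; by move: p1; rewrite h' oppr_gt0 ltNge ler01.
by rewrite -[LHS](mulfK (lt0r_neq0 E0)) one mul1r.
Qed.

End TangentFrame.

Section MaximalSurface.
Context {R : realType}.
Variables (D : set (R * R)) (u : R * R -> R) (t : R) (phi N : R * R -> 'rV[R]_4).
Hypotheses (oD : open D) (hu : smooth D u) (am : associated_maximal D u t phi N).

Let X := dx phi.
Let Y := dy phi.
Let E : R * R -> R := fun w => expR (2 * u w).
Let e : R * R -> R := fun w => expR (- (2 * u w)).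

Lemma dx_ip42 f g (h : R * R -> R) z : smooth D f -> smooth D g ->
  (forall w, D w -> ip42 (f w) (g w) = h w) -> D z ->
  ip42 (dx f z) (g z) + ip42 (f z) (dx g z) = dx h z.
Proof.
move=> hf hg fg Dz; rewrite !ip42_ipw -(dx_ipw _ hf hg Dz).
by apply: (dx_ext oD) Dz => w Dw; rewrite -ip42_ipw fg.
Qed.

Lemma dy_ip42 f g (h : R * R -> R) z : smooth D f -> smooth D g ->
  (forall w, D w -> ip42 (f w) (g w) = h w) -> D z ->
  ip42 (dy f z) (g z) + ip42 (f z) (dy g z) = dy h z.
Proof.
move=> hf hg fg Dz; rewrite !ip42_ipw -(dy_ipw _ hf hg Dz).
by apply: (dy_ext oD) Dz => w Dw; rewrite -ip42_ipw fg.
Qed.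

Let hphi : smooth D phi. Proof. by have [[]] := am. Qed.
Let pp w : D w -> ip42 (phi w) (phi w) = -1.
Proof. by have [[_ h]] := am => _ _ _ _; exact: h. Qed.
Let hX : smooth D X. Proof. exact: smooth_dx. Qed.
Let hY : smooth D Y. Proof. exact: smooth_dy. Qed.
Let conf w : D w -> [/\ 0 < E w, ip42 (X w) (X w) = E w, ip42 (Y w) (Y w) = E w & ip42 (X w) (Y w) = 0].
Proof. by have [_ h _ _ _] := am; exact: h. Qed.
Let normal w : D w -> [/\ ip42 (N w) (N w) = -1, ip42 (N w) (phi w) = 0,
        ip42 (N w) (X w) = 0, ip42 (N w) (Y w) = 0 &
        0 < \det (rows4 (X w) (Y w) (phi w) (N w))].
Proof. by have [_ _ h _ _] := am; exact: h. Qed.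

Let dxcst (c : R) z : dx (fun _ : R * R => c) z = 0. Proof. exact: dx_cst. Qed.
Let dycst (c : R) z : dy (fun _ : R * R => c) z = 0. Proof. exact: dy_cst. Qed.

Let pX w : D w -> ip42 (phi w) (X w) = 0.
Proof.
move=> Dw; have := dx_ip42 hphi hphi (fun w => pp (w := w)) Dw; rewrite dxcst -/X [ip42 (X w) _]ip42C.
by move/eqP; rewrite -mulr2n mulrn_eq0 => /eqP.
Qed.
Let pY w : D w -> ip42 (phi w) (Y w) = 0.
Proof.
move=> Dw; have := dy_ip42 hphi hphi (fun w => pp (w := w)) Dw; rewrite dycst -/Y [ip42 (Y w) _]ip42C.
by move/eqP; rewrite -mulr2n mulrn_eq0 => /eqP.
Qed.

Lemma maximal_expansion w v : D w -> v = (ip42 v (X w) / E w) *: X w + (ip42 v (Y w) / E w) *: Y w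
   - ip42 v (phi w) *: phi w - ip42 v (N w) *: N w.
Proof.
move=> Dw; have [E0 XX YY XY] := conf Dw; have [NN Np NX NY _] := normal Dw.
have En : E w != 0 by rewrite gt_eqF.
exact: (frame4_expansion En XX YY XY (pp Dw) NN Np NX NY (pX Dw) (pY Dw) v).
Qed.

Let hE : smooth D E. Proof. rewrite /E; smooth_tac. Qed.
Let he : smooth D e. Proof. rewrite /e; smooth_tac. Qed.
Let eE w : E w * e w = 1. Proof. by rewrite /E /e expRN divff// gt_eqF// expR_gt0. Qed.
Let e_inv w : e w = (E w)^-1. Proof. by rewrite /E /e expRN. Qed.

Lemma dual_at w : D w ->
  let b := (E w)^-1 *: wedge (X w) (Y w) in let c := wedge (N w) (phi w) in
  [/\ c 0 1 = - b 2 3, c 0 2 = - b 1 3 & c 0 3 = b 1 2] /\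
  [/\ c 1 2 = b 0 3, c 1 3 = - b 0 2 & c 2 3 = - b 0 1].
Proof.
move=> Dw; have [E0 XX YY XY] := conf Dw; have [NN Np NX NY d0] := normal Dw.
exact: (normal_plane_dual E0 XX YY XY (pp Dw) NN Np NX NY (pX Dw) (pY Dw) d0).
Qed.

Lemma smooth_wedge_entry (f g : R * R -> 'rV[R]_4) i j : smooth D f -> smooth D g ->
  smooth D (fun w => wedge (f w) (g w) i j).
Proof.
move=> hf hg; apply: (smooth_ext oD (f := fun w => f w 0 i * g w 0 j + - (g w 0 i * f w 0 j))).
  by move=> z _; rewrite wedgeE.
have f1 k := smooth_entry oD hf 0 k; have g1 k := smooth_entry oD hg 0 k.
apply: (smoothD oD); first exact: (smoothM oD (f1 i) (g1 j)).
apply: (smoothN oD); exact: (smoothM oD (g1 i) (f1 j)).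
Qed.

(** N is assumed to be a normal field only, not a smooth one.  It is smooth because
    N /\ phi is dual to the tangent plane, hence smooth, and N is recovered from
    N /\ phi by contraction with phi. *)
Lemma smooth_normal : smooth D N.
Proof.
pose b k l := fun w => (E w)^-1 * wedge (X w) (Y w) k l.
have hb k l : smooth D (b k l).
  apply: (smooth_ext oD (f := fun w => e w * wedge (X w) (Y w) k l)).
    by move=> z _; rewrite /b e_inv.
  exact: (smoothM oD he (smooth_wedge_entry k l hX hY)).
have hc : forall k l, smooth D (fun w => wedge (N w) (phi w) k l).
  have anti k l w : wedge (N w) (phi w) k l = - wedge (N w) (phi w) l k.
    by rewrite !wedgeE; ring.
  have D2 k l : smooth D (fun w => wedge (N w) (phi w) k l) -> smooth D (fun w => wedge (N w) (phi w) l k).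
    move=> h; apply: (smooth_ext oD (f := fun w => - wedge (N w) (phi w) k l)).
      by move=> z _; rewrite -anti.
    exact: (smoothN oD h).
  have D1 k : smooth D (fun w => wedge (N w) (phi w) k k).
    apply: (smooth_ext oD (f := fun=> 0)); last exact: (smooth_cst oD 0).
    by move=> z _; rewrite wedgeE mulrC subrr.
  have ne k l k' l' : (forall w, D w -> wedge (N w) (phi w) k l = - ((E w)^-1 *: wedge (X w) (Y w)) k' l') ->
     smooth D (fun w => wedge (N w) (phi w) k l).
    move=> h; apply: (smooth_ext oD (f := fun w => - b k' l' w)); last exact: (smoothN oD (hb _ _)).
    by move=> z Dz; rewrite h// [in RHS]mxE.
  have po k l k' l' : (forall w, D w -> wedge (N w) (phi w) k l = ((E w)^-1 *: wedge (X w) (Y w)) k' l') ->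
     smooth D (fun w => wedge (N w) (phi w) k l).
    move=> h; apply: (smooth_ext oD (f := fun w => b k' l' w)); last exact: (hb _ _).
    by move=> z Dz; rewrite h// [in RHS]mxE.
  have s01 : smooth D (fun w => wedge (N w) (phi w) 0 1) by apply: (ne _ _ 2 3) => w /dual_at[[]].
  have s02 : smooth D (fun w => wedge (N w) (phi w) 0 2) by apply: (ne _ _ 1 3) => w /dual_at[[]].
  have s03 : smooth D (fun w => wedge (N w) (phi w) 0 3) by apply: (po _ _ 1 2) => w /dual_at[[]].
  have s12 : smooth D (fun w => wedge (N w) (phi w) 1 2) by apply: (po _ _ 0 3) => w /dual_at[_ []].
  have s13 : smooth D (fun w => wedge (N w) (phi w) 1 3) by apply: (ne _ _ 0 2) => w /dual_at[_ []].
  have s23 : smooth D (fun w => wedge (N w) (phi w) 2 3) by apply: (ne _ _ 0 1) => w /dual_at[_ []].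
  apply: (@ord4P (fun k => forall l, smooth D (fun w => wedge (N w) (phi w) k l)));
    apply: (@ord4P (fun l => smooth D (fun w => wedge (N w) (phi w) _ l)));
    first [exact: D1|assumption|exact: D2].
apply/(smooth_mxP oD) => i k; rewrite ord1.
(* contracting N /\ phi with phi recovers - N *)
have E1 w : D w -> - \sum_j (eta4 R j * wedge (N w) (phi w) k j * phi w 0 j) = N w 0 k.
  move=> Dw; have -> : \sum_j (eta4 R j * wedge (N w) (phi w) k j * phi w 0 j) =
     N w 0 k * ip42 (phi w) (phi w) - phi w 0 k * ip42 (N w) (phi w).
    rewrite !ip42_ipw /ipw !mulr_sumr -sumrB; apply: eq_bigr => j _.
    by rewrite wedgeE /=; case: ifP => _; ring.
  by have [_ -> _ _ _] := normal Dw; rewrite pp// mulr0 subr0 mulrN1 opprK.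
apply: (smooth_ext oD E1); apply: (smoothN oD); apply: (smooth_sum oD) => j.
apply: (smoothM oD); last exact: (smooth_entry oD hphi 0 j).
apply: (smoothM oD); [exact: (smooth_cst oD)|exact: hc].
Qed.

Let hN := smooth_normal.

Lemma ip42_mx_z (f g : R * R -> 'rV[R]_4) z : smooth D f -> smooth D g -> D z ->
  ip42 (mx_z f z) (mx_z g z) = ((ip42 (dx f z) (dx g z) - ip42 (dy f z) (dy g z)) / 4) +i*
    (- ((ip42 (dx f z) (dy g z) + ip42 (dy f z) (dx g z)) / 4)).
Proof.
move=> hf hg Dz.
have fE : mx_z f z = \row_k ((dx f z 0 k / 2) +i* (- (dy f z 0 k / 2))).
  by apply/rowP => k; rewrite /mx_z !mxE d_zE (dx_mx hf 0 k Dz) (dy_mx hf 0 k Dz).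
have gE : mx_z g z = \row_k ((dx g z 0 k / 2) +i* (- (dy g z 0 k / 2))).
  by apply/rowP => k; rewrite /mx_z !mxE d_zE (dx_mx hg 0 k Dz) (dy_mx hg 0 k Dz).
rewrite fE gE; move: (dx f z) (dy f z) (dx g z) (dy g z) => a b c d.
rewrite ip42E !mxE !ip42E.
move: (a 0 0) (a 0 1) (a 0 2) (a 0 3) (b 0 0) (b 0 1) (b 0 2) (b 0 3).
move: (c 0 0) (c 0 1) (c 0 2) (c 0 3) (d 0 0) (d 0 1) (d 0 2) (d 0 3) => *; simpc.
by congr (_ +i* _); rewrite /=; field.
Qed.

Let dxE z : D z -> dx E z = 2 * dx u z * E z.
Proof.
move=> Dz; have h := dv_comp (is_derive_expR _) (dvM (dvC 2 z _) (smooth_isdx hu Dz)).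
by rewrite (dx_val h) mul0r add0r mulrC.
Qed.
Let dyE z : D z -> dy E z = 2 * dy u z * E z.
Proof.
move=> Dz; have h := dv_comp (is_derive_expR _) (dvM (dvC 2 z _) (smooth_isdy hu Dz)).
by rewrite (dy_val h) mul0r add0r mulrC.
Qed.

Let Schw z : D z -> dx Y z = dy X z.
Proof. exact: (mx_Schwarz oD hphi). Qed.

(** The scalar products of the second derivatives with N are, up to sign, those of
    the first derivatives of phi and N, which enter the Hopf differential. *)
Lemma second_form z : D z ->
  [/\ ip42 (dx X z) (N z) = sin t, ip42 (dy X z) (N z) = cos t & ip42 (dy Y z) (N z) = - sin t].
Proof.
move=> Dz; have [E0 XX YY XY] := conf Dz.
have NX w : D w -> ip42 (N w) (X w) = 0 by move=> /normal[].
have NY w : D w -> ip42 (N w) (Y w) = 0 by move=> /normal[].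
have a1 := etrans (dx_ip42 hN hX NX Dz) (dxcst 0 z).
have a2 := etrans (dy_ip42 hN hX NX Dz) (dycst 0 z).
have a3 := etrans (dx_ip42 hN hY NY Dz) (dxcst 0 z).
have a4 := etrans (dy_ip42 hN hY NY Dz) (dycst 0 z).
have S := Schw Dz.
have [_ _ _ mc hopf] := am.
have m := etrans (esym (mean_curvature_conformal (B := @ip42 R) (N z) E0 XX YY XY)) (mc z Dz).
have h := etrans (esym (ip42_mx_z hphi hN Dz)) (hopf z Dz).
have ie : 'i%C / 2 * expi t = (- (sin t / 2)) +i* (cos t / 2) :> R[i].
  have h2 : (2 : R[i])^-1 = (2^-1)%:C by rewrite -(rmorph_nat (real_complex R)) fmorphV.
  by rewrite h2 /expi; simpc; congr (_ +i* _); rewrite mulrC.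
have {h}[h1 h2] := complex_inj (etrans h ie).
rewrite -/X -/Y in m h1 h2; rewrite S in a3.
have C1 := ip42C (dx N z) (X z); have C2 := ip42C (N z) (dx X z).
apply: (second_form_arith (k := E z) (n1 := ip42 (X z) (dx N z)) (n2 := ip42 (X z) (dy N z))
  (n3 := ip42 (Y z) (dx N z)) (n4 := ip42 (Y z) (dy N z)) E0 _ _ _ _ m h1 h2).
- exact (etrans (congr2 +%R (ip42C _ _) (ip42C _ _)) a1).
- exact (etrans (congr2 +%R (ip42C _ _) (ip42C _ _)) a2).
- exact (etrans (congr2 +%R (ip42C _ _) (ip42C _ _)) a3).
- exact (etrans (congr2 +%R (ip42C _ _) (ip42C _ _)) a4).
Qed.

Let ux := dx u.
Let uy := dy u.

Lemma dx_ip42_self f (h : R * R -> R) z : smooth D f -> (forall w, D w -> ip42 (f w) (f w) = h w) ->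
  D z -> 2 * ip42 (dx f z) (f z) = dx h z.
Proof.
move=> hf ff Dz; rewrite mulr_natl mulr2n.
exact (etrans (congr2 +%R erefl (ip42C _ _)) (dx_ip42 hf hf ff Dz)).
Qed.
Lemma dy_ip42_self f (h : R * R -> R) z : smooth D f -> (forall w, D w -> ip42 (f w) (f w) = h w) ->
  D z -> 2 * ip42 (dy f z) (f z) = dy h z.
Proof.
move=> hf ff Dz; rewrite mulr_natl mulr2n.
exact (etrans (congr2 +%R erefl (ip42C _ _)) (dy_ip42 hf hf ff Dz)).
Qed.

Lemma dx_ip42_orth f g z : smooth D f -> smooth D g -> (forall w, D w -> ip42 (f w) (g w) = 0) ->
  D z -> ip42 (dx f z) (g z) = - ip42 (dx g z) (f z).
Proof.
move=> hf hg fg Dz.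
have h := etrans (congr2 +%R erefl (ip42C _ _)) (etrans (dx_ip42 hf hg fg Dz) (dxcst 0 z)).
by apply/eqP; rewrite -addr_eq0; apply/eqP; exact: h.
Qed.
Lemma dy_ip42_orth f g z : smooth D f -> smooth D g -> (forall w, D w -> ip42 (f w) (g w) = 0) ->
  D z -> ip42 (dy f z) (g z) = - ip42 (dy g z) (f z).
Proof.
move=> hf hg fg Dz.
have h := etrans (congr2 +%R erefl (ip42C _ _)) (etrans (dy_ip42 hf hg fg Dz) (dycst 0 z)).
by apply/eqP; rewrite -addr_eq0; apply/eqP; exact: h.
Qed.

Let two0 : (2 : R) != 0. Proof. by rewrite pnatr_eq0. Qed.

Section At.
Variable z : R * R.
Hypothesis Dz : D z.

Let XXf w (Dw : D w) : ip42 (X w) (X w) = E w. Proof. by have [] := conf Dw. Qed.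
Let YYf w (Dw : D w) : ip42 (Y w) (Y w) = E w. Proof. by have [] := conf Dw. Qed.
Let XYf w (Dw : D w) : ip42 (X w) (Y w) = 0. Proof. by have [] := conf Dw. Qed.
Let YXf w (Dw : D w) : ip42 (Y w) (X w) = 0. Proof. exact (etrans (ip42C _ _) (XYf Dw)). Qed.
Let NNf w (Dw : D w) : ip42 (N w) (N w) = -1. Proof. by have [] := normal Dw. Qed.
Let Npf w (Dw : D w) : ip42 (N w) (phi w) = 0. Proof. by have [] := normal Dw. Qed.
Let NXf w (Dw : D w) : ip42 (N w) (X w) = 0. Proof. by have [] := normal Dw. Qed.
Let NYf w (Dw : D w) : ip42 (N w) (Y w) = 0. Proof. by have [] := normal Dw. Qed.
Let Xpf w (Dw : D w) : ip42 (X w) (phi w) = 0. Proof. exact (etrans (ip42C _ _) (pX Dw)). Qed.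
Let Ypf w (Dw : D w) : ip42 (Y w) (phi w) = 0. Proof. exact (etrans (ip42C _ _) (pY Dw)). Qed.
Let En : E z != 0. Proof. by rewrite gt_eqF// expR_gt0. Qed.

Let half (a b c : R) : 2 * a = 2 * b * c -> a = b * c.
Proof. by rewrite -mulrA => /(mulfI two0). Qed.

Let i1 : ip42 (dx X z) (X z) = ux z * E z.
Proof. exact (half (etrans (dx_ip42_self hX XXf Dz) (dxE Dz))). Qed.
Let i2 : ip42 (dy X z) (X z) = uy z * E z.
Proof. exact (half (etrans (dy_ip42_self hX XXf Dz) (dyE Dz))). Qed.
Let i3 : ip42 (dx Y z) (Y z) = ux z * E z.
Proof. exact (half (etrans (dx_ip42_self hY YYf Dz) (dxE Dz))). Qed.
Let i4 : ip42 (dy Y z) (Y z) = uy z * E z.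
Proof. exact (half (etrans (dy_ip42_self hY YYf Dz) (dyE Dz))). Qed.
Let i3' : ip42 (dy X z) (Y z) = ux z * E z.
Proof. exact (etrans (congr1 (fun v => ip42 v (Y z)) (esym (Schw Dz))) i3). Qed.
Let i5 : ip42 (dx X z) (Y z) = - (uy z * E z).
Proof.
exact (etrans (dx_ip42_orth hX hY XYf Dz) (congr1 -%R (etrans (congr1 (fun v => ip42 v (X z)) (Schw Dz)) i2))).
Qed.
Let i6 : ip42 (dy Y z) (X z) = - (ux z * E z).
Proof. exact (etrans (dy_ip42_orth hY hX YXf Dz) (congr1 -%R i3')). Qed.
Let i7 : ip42 (dx X z) (phi z) = - E z.
Proof. exact (etrans (dx_ip42_orth hX hphi Xpf Dz) (congr1 -%R (XXf Dz))). Qed.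
Let i8 : ip42 (dy X z) (phi z) = - 0.
Proof. exact (etrans (dy_ip42_orth hX hphi Xpf Dz) (congr1 -%R (YXf Dz))). Qed.
Let i9 : ip42 (dy Y z) (phi z) = - E z.
Proof. exact (etrans (dy_ip42_orth hY hphi Ypf Dz) (congr1 -%R (YYf Dz))). Qed.
Let j1 : ip42 (dx X z) (N z) = sin t. Proof. by have [] := second_form Dz. Qed.
Let j2 : ip42 (dy X z) (N z) = cos t. Proof. by have [] := second_form Dz. Qed.
Let j3 : ip42 (dy Y z) (N z) = - sin t. Proof. by have [] := second_form Dz. Qed.
Let n1 : ip42 (dx N z) (N z) = 0.
Proof. exact (mulfI two0 (etrans (dx_ip42_self hN NNf Dz) (etrans (dxcst (-1) z) (esym (mulr0 2))))). Qed.
Let n2 : ip42 (dy N z) (N z) = 0.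
Proof. exact (mulfI two0 (etrans (dy_ip42_self hN NNf Dz) (etrans (dycst (-1) z) (esym (mulr0 2))))). Qed.
Let n3 : ip42 (dx N z) (phi z) = - 0.
Proof. exact (etrans (dx_ip42_orth hN hphi Npf Dz) (congr1 -%R (etrans (ip42C _ _) (NXf Dz)))). Qed.
Let n4 : ip42 (dy N z) (phi z) = - 0.
Proof. exact (etrans (dy_ip42_orth hN hphi Npf Dz) (congr1 -%R (etrans (ip42C _ _) (NYf Dz)))). Qed.
Let n5 : ip42 (dx N z) (X z) = - sin t.
Proof. exact (etrans (dx_ip42_orth hN hX NXf Dz) (congr1 -%R j1)). Qed.
Let n6 : ip42 (dy N z) (X z) = - cos t.
Proof. exact (etrans (dy_ip42_orth hN hX NXf Dz) (congr1 -%R j2)). Qed.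
Let n7 : ip42 (dx N z) (Y z) = - cos t.
Proof.
exact (etrans (dx_ip42_orth hN hY NYf Dz) (congr1 -%R (etrans (congr1 (fun v => ip42 v (N z)) (Schw Dz)) j2))).
Qed.
Let n8 : ip42 (dy N z) (Y z) = - - sin t.
Proof. exact (etrans (dy_ip42_orth hN hY NYf Dz) (congr1 -%R j3)). Qed.

Let expand v a b p n : ip42 v (X z) = a -> ip42 v (Y z) = b -> ip42 v (phi z) = p ->
  ip42 v (N z) = n -> v = (a / E z) *: X z + (b / E z) *: Y z - p *: phi z - n *: N z.
Proof. by move=> <- <- <- <-; exact: maximal_expansion. Qed.

(** The Gauss-Weingarten equations: each derivative is expanded in the orthogonal
    frame (X, Y, phi, N). *)
Lemma gauss_xx : dx X z = ux z *: X z - uy z *: Y z + E z *: phi z - sin t *: N z.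
Proof.
by rewrite [LHS](expand i1 i5 i7 j1) mulNr !(mulfK En) !scaleNr opprK.
Qed.
Lemma gauss_xy : dy X z = uy z *: X z + ux z *: Y z - cos t *: N z.
Proof.
by rewrite [LHS](expand i2 i3' i8 j2) !(mulfK En) oppr0 scale0r subr0.
Qed.
Lemma gauss_yx : dx Y z = uy z *: X z + ux z *: Y z - cos t *: N z.
Proof. exact (etrans (Schw Dz) gauss_xy). Qed.
Lemma gauss_yy : dy Y z = - ux z *: X z + uy z *: Y z + E z *: phi z + sin t *: N z.
Proof.
by rewrite [LHS](expand i6 i4 i9 j3) mulNr !(mulfK En) !scaleNr !opprK.
Qed.
Lemma weingarten_x : dx N z = - (e z * sin t) *: X z - (e z * cos t) *: Y z.
Proof.
by rewrite [LHS](expand n5 n7 n3 n1) e_inv oppr0 !scale0r !subr0 !mulNr !scaleNr ![(E z)^-1 * _]mulrC.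
Qed.
Lemma weingarten_y : dy N z = - (e z * cos t) *: X z + (e z * sin t) *: Y z.
Proof.
by rewrite [LHS](expand n6 n8 n4 n2) e_inv oppr0 !scale0r !subr0 !mulNr !scaleNr opprK ![(E z)^-1 * _]mulrC.
Qed.

End At.

(* W is the Gauss map up to the factor 1/sqrt 2; A1 and A2 span its differential *)
Let W w := e w *: wedge (X w) (Y w) + wedge (N w) (phi w).
Let A1 w := wedge (N w) (X w) + wedge (phi w) (Y w).
Let A2 w := wedge (N w) (Y w) - wedge (phi w) (X w).
Let c := cos t.
Let s := sin t.

Let isdX z (Dz : D z) := smooth_isdx hX Dz.
Let isdY z (Dz : D z) := smooth_isdx hY Dz.
Let isdN z (Dz : D z) := smooth_isdx hN Dz.
Let isdp z (Dz : D z) : is_derive z ((1, 0) : R * R) phi (X z) := smooth_isdx hphi Dz.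
Let jsdX z (Dz : D z) := smooth_isdy hX Dz.
Let jsdY z (Dz : D z) := smooth_isdy hY Dz.
Let jsdN z (Dz : D z) := smooth_isdy hN Dz.
Let jsdp z (Dz : D z) : is_derive z ((0, 1) : R * R) phi (Y z) := smooth_isdy hphi Dz.

Let isde z : D z -> is_derive z ((1, 0) : R * R) e (- (2 * ux z) * e z).
Proof.
move=> Dz; apply: dv_eq (dv_comp (is_derive_expR _) (dvN (dvM (dvC 2 z _) (smooth_isdx hu Dz)))) _.
by rewrite mul0r add0r mulrC.
Qed.
Let jsde z : D z -> is_derive z ((0, 1) : R * R) e (- (2 * uy z) * e z).
Proof.
move=> Dz; apply: dv_eq (dv_comp (is_derive_expR _) (dvN (dvM (dvC 2 z _) (smooth_isdy hu Dz)))) _.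
by rewrite mul0r add0r mulrC.
Qed.

Let mx_eq (v z : R * R) (M : R * R -> 'M[R]_4) d d' : is_derive z v M d -> d = d' -> is_derive z v M d'.
Proof. by move=> ? <-. Qed.

Let W_x z : D z -> is_derive z ((1, 0) : R * R) W ((1 + e z * c) *: A1 z - (e z * s) *: A2 z).
Proof.
move=> Dz; have h := isd_add (isd_scale (isde Dz) (isd_wedge (isdX Dz) (isdY Dz))) (isd_wedge (isdN Dz) (isdp Dz)).
rewrite (gauss_xx Dz) (gauss_yx Dz) (weingarten_x Dz) in h.
apply: mx_eq h _; exact: (gauss_dx_alg _ _ _ _ (ux z) (uy z) s c (eE z)).
Qed.

Let W_y z : D z -> is_derive z ((0, 1) : R * R) W (- (e z * s) *: A1 z + (1 - e z * c) *: A2 z).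
Proof.
move=> Dz; have h := isd_add (isd_scale (jsde Dz) (isd_wedge (jsdX Dz) (jsdY Dz))) (isd_wedge (jsdN Dz) (jsdp Dz)).
rewrite (gauss_xy Dz) (gauss_yy Dz) (weingarten_y Dz) in h.
apply: mx_eq h _; exact: (gauss_dy_alg _ _ _ _ (ux z) (uy z) s c (eE z)).
Qed.

Let A1_x z : D z -> is_derive z ((1, 0) : R * R) A1 (ux z *: A1 z - uy z *: A2 z + (E z + c) *: W z).
Proof.
move=> Dz; have h := isd_add (isd_wedge (isdN Dz) (isdX Dz)) (isd_wedge (isdp Dz) (isdY Dz)).
rewrite (gauss_xx Dz) (gauss_yx Dz) (weingarten_x Dz) in h.
apply: mx_eq h _; exact: (A1_dx_alg _ _ _ _ (ux z) (uy z) s c (eE z)).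
Qed.

Let A2_x z : D z -> is_derive z ((1, 0) : R * R) A2 (uy z *: A1 z + ux z *: A2 z - s *: W z).
Proof.
move=> Dz; have h := isd_add (isd_wedge (isdN Dz) (isdY Dz)) (isd_opp (isd_wedge (isdp Dz) (isdX Dz))).
rewrite (gauss_xx Dz) (gauss_yx Dz) (weingarten_x Dz) in h.
apply: mx_eq h _; exact: (A2_dx_alg _ _ _ _ (ux z) (uy z) (E z) (e z) s c).
Qed.

Let A1_y z : D z -> is_derive z ((0, 1) : R * R) A1 (uy z *: A1 z + ux z *: A2 z - s *: W z).
Proof.
move=> Dz; have h := isd_add (isd_wedge (jsdN Dz) (jsdX Dz)) (isd_wedge (jsdp Dz) (jsdY Dz)).
rewrite (gauss_xy Dz) (gauss_yy Dz) (weingarten_y Dz) in h.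
apply: mx_eq h _; exact: (A1_dy_alg _ _ _ _ (ux z) (uy z) (E z) (e z) s c).
Qed.

Let A2_y z : D z -> is_derive z ((0, 1) : R * R) A2 (- ux z *: A1 z + uy z *: A2 z + (E z - c) *: W z).
Proof.
move=> Dz; have h := isd_add (isd_wedge (jsdN Dz) (jsdY Dz)) (isd_opp (isd_wedge (jsdp Dz) (jsdX Dz))).
rewrite (gauss_xy Dz) (gauss_yy Dz) (weingarten_y Dz) in h.
apply: mx_eq h _; exact: (A2_dy_alg _ _ _ _ (ux z) (uy z) s c (eE z)).
Qed.

Let hW : smooth D W.
Proof.
apply: (smooth_add oD); first apply: (smooth_scale oD he).
  by apply/(smooth_mxP oD) => i j; exact: smooth_wedge_entry.
by apply/(smooth_mxP oD) => i j; exact: smooth_wedge_entry.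
Qed.

Let W_laplacian z : D z -> dx (dx W) z + dy (dy W) z = (2 * (E z + e z)) *: W z.
Proof.
move=> Dz.
have w1 w : D w -> dx W w = (1 + e w * c) *: A1 w + - ((e w * s) *: A2 w).
  by move=> Dw; exact: (dx_val (W_x Dw)).
have w2 w : D w -> dy W w = - ((e w * s) *: A1 w) + (1 - e w * c) *: A2 w.
  by move=> Dw; rewrite (dy_val (W_y Dw)) scaleNr.
rewrite (dx_ext oD w1 Dz) (dy_ext oD w2 Dz).
have k1 : is_derive z ((1, 0) : R * R) (fun w => 1 + e w * c) (- (2 * ux z) * e z * c).
  by apply: dv_eq (dvD (dvC 1 z _) (dvM (isde Dz) (dvC c z _))) _; rewrite mulr0 addr0 add0r.
have k2 : is_derive z ((1, 0) : R * R) (fun w => e w * s) (- (2 * ux z) * e z * s).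
  by apply: dv_eq (dvM (isde Dz) (dvC s z _)) _; rewrite mulr0 addr0.
have k3 : is_derive z ((0, 1) : R * R) (fun w => e w * s) (- (2 * uy z) * e z * s).
  by apply: dv_eq (dvM (jsde Dz) (dvC s z _)) _; rewrite mulr0 addr0.
have k4 : is_derive z ((0, 1) : R * R) (fun w => 1 - e w * c) (- (- (2 * uy z) * e z * c)).
  by apply: dv_eq (dvD (dvC 1 z _) (dvN (dvM (jsde Dz) (dvC c z _)))) _; rewrite mulr0 addr0 add0r.
have h1 := isd_add (isd_scale k1 (A1_x Dz)) (isd_opp (isd_scale k2 (A2_x Dz))).
have h2 := isd_add (isd_opp (isd_scale k3 (A1_y Dz))) (isd_scale k4 (A2_y Dz)).
rewrite (dx_val h1) (dy_val h2).
exact (laplacian_alg (cos2Dsin2 t) erefl erefl erefl erefl).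
Qed.

Let W_metric z (Dz : D z) a b a' b' :
  gbiv (a *: A1 z + b *: A2 z) (a' *: A1 z + b' *: A2 z) = 2 * E z * (a * a' + b * b').
Proof.
have [E0 XX YY XY] := conf Dz; have [NN Np NX NY _] := normal Dz.
exact: (gbiv_combination XX YY XY (pp Dz) NN Np NX NY (pX Dz) (pY Dz)).
Qed.

Let W_norm z : D z -> gbiv (W z) (W z) = -2.
Proof.
move=> Dz; have [E0 XX YY XY] := conf Dz; have [NN Np NX NY _] := normal Dz.
exact: (gbiv_WW (eE z) XX YY XY (pp Dz) NN Np NX NY (pX Dz) (pY Dz)).
Qed.

Let W_Lambda z : D z -> Lambda_plus (W z).
Proof.
move=> Dz; have [E0 XX YY XY] := conf Dz; have [NN Np NX NY d0] := normal Dz.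
rewrite /W e_inv.
exact: (gauss_Lambda_plus E0 XX YY XY (pp Dz) NN Np NX NY (pX Dz) (pY Dz) d0).
Qed.

Let cs1 : c * c + s * s = 1. Proof. by rewrite -!expr2 cos2Dsin2. Qed.

Lemma gauss_metric z : D z -> 
  [/\ gbiv (dx W z) (dx W z) = 2 * (E z + e z + 2 * c), 
      gbiv (dy W z) (dy W z) = 2 * (E z + e z - 2 * c) &
      gbiv (dx W z) (dy W z) = - (4 * s)].
Proof.
move=> Dz.
have Wx := dx_val (W_x Dz); have Wy := dy_val (W_y Dz); rewrite -scaleNr in Wx.
rewrite Wx Wy !(W_metric Dz); have := eE z; move: (E z) (e z) cs1 => k l cs kl.
split.
- transitivity (2 * (k + 2 * (k * l) * c + (k * l) * l * (c * c + s * s))); first by ring.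
  by rewrite cs kl; ring.
- transitivity (2 * (k - 2 * (k * l) * c + (k * l) * l * (c * c + s * s))); first by ring.
  by rewrite cs kl; ring.
- transitivity (- (4 * (k * l) * s)); first by ring.
  by rewrite kl; ring.
Qed.

Let F (k : R) w := k *: W w.
Let h (w : R * R) : R := 2 * complex.Im (toC w * expi (t / 2)).

Let heightE : h = (fun w => 2 * (w.1 * sin (t / 2) + w.2 * cos (t / 2))).
Proof. by apply/funext => -[x y]. Qed.

Let h_x z : is_derive z ((1, 0) : R * R) h (2 * sin (t / 2)).
Proof.
rewrite heightE; apply: dv_eq (dvM (dvC 2 z _) (dvD (dvM (dx_fst z) (dvC (sin (t / 2)) z _)) (dvM (dx_snd z) (dvC (cos (t / 2)) z _)))) _.
by rewrite !mul0r !mulr0 !mul1r !addr0 add0r.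
Qed.
Let h_y z : is_derive z ((0, 1) : R * R) h (2 * cos (t / 2)).
Proof.
rewrite heightE; apply: dv_eq (dvM (dvC 2 z _) (dvD (dvM (dy_fst z) (dvC (sin (t / 2)) z _)) (dvM (dy_snd z) (dvC (cos (t / 2)) z _)))) _.
by rewrite !mul0r !mulr0 !mul1r !addr0 !add0r.
Qed.

Let hh : smooth D h.
Proof.
rewrite heightE; smooth_tac.
Qed.

Let Phi k w := (F k w, h w).

Let hF k : smooth D (F k). Proof. exact: (smooth_scale oD (smooth_cst oD k) hW). Qed.

Let F_x k z : D z -> dx (F k) z = k *: dx W z.
Proof.
move=> Dz; rewrite (dx_val (isd_scale (dvC k z _) (smooth_isdx hW Dz))).
by rewrite scale0r add0r.
Qed.
Let F_y k z : D z -> dy (F k) z = k *: dy W z.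
Proof.
move=> Dz; rewrite (dy_val (isd_scale (dvC k z _) (smooth_isdy hW Dz))).
by rewrite scale0r add0r.
Qed.

Let Phi_x k z : D z -> dx (Phi k) z = (k *: dx W z, 2 * sin (t / 2)).
Proof.
move=> Dz; apply: dx_val; apply/is_derive_pairP; split => /=; last exact: h_x.
rewrite -(F_x k Dz); exact: (smooth_isdx (hF k) Dz).
Qed.
Let Phi_y k z : D z -> dy (Phi k) z = (k *: dy W z, 2 * cos (t / 2)).
Proof.
move=> Dz; apply: dy_val; apply/is_derive_pairP; split => /=; last exact: h_y.
rewrite -(F_y k Dz); exact: (smooth_isdy (hF k) Dz).
Qed.
Let Phi_xx k z : D z -> dx (dx (Phi k)) z = (k *: dx (dx W) z, 0).
Proof.
move=> Dz; rewrite (dx_ext oD (Phi_x k) Dz).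
apply: dx_val; apply/is_derive_pairP; split => /=; last exact: dvC.
have := isd_scale (dvC k z ((1, 0) : R * R)) (smooth_isdx (smooth_dx hW) Dz).
by rewrite scale0r add0r.
Qed.
Let Phi_yy k z : D z -> dy (dy (Phi k)) z = (k *: dy (dy W) z, 0).
Proof.
move=> Dz; rewrite (dy_ext oD (Phi_y k) Dz).
apply: dy_val; apply/is_derive_pairP; split => /=; last exact: dvC.
have := isd_scale (dvC k z ((0, 1) : R * R)) (smooth_isdy (smooth_dy hW) Dz).
by rewrite scale0r add0r.
Qed.

Let sin_half : (2 * sin (t / 2)) * (2 * sin (t / 2)) = 2 - 2 * c.
Proof.
have := cosD (t / 2) (t / 2); rewrite -splitr -/c -!expr2 cos2sin2 => ->; ring.
Qed.
Let cos_half : (2 * cos (t / 2)) * (2 * cos (t / 2)) = 2 + 2 * c.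
Proof.
have := cosD (t / 2) (t / 2); rewrite -splitr -/c -!expr2 sin2cos2 => ->; ring.
Qed.
Let sin_cos_half : (2 * sin (t / 2)) * (2 * cos (t / 2)) = 2 * s.
Proof. by have := sinD (t / 2) (t / 2); rewrite -splitr -/s => ->; ring. Qed.

Let coshE z : 4 * cosh (u z) ^+ 2 = E z + e z + 2. Proof. exact: cosh_sq_exp_sum. Qed.

(** The factor k is 1/sqrt 2 or -1/sqrt 2, according to the sheet containing the
    Gauss map. *)
Lemma gauss_minimal k : k * k = 2^-1 -> (forall z, D z -> 0 < k * W z 0 1) ->
  associated_minimal D u t (Phi k).
Proof.
move=> k2 kpos.
have inL z : D z -> Lambda_plus (F k z) by move=> Dz; apply: Lambda_plusZ; exact: W_Lambda.
have kk a b : gbiv (k *: a) (k *: b) = 2^-1 * gbiv a b by rewrite gbivZl gbivZr mulrA k2.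
have lam0 z : 0 < 4 * cosh (u z) ^+ 2.
  by rewrite coshE !addr_gt0// expR_gt0.
have cf : conformal_metric (@gH2R R) D (Phi k) (fun z => 4 * cosh (u z) ^+ 2).
  move=> z Dz; have [m1 m2 m3] := gauss_metric Dz.
  have Px := Phi_x k Dz; have Py := Phi_y k Dz.
  have g a p b q : gH2R (k *: a, p) (k *: b, q) = 2^-1 * gbiv a b + p * q.
    exact (congr1 (fun x => x + p * q) (kk a b)).
  have g1 := etrans (congr2 (@gH2R R) Px Px) (etrans (g _ _ _ _) (congr2 +%R (congr1 ( *%R _) m1) sin_half)).
  have g2 := etrans (congr2 (@gH2R R) Py Py) (etrans (g _ _ _ _) (congr2 +%R (congr1 ( *%R _) m2) cos_half)).
  have g3 := etrans (congr2 (@gH2R R) Px Py) (etrans (g _ _ _ _) (congr2 +%R (congr1 ( *%R _) m3) sin_cos_half)).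
  have ch := coshE z.
  split; [exact: lam0|apply: etrans g1 _|apply: etrans g2 _|apply: etrans g3 _].
  - exact (etrans (metric_arith1 _ _ _) (esym ch)).
  - exact (etrans (metric_arith2 _ _ _) (esym ch)).
  - exact: metric_arith3.
split.
- split; first by apply/(smooth_pairP oD); split; [exact: hF|exact: hh].
  move=> z Dz; split; [exact: inL| |by rewrite mxE; exact: kpos].
  by rewrite /Phi /F /= kk (W_norm Dz); field.
- exact: cf.
- move=> z Dz xi [xiL xip] _ _ _.
  have [l0 c1 c2 c3] := cf z Dz.
  rewrite (mean_curvature_conformal (B := @gH2R R) xi l0 c1 c2 c3).
  have z0 : gH2R (dx (dx (Phi k)) z) xi + gH2R (dy (dy (Phi k)) z) xi = 0.
    apply: etrans (congr2 (fun a b => gH2R a xi + gH2R b xi) (Phi_xx k Dz) (Phi_yy k Dz)) _.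
    have lin (a b : 'M[R]_4) : gH2R (k *: a, 0) xi + gH2R (k *: b, 0) xi = k * gbiv (a + b) xi.1.
      by rewrite /gH2R /= !mul0r !addr0 gbivDl !gbivZl mulrDr.
    apply: etrans (lin _ _) _; apply: etrans (congr1 (fun a => k * gbiv a xi.1) (W_laplacian Dz)) _.
    have xip' : k * gbiv (W z) xi.1 = 0 by exact (etrans (esym (gbivZl _ _ _)) xip).
    have lin2 (x : R) (a : 'M[R]_4) : k * gbiv (x *: a) xi.1 = x * (k * gbiv a xi.1).
      by rewrite gbivZl mulrCA.
    by apply: etrans (lin2 _ _) _; rewrite xip' mulr0.
  by rewrite z0 mul0r.
- move=> z Dz; have [m1 m2 m3] := gauss_metric Dz.
  have Fx := F_x k Dz; have Fy := F_y k Dz.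
  change (gbiv (mx_z (F k) z) (mx_z (F k) z) = expi t).
  apply: etrans (gbiv_mx_z (hF k) Dz) _.
  have g1 := etrans (congr2 (@gbiv R) Fx Fx) (etrans (kk _ _) (congr1 ( *%R _) m1)).
  have g2 := etrans (congr2 (@gbiv R) Fy Fy) (etrans (kk _ _) (congr1 ( *%R _) m2)).
  have g3 := etrans (congr2 (@gbiv R) Fx Fy) (etrans (kk _ _) (congr1 ( *%R _) m3)).
  apply: etrans (congr2 (fun a b => a +i* b) (congr2 (fun a b => (a - b) / 4) g1 g2) (congr1 (fun a => - (a / 2)) g3)) _.
  exact (congr2 (fun a b => a +i* b) (metric_arith4 _ _ _) (metric_arith5 _)).
Qed.

(** e1 /\ e2 does not depend on the oriented orthonormal frame. *)
Lemma nu_plus_gauss e1 e2 z : oriented_frame D phi e1 e2 -> D z ->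
  nu_plus phi N e1 e2 z = (Num.sqrt 2)^-1 *: W z.
Proof.
move=> ofr Dz; have [E0 XX YY XY] := conf Dz.
have [f1 f2 f3 [a [b [c' [d [h1 h2 pos]]]]]] := ofr z Dz.
have j := frame_jacobian E0 XX YY XY f1 f2 f3 h1 h2 pos.
have w12 := etrans (congr2 (@wedge R) h1 h2) (wedge_comb a b c' d (X z) (Y z)).
apply: (congr1 (fun M => (Num.sqrt 2)^-1 *: (M + wedge (N z) (phi z)))).
apply: etrans w12 _; exact: (congr1 (fun x => x *: wedge (X z) (Y z)) (etrans j (esym (e_inv z)))).
Qed.

Hypothesis cD : connected D.

Theorem gauss_map_minimal e1 e2 : oriented_frame D phi e1 e2 -> D !=set0 ->
  associated_minimal D u t
    (fun z => (to_sheet (nu_plus phi N e1 e2 z), 2 * complex.Im (toC z * expi (t / 2)))).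
Proof.
move=> ofr [z0 Dz0].
have s2 : (Num.sqrt 2 : R)^-1 * (Num.sqrt 2)^-1 = 2^-1.
  by rewrite -invfM -expr2 sqr_sqrtr.
have s20 : 0 < (Num.sqrt 2 : R)^-1 by rewrite invr_gt0 sqrtr_gt0.
have W01 z : D z -> W z 0 1 != 0.
  move=> Dz; apply/eqP => w0; have := W_norm Dz.
  rewrite (gbiv_Lambda (W_Lambda Dz) (W_Lambda Dz)) w0 mulr0 oppr0 add0r -!expr2 => h'.
  have : 0 <= 2 * (W z 0 2 ^+ 2 + W z 0 3 ^+ 2) by rewrite mulr_ge0// addr_ge0// sqr_ge0.
  by rewrite h' oppr_ge0 lern0.
have W01c z : D z -> {for z, continuous (fun w => W w 0 1)}.
  by move=> Dz; apply: smooth_cont Dz; exact: smooth_entry.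
have near_pos (f : R * R -> R) z : {for z, continuous f} -> 0 < f z -> \forall w \near z, 0 < f w.
  by move=> cf fz; apply: (cvgr_gt (f z) cf).
have near_neg (f : R * R -> R) z : {for z, continuous f} -> f z < 0 -> \forall w \near z, f w < 0.
  by move=> cf fz; apply: (cvgr_lt (f z) cf).
(* the coefficient of e_1 /\ e_2 keeps its sign on the connected set D *)
have sgn : exists2 k : R, k * k = 2^-1 & forall z, D z ->
    k * W z 0 1 > 0 /\ to_sheet (nu_plus phi N e1 e2 z) = k *: W z.
  have nuE z : D z -> nu_plus phi N e1 e2 z = (Num.sqrt 2)^-1 *: W z by exact: nu_plus_gauss.
  have nu01 z : D z -> (0 < nu_plus phi N e1 e2 z 0 1) = (0 < W z 0 1).
    by move=> Dz; rewrite nuE// mxE pmulr_rgt0.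
  have [w0|w0] := ltP 0 (W z0 0 1).
    have P z : D z -> 0 < W z 0 1.
      apply: (@connected_spread _ _ oD cD (fun z => 0 < W z 0 1) z0) => //.
        by move=> y Dy; apply: near_pos; exact: W01c.
      move=> y Dy /negP; rewrite -leNgt le_eqVlt (negbTE (W01 _ Dy)) /= => yn.
      by apply: filterS (near_neg _ _ (W01c _ Dy) yn) => x xn; apply/negP; rewrite -leNgt ltW.
    exists (Num.sqrt 2)^-1 => // z Dz; split; first by rewrite mulr_gt0// P.
    by rewrite /to_sheet nu01// P// nuE.
  have P z : D z -> W z 0 1 < 0.
    apply: (@connected_spread _ _ oD cD (fun z => W z 0 1 < 0) z0) => //.
    - by rewrite lt_neqAle W01.
    - by move=> y Dy; apply: near_neg; exact: W01c.
    move=> y Dy /negP; rewrite -leNgt le_eqVlt eq_sym (negbTE (W01 _ Dy)) /= => yn.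
    by apply: filterS (near_pos _ _ (W01c _ Dy) yn) => x xn; apply/negP; rewrite -leNgt ltW.
  exists (- (Num.sqrt 2)^-1); first by rewrite mulrNN.
  move=> z Dz; split; first by rewrite mulNr oppr_gt0 pmulr_rlt0// P.
  by rewrite /to_sheet nu01// ltNge ltW ?P//= nuE// scaleNr.
have [k k2 kP] := sgn.
apply: (associated_minimal_ext oD (Phi := Phi k)).
  by move=> z Dz; have [_ ->] := kP z Dz.
by apply: gauss_minimal => // z Dz; have [] := kP z Dz.
Qed.

End MaximalSurface.

(** * Coordinates on self-dual bivectors and isometries between frames *)

Notation eta3 R := (fun i : 'I_3 => if (i == 0 :> nat)%N then - 2 else 2 : R).

Section Coordinates.
Context {R : realType}.
Implicit Types (v w : 'rV[R]_3) (a b : 'M[R]_4).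

Lemma ip3E v w : ipw (eta3 R) v w = 2 * (- (v 0 0 * w 0 0) + v 0 1 * w 0 1 + v 0 2 * w 0 2).
Proof. by rewrite /ipw sum3 /=; ring. Qed.

(** A self-dual bivector is determined by its coefficients on e_1 /\ e_j; the metric
    g becomes twice the Lorentz product of these coordinates, see [gbiv_crd]. *)
Definition crd (a : 'M[R]_4) : 'rV[R]_3 := \row_k nth 0 [:: a 0 1; a 0 2; a 0 3] k.
Definition uncrd (v : 'rV[R]_3) : 'M[R]_4 :=
  let a := v 0 0 in let b := v 0 1 in let c := v 0 2 in
  \matrix_(i, j) nth 0 (nth [::] [:: [:: 0; a; b; c]; [:: - a; 0; c; - b];
                                    [:: - b; - c; 0; - a]; [:: - c; b; a; 0]] i) j.

Lemma mx4P (P : 'I_4 -> 'I_4 -> Prop) :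
  P 0 0 -> P 0 1 -> P 0 2 -> P 0 3 -> P 1 0 -> P 1 1 -> P 1 2 -> P 1 3 ->
  P 2 0 -> P 2 1 -> P 2 2 -> P 2 3 -> P 3 0 -> P 3 1 -> P 3 2 -> P 3 3 -> forall i j, P i j.
Proof.
move=> *; apply: (@ord4P (fun i => forall j, P i j)); exact: (@ord4P (P _)).
Qed.

Lemma uncrd_Lambda v : Lambda_plus (uncrd v).
Proof.
apply/Lambda_plusP; split; last by split; rewrite !mxE.
apply/matrixP; apply: (@mx4P (fun i j => (uncrd v)^T i j = (- uncrd v) i j));
  by rewrite !mxE /= ?oppr0 ?opprK.
Qed.

Lemma uncrdK v : crd (uncrd v) = v.
Proof.
by apply/rowP; apply: (@ord3P (fun k => crd (uncrd v) 0 k = v 0 k)); rewrite !mxE.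
Qed.

Lemma Lambda_plus_eq a b : Lambda_plus a -> Lambda_plus b -> crd a = crd b -> a = b.
Proof.
move=> /Lambda_plusP[ba [a1 a2 a3]] /Lambda_plusP[bb [b1 b2 b3]] ab.
have e k := congr1 (fun v : 'rV[R]_3 => v 0 k) ab.
have := e 0; have := e 1; have := e 2; rewrite !mxE /= => e3 e2 e1.
have up : forall i j : 'I_4, (i < j)%N -> a i j = b i j.
  apply: (@ord4P (fun i => forall j : 'I_4, (i < j)%N -> a i j = b i j));
   apply: (@ord4P (fun j => (_ < j)%N -> a _ j = b _ j)) => //= _.
  - by rewrite a3 b3.
  - by rewrite a2 b2 e2.
  - by rewrite a1 b1 e1.
apply/matrixP => i j; have [ij|ij|ij] := ltngtP i j.
- exact: up.
- by rewrite (bivectorE ba j i) (bivectorE bb j i) up.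
- by rewrite (val_inj ij) (bivector_diag ba) (bivector_diag bb).
Qed.

Lemma crdK a : Lambda_plus a -> uncrd (crd a) = a.
Proof. by move=> ha; apply: Lambda_plus_eq => //; [exact: uncrd_Lambda|exact: uncrdK]. Qed.

Lemma gbiv_crd a b : Lambda_plus a -> Lambda_plus b -> gbiv a b = ipw (eta3 R) (crd a) (crd b).
Proof. by move=> ha hb; rewrite (gbiv_Lambda ha hb) ip3E !mxE /=. Qed.

Lemma gbiv_uncrd v w : gbiv (uncrd v) (uncrd w) = ipw (eta3 R) v w.
Proof. by rewrite gbiv_crd ?uncrdK//; exact: uncrd_Lambda. Qed.

Lemma ipwDl n (eta : 'I_n -> R) (v w x : 'rV[R]_n) : ipw eta (v + w) x = ipw eta v x + ipw eta w x.
Proof. by rewrite /ipw -big_split; apply: eq_bigr => i _; rewrite mxE /=; ring. Qed.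
Lemma ipwDr n (eta : 'I_n -> R) (v w x : 'rV[R]_n) : ipw eta x (v + w) = ipw eta x v + ipw eta x w.
Proof. by rewrite ![ipw _ x _]ipwC ipwDl. Qed.
Lemma ipwZl n (eta : 'I_n -> R) k (v w : 'rV[R]_n) : ipw eta (k *: v) w = k * ipw eta v w.
Proof. by rewrite /ipw mulr_sumr; apply: eq_bigr => i _; rewrite mxE; ring. Qed.
Lemma ipwZr n (eta : 'I_n -> R) k (v w : 'rV[R]_n) : ipw eta v (k *: w) = k * ipw eta v w.
Proof. by rewrite ipwC ipwZl ipwC. Qed.
Lemma ipwNl n (eta : 'I_n -> R) (v w : 'rV[R]_n) : ipw eta (- v) w = - ipw eta v w.
Proof. by rewrite -scaleN1r ipwZl mulN1r. Qed.
Lemma ipwNr n (eta : 'I_n -> R) (v w : 'rV[R]_n) : ipw eta v (- w) = - ipw eta v w.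
Proof. by rewrite ipwC ipwNl ipwC. Qed.

Local Notation B := (ipw (eta3 R)).

(** The Lorentz cross product, scaled so that it turns the plane orthogonal to v by a
    right angle when B(v, v) = -1, see [cross_norm]. *)
Definition cross (v w : 'rV[R]_3) : 'rV[R]_3 :=
  Num.sqrt 2 *: \row_k nth 0 [:: - (v 0 1 * w 0 2 - v 0 2 * w 0 1);
     v 0 2 * w 0 0 - v 0 0 * w 0 2; v 0 0 * w 0 1 - v 0 1 * w 0 0] k.

Let s2 : (Num.sqrt 2 : R) * Num.sqrt 2 = 2.
Proof. by rewrite -expr2 sqr_sqrtr. Qed.

Lemma cross_orth1 v w : B v (cross v w) = 0.
Proof. by rewrite ip3E !mxE /=; ring. Qed.
Lemma cross_orth2 v w : B w (cross v w) = 0.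
Proof. by rewrite ip3E !mxE /=; ring. Qed.
Lemma cross_norm v w : B v v = -1 -> B v w = 0 -> B (cross v w) (cross v w) = B w w.
Proof.
rewrite !ip3E => vv vw; rewrite !mxE /=.
move: (Num.sqrt 2 : R) s2 vv vw => r rr.
move: (v 0 0) (v 0 1) (v 0 2) (w 0 0) (w 0 1) (w 0 2) => v0 v1 v2 w0 w1 w2 vv vw.
transitivity (- (r * r) / 2 * ((2 * (- (v0 * v0) + v1 * v1 + v2 * v2)) * (2 * (- (w0 * w0) + w1 * w1 + w2 * w2))
   - (2 * (- (v0 * w0) + v1 * w1 + v2 * w2)) ^+ 2)); first by field.
by rewrite vv vw rr; field.
Qed.

Lemma expansion3 (f X Y : 'rV[R]_3) (E : R) (v : 'rV[R]_3) : E != 0 ->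
  B f f = -1 -> B X X = E -> B Y Y = E -> B f X = 0 -> B f Y = 0 -> B X Y = 0 ->
  v = - B v f *: f + (B v X / E) *: X + (B v Y / E) *: Y.
Proof.
move=> E0 ff XX YY fX fY XY.
have Xf : B X f = 0 by rewrite ipwC.
have Yf : B Y f = 0 by rewrite ipwC.
have YX : B Y X = 0 by rewrite ipwC.
pose b (i : 'I_3) := nth 0 [:: f; X; Y] i.
pose d (i : 'I_3) := nth 0 [:: -1; E; E] i.
have bd : forall i j, B (b i) (b j) = d i *+ (i == j).
  apply: (@ord3P (fun i => forall j, B (b i) (b j) = d i *+ (i == j)));
    apply: (@ord3P (fun j => B (b _) (b j) = d _ *+ (_ == j)));
    by rewrite /b /d /= ?mulr1n ?mulr0n.
have d0 : forall i, d i != 0.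
  by apply: (@ord3P (fun i => d i != 0)); rewrite /d /= ?oppr_eq0 ?oner_eq0.
rewrite {1}(ortho_expansion v bd d0) sum3 /b /d /=.
by rewrite invrN1 !mulrN1.
Qed.

End Coordinates.

Section FrameIsometry.
Context {R : realType}.
Local Notation B := (ipw (eta3 R)).

(** The last two vectors have square norm E rather than 1, so that derivatives of a
    surface can be used without dividing by sqrt E. *)
Definition orthoframe (E : R) (f X Y : 'rV[R]_3) : Prop :=
  [/\ B f f = -1, B X X = E & B Y Y = E] /\ [/\ B f X = 0, B f Y = 0 & B X Y = 0].

(** The linear map carrying the frame (f, X, Y) to (g, X', Y'), written through the
    scalar products with the first frame. *)
Definition frame_map (E : R) (f X Y g X' Y' v : 'rV[R]_3) : 'rV[R]_3 :=
  - B f v *: g + (B X v / E) *: X' + (B Y v / E) *: Y'.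

Variables (E : R) (f X Y g X' Y' : 'rV[R]_3).
Hypotheses (E0 : 0 < E) (F1 : orthoframe E f X Y) (F2 : orthoframe E g X' Y').
Local Notation L := (frame_map E f X Y g X' Y').

Let En : E != 0. Proof. by rewrite gt_eqF. Qed.

Lemma frame_expand v : v = - B v f *: f + (B v X / E) *: X + (B v Y / E) *: Y.
Proof. by have [[ff XX YY] [fX fY XY]] := F1; exact: expansion3. Qed.

Lemma frame_map_isometry v w : B (L v) (L w) = B v w.
Proof.
have [[ff XX YY] [fX fY XY]] := F2.
have Xf : B X' g = 0 by rewrite ipwC.
have Yf : B Y' g = 0 by rewrite ipwC.
have YX : B Y' X' = 0 by rewrite ipwC.
transitivity (- (B v f * B w f) + B v X * B w X / E + B v Y * B w Y / E).
  rewrite /frame_map !ipwDl !ipwDr !ipwZl !ipwZr ff XX YY fX fY XY Xf Yf YX.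
  rewrite ![B f _]ipwC ![B X _]ipwC ![B Y _]ipwC.
  by move: (B v f) (B w f) (B v X) (B w X) (B v Y) (B w Y) => *; field.
rewrite [in RHS](frame_expand v) !ipwDl !ipwZl ![B f w]ipwC ![B X w]ipwC ![B Y w]ipwC.
by ring.
Qed.

Lemma frame_map_pair v : [/\ B g (L v) = B f v, B X' (L v) = B X v & B Y' (L v) = B Y v].
Proof.
have [[ff XX YY] [fX fY XY]] := F2.
have Xf : B X' g = 0 by rewrite ipwC.
have Yf : B Y' g = 0 by rewrite ipwC.
have YX : B Y' X' = 0 by rewrite ipwC.
rewrite /frame_map !ipwDr !ipwZr ff XX YY fX fY XY Xf Yf YX !mulr0 !addr0 ?add0r !divfK//.
by split=> //; rewrite mulrN1 opprK.
Qed.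

End FrameIsometry.

Lemma frame_mapK (R : realType) (E : R) (f X Y g X' Y' v : 'rV[R]_3) : 0 < E ->
  orthoframe E f X Y -> orthoframe E g X' Y' ->
  frame_map E g X' Y' f X Y (frame_map E f X Y g X' Y' v) = v.
Proof.
move=> E0 F1 F2; have [h1 h2 h3] := frame_map_pair f X Y E0 F2 v.
rewrite {1}/frame_map h1 h2 h3 [RHS](frame_expand E0 F1 v).
by rewrite ![ipw _ v _]ipwC.
Qed.

(** * Frames of a surface in the hyperbolic plane and their rigidity *)

Section Directional.
Context {R : realType}.
Variables (D : set (R * R)).
Hypothesis oD : open D.
Variables (p q : R).

Definition vd n (f : R * R -> 'rV[R]_n) (w : R * R) : 'rV[R]_n := p *: dx f w + q *: dy f w.
Definition sd (f : R * R -> R) (w : R * R) : R := p * dx f w + q * dy f w.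

Lemma smooth_vd n (f : R * R -> 'rV[R]_n) : smooth D f -> smooth D (vd f).
Proof.
move=> hf; apply: (smooth_add oD).
  exact: (smooth_scale oD (smooth_cst oD p) (smooth_dx hf)).
exact: (smooth_scale oD (smooth_cst oD q) (smooth_dy hf)).
Qed.

Lemma smooth_sd (f : R * R -> R) : smooth D f -> smooth D (sd f).
Proof. move=> hf; rewrite /sd; smooth_tac. Qed.

Lemma sd_ext (f g : R * R -> R) z : (forall w, D w -> f w = g w) -> D z -> sd f z = sd g z.
Proof. by move=> fg Dz; rewrite /sd (dx_ext oD fg Dz) (dy_ext oD fg Dz). Qed.
Lemma sdM (f g : R * R -> R) z : smooth D f -> smooth D g -> D z ->
  sd (fun w => f w * g w) z = sd f z * g z + f z * sd g z.
Proof. by move=> hf hg Dz; rewrite /sd (dxM hf hg Dz) (dyM hf hg Dz); ring. Qed.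
Lemma sdD (f g : R * R -> R) z : smooth D f -> smooth D g -> D z ->
  sd (fun w => f w + g w) z = sd f z + sd g z.
Proof. by move=> hf hg Dz; rewrite /sd (dxD hf hg Dz) (dyD hf hg Dz); ring. Qed.
Lemma sdN (f : R * R -> R) z : smooth D f -> D z -> sd (fun w => - f w) z = - sd f z.
Proof. by move=> hf Dz; rewrite /sd (dxN hf Dz) (dyN hf Dz); ring. Qed.
Lemma sdV (f : R * R -> R) z : smooth D f -> (forall w, D w -> f w != 0) -> D z ->
  sd (fun w => (f w)^-1) z = - sd f z * (f z)^-1 * (f z)^-1.
Proof.
move=> hf f0 Dz; rewrite /sd.
rewrite (dx_val (dvV (f0 _ Dz) (smooth_isdx hf Dz))) (dy_val (dvV (f0 _ Dz) (smooth_isdy hf Dz))).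
ring.
Qed.
Lemma sd_cst (k : R) z : sd (fun=> k) z = 0.
Proof. by rewrite /sd dx_cst dy_cst !mulr0 addr0. Qed.

Lemma sd_entry n (f : R * R -> 'rV[R]_n) k z : smooth D f -> D z ->
  sd (fun w => f w 0 k) z = vd f z 0 k.
Proof.
move=> hf Dz; rewrite /sd -(dx_mx hf 0 k Dz) -(dy_mx hf 0 k Dz) /vd.
by move: (dx f z) (dy f z) => a b; rewrite !mxE.
Qed.

Lemma sd_ipw n (eta : 'I_n -> R) (f g : R * R -> 'rV[R]_n) (h : R * R -> R) z :
  smooth D f -> smooth D g -> (forall w, D w -> ipw eta (f w) (g w) = h w) -> D z ->
  ipw eta (vd f z) (g z) + ipw eta (f z) (vd g z) = sd h z.
Proof.
move=> hf hg fg Dz; rewrite -(sd_ext fg Dz) /sd (dx_ipw eta hf hg Dz) (dy_ipw eta hf hg Dz) /vd.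
move: (dx f z) (dy f z) (dx g z) (dy g z) (f z) (g z) => a b a' b' x y.
rewrite ipwDl ipwDr !ipwZl !ipwZr; ring.
Qed.

Lemma sd_ipw_orth n (eta : 'I_n -> R) (f g : R * R -> 'rV[R]_n) z :
  smooth D f -> smooth D g -> (forall w, D w -> ipw eta (f w) (g w) = 0) -> D z ->
  ipw eta (vd f z) (g z) = - ipw eta (f z) (vd g z).
Proof.
move=> hf hg fg Dz; have := sd_ipw hf hg fg Dz; rewrite sd_cst => /eqP.
by rewrite addr_eq0 => /eqP.
Qed.

Lemma sd_ipw_self n (eta : 'I_n -> R) (f : R * R -> 'rV[R]_n) (h : R * R -> R) z :
  smooth D f -> (forall w, D w -> ipw eta (f w) (f w) = h w) -> D z ->
  ipw eta (vd f z) (f z) = sd h z / 2.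
Proof.
move=> hf ff Dz; have := sd_ipw hf hf ff Dz; rewrite [ipw _ (f z) _]ipwC => <-.
by field.
Qed.

End Directional.

Lemma drop_null_terms (R : pzRingType) (V : lmodType R) (a b : R) (x y x' y' : V) :
  0 *: x + a *: y + (0 *: x' + b *: y') = a *: y + b *: y'.
Proof. by rewrite !scale0r !add0r. Qed.

Lemma swap_directions (R : comPzRingType) (V : lmodType R) (p q p' q' : R) (a b b' c : V) : b = b' ->
  p *: (p' *: a + q' *: b) + q *: (p' *: b' + q' *: c) =
  p' *: (p *: a + q *: b) + q' *: (p *: b' + q *: c).
Proof.
move=> ->; rewrite !scalerDr !scalerA ![p' * _]mulrC ![q' * _]mulrC -!addrA; congr (_ + _).
by rewrite addrCA.
Qed.

Lemma vd_vd (R : realType) (D : set (R * R)) n (f : R * R -> 'rV[R]_n) (a b a' b' : R) z :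
  smooth D f -> D z -> vd a b (vd a' b' f) z =
   a *: (a' *: dx (dx f) z + b' *: dx (dy f) z) + b *: (a' *: dy (dx f) z + b' *: dy (dy f) z).
Proof.
move=> hf Dz; have hx := smooth_dx hf; have hy := smooth_dy hf.
have X : dx (vd a' b' f) z = a' *: dx (dx f) z + b' *: dx (dy f) z.
  have h := dx_val (isd_add (isd_scale (dvC a' z _) (smooth_isdx hx Dz)) (isd_scale (dvC b' z _) (smooth_isdx hy Dz))).
  exact (etrans h (drop_null_terms _ _ _ _ _ _)).
have Y : dy (vd a' b' f) z = a' *: dy (dx f) z + b' *: dy (dy f) z.
  have h := dy_val (isd_add (isd_scale (dvC a' z _) (smooth_isdy hx Dz)) (isd_scale (dvC b' z _) (smooth_isdy hy Dz))).
  exact (etrans h (drop_null_terms _ _ _ _ _ _)).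
exact (congr2 (fun v w => a *: v + b *: w) X Y).
Qed.

Lemma vd_comm (R : realType) (D : set (R * R)) n (f : R * R -> 'rV[R]_n) (p q p' q' : R) z :
  open D -> smooth D f -> D z -> vd p q (vd p' q' f) z = vd p' q' (vd p q f) z.
Proof.
move=> oD hf Dz; apply: etrans (vd_vd _ _ _ _ hf Dz) _; apply: etrans _ (esym (vd_vd _ _ _ _ hf Dz)).
exact: (swap_directions _ _ _ _ _ _ (mx_Schwarz oD hf Dz)).
Qed.

(** The Laplacian is invariant under rotations. *)
Lemma rotated_laplacian (K : comPzRingType) (V : lmodType K) (c s : K) (a b b' d : V) : c * c + s * s = 1 ->
  (c *: (c *: a + - s *: b) + - s *: (c *: b' + - s *: d)) +
  (s *: (s *: a + c *: b) + c *: (s *: b' + c *: d)) = a + d.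
Proof.
move=> cs; rewrite !scalerDr !scalerA.
rewrite mulrNN -[in RHS](scale1r a) -[in RHS](scale1r d) -cs !scalerDl.
rewrite !mulNr !mulrN [s * c]mulrC !scaleNr.
move: ((c * c) *: a) ((s * s) *: a) ((c * s) *: b) ((c * s) *: b') ((s * s) *: d) ((c * c) *: d) => a1 a2 b1 b2 d1 d2.
rewrite [LHS]addrACA (addrACA a1) (addrACA (- b2)) !addNr addr0 add0r.
by rewrite [d1 + d2]addrC.
Qed.

Section PairingAlgebra.
Context {R : realType}.

Lemma comb3E n (a b c : R) (u v w : 'rV[R]_n) i :
  (a *: u + b *: v + c *: w) 0 i = a * u 0 i + b * v 0 i + c * w 0 i.
Proof. by rewrite !mxE. Qed.

Lemma pairing_ds_alg (E b k f X Y g X' Y' : R) : E != 0 ->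
  - (X * g + f * X') + (((E * f + b * X + k * Y) * X' + X * (E * g + b * X' + k * Y') +
   ((0 * f + - k * X + b * Y) * Y' + Y * (0 * g + - k * X' + b * Y'))) * E^-1
   + (X * X' + Y * Y') * (- (2 * b * E) * E^-1 * E^-1)) = 0.
Proof. by move=> *; field. Qed.

Lemma pairing_dr_alg (E b k S f X Y g X' Y' : R) : E != 0 ->
  - (S / E * Y * g + f * (S / E * Y')) + (((0 * f + b * X + k * Y) * X' + X * (0 * g + b * X' + k * Y') +
   ((S * f + - k * X + b * Y) * Y' + Y * (S * g + - k * X' + b * Y'))) * E^-1
   + (X * X' + Y * Y') * (- (2 * b * E) * E^-1 * E^-1)) = 0.
Proof. by move=> *; field. Qed.

(** The matrix entries of [frame_map] are the function [pairing] below, up to the signs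
    of the scalar product. *)
Lemma frame_map_entry (E : R) (f X Y g X' Y' v : 'rV[R]_3) j :
  frame_map E f X Y g X' Y' v 0 j = \sum_i eta3 R i * v 0 i *
    (- (f 0 i * g 0 j) + (X 0 i * X' 0 j + Y 0 i * Y' 0 j) * E^-1).
Proof.
have l (u : 'rV[R]_3) (k : R) : ipw (eta3 R) u v * k = \sum_i eta3 R i * u 0 i * v 0 i * k.
  by rewrite mulr_suml.
rewrite /frame_map comb3E mulNr -[ipw _ X v / E * _]mulrA -[ipw _ Y v / E * _]mulrA !l.
rewrite -sumrN -!big_split; apply: eq_bigr => i _ /=.
by case: ifP => _; ring.
Qed.

End PairingAlgebra.

Section AdaptedFrame.
Context {R : realType}.
Local Notation B := (ipw (eta3 R)).
Variables (D : set (R * R)) (c s : R) (E S : R * R -> R).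
Hypotheses (oD : open D) (cD : connected D) (cs1 : c * c + s * s = 1).
Hypotheses (hE : smooth D E) (hS : smooth D S) (E0 : forall w, D w -> 0 < E w).

Local Notation vs := (vd c (- s)).
Local Notation vr := (vd s c).
Local Notation ds := (sd c (- s)).
Local Notation dr := (sd s c).

(** Y is the derivative of f along d_s turned by a right angle, and d_r f is the
    multiple S / E of Y; the last condition expresses that the surface is minimal. *)
Definition adapted (f Y : R * R -> 'rV[R]_3) : Prop :=
  [/\ smooth D f, smooth D Y,
      forall z, D z -> orthoframe (E z) (f z) (vs f z) (Y z),
      forall z, D z -> vr f z = (S z / E z) *: Y z &
      forall z, D z -> B (vs (vs f) z + vr (vr f) z) (Y z) = 0].

Let b z := ds E z / 2 / E z.
Let b' z := dr E z / 2 / E z.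
Let k z := - (dr S z - S z / E z * (dr E z / 2)) / E z.
Let k' z := (ds S z - S z / E z * (ds E z / 2)) / E z.

Section Structure.
Variables (f Y : R * R -> 'rV[R]_3).
Hypothesis af : adapted f Y.
Let hf : smooth D f. Proof. by case: af. Qed.
Let hY : smooth D Y. Proof. by case: af. Qed.
Let X := vs f.
Let Z := vr f.
Let hX : smooth D X. Proof. exact: smooth_vd. Qed.
Let hZ : smooth D Z. Proof. exact: smooth_vd. Qed.
Let fr z (Dz : D z) : orthoframe (E z) (f z) (X z) (Y z). Proof. by case: af => _ _ h _ _; exact: h. Qed.
Let ff z (Dz : D z) : B (f z) (f z) = -1. Proof. by have [[]] := fr Dz. Qed.
Let XX z (Dz : D z) : B (X z) (X z) = E z. Proof. by have [[]] := fr Dz. Qed.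
Let YY z (Dz : D z) : B (Y z) (Y z) = E z. Proof. by have [[]] := fr Dz. Qed.
Let Xf z (Dz : D z) : B (X z) (f z) = 0. Proof. by have [_ []] := fr Dz; rewrite ipwC. Qed.
Let Yf z (Dz : D z) : B (Y z) (f z) = 0. Proof. by have [_ []] := fr Dz; rewrite [B (f z) (Y z)]ipwC. Qed.
Let XY z (Dz : D z) : B (X z) (Y z) = 0. Proof. by have [_ []] := fr Dz. Qed.
Let YX z (Dz : D z) : B (Y z) (X z) = 0. Proof. by rewrite ipwC; exact: XY. Qed.
Let ZE z (Dz : D z) : Z z = (S z / E z) *: Y z. Proof. by case: af => _ _ _ h _; exact: h. Qed.
Let ZY z (Dz : D z) : B (Z z) (Y z) = S z.
Proof. by rewrite (ZE Dz) ipwZl (YY Dz) divfK// gt_eqF// E0. Qed.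
Let harm z (Dz : D z) : B (vs X z) (Y z) = - B (vr Z z) (Y z).
Proof. by apply/eqP; rewrite -addr_eq0 -ipwDl; case: af => _ _ _ _ h; rewrite h. Qed.

Let expand z v a x y : D z -> B v (f z) = - a -> B v (X z) = x -> B v (Y z) = y ->
  v = a *: f z + (x / E z) *: X z + (y / E z) *: Y z.
Proof.
move=> Dz vf <- <-; have En := E0 Dz.
by rewrite {1}(frame_expand En (fr Dz) v) vf opprK.
Qed.

(** The coefficient on Y comes from the harmonicity condition, which turns the
    derivative of X along d_s into that of (S / E) Y along d_r. *)
Lemma adapted_Xs z : D z -> vs X z = E z *: f z + b z *: X z + k z *: Y z.
Proof.
move=> Dz; apply: expand => //.
- by rewrite (sd_ipw_orth oD _ _ hX hf Xf Dz) (XX Dz).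
- exact: (sd_ipw_self oD c (- s) hX XX Dz).
- rewrite (harm Dz); congr (- _).
  have := sd_ipw oD s c hZ hY ZY Dz => /esym/eqP; rewrite -subr_eq => /eqP <-.
  by rewrite (ZE Dz) ipwZl ipwC (sd_ipw_self oD s c hY YY Dz).
Qed.

Lemma adapted_Ys z : D z -> vs Y z = 0 *: f z + (- k z) *: X z + b z *: Y z.
Proof.
move=> Dz; rewrite /k mulNr opprK; apply: expand => //.
- by rewrite (sd_ipw_orth oD _ _ hY hf Yf Dz) (YX Dz).
- rewrite (sd_ipw_orth oD _ _ hY hX YX Dz) ipwC (harm Dz) opprK.
  have := sd_ipw oD s c hZ hY ZY Dz => /esym/eqP; rewrite -subr_eq => /eqP <-.
  by rewrite (ZE Dz) ipwZl ipwC (sd_ipw_self oD s c hY YY Dz).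
- exact: (sd_ipw_self oD c (- s) hY YY Dz).
Qed.

Let Xr_Y z : D z -> B (vr X z) (Y z) = ds S z - S z / E z * (ds E z / 2).
Proof.
move=> Dz; rewrite /X (vd_comm _ _ _ _ oD hf Dz) -/Z.
have := sd_ipw oD c (- s) hZ hY ZY Dz => /esym/eqP; rewrite -subr_eq => /eqP <-.
by rewrite (ZE Dz) ipwZl ipwC (sd_ipw_self oD c (- s) hY YY Dz).
Qed.

(** The mixed derivative d_r d_s f is that of (S / E) Y along d_s. *)
Lemma adapted_Xr z : D z -> vr X z = 0 *: f z + b' z *: X z + k' z *: Y z.
Proof.
move=> Dz; apply: expand => //.
- by rewrite (sd_ipw_orth oD _ _ hX hf Xf Dz) -/Z (ZE Dz) ipwZr (XY Dz) mulr0.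
- exact: (sd_ipw_self oD s c hX XX Dz).
- exact: Xr_Y.
Qed.

Lemma adapted_Yr z : D z -> vr Y z = S z *: f z + (- k' z) *: X z + b' z *: Y z.
Proof.
move=> Dz; rewrite /k' -mulNr; apply: expand => //.
- by rewrite (sd_ipw_orth oD _ _ hY hf Yf Dz) -/Z ipwC (ZY Dz).
- by rewrite (sd_ipw_orth oD _ _ hY hX YX Dz) ipwC (Xr_Y Dz).
- exact: (sd_ipw_self oD s c hY YY Dz).
Qed.

End Structure.

Variables (f Y g Y' : R * R -> 'rV[R]_3).
Hypotheses (af : adapted f Y) (ag : adapted g Y').

Let pairing i j (w : R * R) : R := - (f w 0 i * g w 0 j) +
  (vs f w 0 i * vs g w 0 j + Y w 0 i * Y' w 0 j) * (E w)^-1.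

Let hf : smooth D f. Proof. by case: af. Qed.
Let hg : smooth D g. Proof. by case: ag. Qed.
Let hY : smooth D Y. Proof. by case: af. Qed.
Let hY' : smooth D Y'. Proof. by case: ag. Qed.
Let hX : smooth D (vs f). Proof. exact: smooth_vd. Qed.
Let hX' : smooth D (vs g). Proof. exact: smooth_vd. Qed.
Let En z : D z -> E z != 0. Proof. by move=> Dz; rewrite gt_eqF// E0. Qed.
Let he : smooth D (fun w => (E w)^-1). Proof. exact: (smoothV oD En hE). Qed.

Let sf i := smooth_entry oD hf 0 i.
Let sg i := smooth_entry oD hg 0 i.
Let sX i := smooth_entry oD hX 0 i.
Let sX' i := smooth_entry oD hX' 0 i.
Let sY i := smooth_entry oD hY 0 i.
Let sY' i := smooth_entry oD hY' 0 i.

Let smooth_pairing i j : smooth D (pairing i j).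
Proof.
exact: (smoothD oD (smoothN oD (smoothM oD (sf i) (sg j)))
  (smoothM oD (smoothD oD (smoothM oD (sX i) (sX' j)) (smoothM oD (sY i) (sY' j))) he)).
Qed.

Let sd_pairing p q i j z : D z -> sd p q (pairing i j) z =
  - (vd p q f z 0 i * g z 0 j + f z 0 i * vd p q g z 0 j) +
  ((vd p q (vs f) z 0 i * vs g z 0 j + vs f z 0 i * vd p q (vs g) z 0 j +
   (vd p q Y z 0 i * Y' z 0 j + Y z 0 i * vd p q Y' z 0 j)) * (E z)^-1
   + (vs f z 0 i * vs g z 0 j + Y z 0 i * Y' z 0 j) * (- sd p q E z * (E z)^-1 * (E z)^-1)).
Proof.
move=> Dz; have m1 := smoothM oD (sf i) (sg j).
have m2 := smoothM oD (sX i) (sX' j); have m3 := smoothM oD (sY i) (sY' j).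
have m23 := smoothD oD m2 m3.
have e1 := sdD p q (smoothN oD m1) (smoothM oD m23 he) Dz.
rewrite /pairing e1 (sdN p q m1 Dz) (sdM p q m23 he Dz) (sdD p q m2 m3 Dz).
rewrite (sdM p q (sf i) (sg j) Dz) (sdM p q (sX i) (sX' j) Dz) (sdM p q (sY i) (sY' j) Dz).
rewrite (sdV p q hE En Dz).
rewrite (sd_entry p q i hf Dz) (sd_entry p q j hg Dz) (sd_entry p q i hX Dz).
by rewrite (sd_entry p q j hX' Dz) (sd_entry p q i hY Dz) (sd_entry p q j hY' Dz).
Qed.

Let ds_pairing i j z : D z -> ds (pairing i j) z = 0.
Proof.
move=> Dz; rewrite (sd_pairing c (- s) i j Dz).
rewrite (adapted_Xs af Dz) (adapted_Xs ag Dz) (adapted_Ys af Dz) (adapted_Ys ag Dz).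
have -> : sd c (- s) E z = 2 * b z * E z by rewrite /b; field; exact: En.
rewrite !comb3E; exact: (pairing_ds_alg _ _ _ _ _ _ _ _ (En Dz)).
Qed.

Let dr_pairing i j z : D z -> dr (pairing i j) z = 0.
Proof.
move=> Dz; rewrite (sd_pairing s c i j Dz).
have [_ _ _ zf _] := af; have [_ _ _ zg _] := ag.
rewrite (adapted_Xr af Dz) (adapted_Xr ag Dz) (adapted_Yr af Dz) (adapted_Yr ag Dz) (zf _ Dz) (zg _ Dz).
have -> : sd s c E z = 2 * b' z * E z by rewrite /b'; field; exact: En.
have zE (x : R) (v : 'rV[R]_3) l : (x *: v) 0 l = x * v 0 l by rewrite mxE.
rewrite !comb3E !zE; exact: (pairing_dr_alg _ _ _ _ _ _ _ _ _ (En Dz)).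
Qed.

Let pairing_constant i j z w : D z -> D w -> pairing i j z = pairing i j w.
Proof.
move=> Dz Dw; apply: (@constant_on_domain R D oD cD (pairing i j)) => // y Dy.
- apply: dv_eq (smooth_isdx (smooth_pairing i j) Dy) _.
  rewrite -[LHS]mul1r -cs1.
  transitivity (c * ds (pairing i j) y + s * dr (pairing i j) y); first by rewrite /sd; ring.
  by rewrite ds_pairing// dr_pairing// !mulr0 addr0.
- apply: dv_eq (smooth_isdy (smooth_pairing i j) Dy) _.
  rewrite -[LHS]mul1r -cs1.
  transitivity (- s * ds (pairing i j) y + c * dr (pairing i j) y); first by rewrite /sd; ring.
  by rewrite ds_pairing// dr_pairing// !mulr0 addr0.
Qed.

(** The structure equations of both frames have the same coefficients, so the matrix
    of the isometry between the frames has zero derivatives and is the same at z0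
    and at z. *)
Theorem adapted_rigidity z0 z : D z0 -> D z ->
  g z = frame_map (E z0) (f z0) (vs f z0) (Y z0) (g z0) (vs g z0) (Y' z0) (f z).
Proof.
move=> Dz0 Dz.
have key w j : D w -> frame_map (E w) (f w) (vs f w) (Y w) (g w) (vs g w) (Y' w) (f z) 0 j =
   \sum_i eta3 R i * f z 0 i * pairing i j w.
  by move=> Dw; exact: frame_map_entry.
apply/rowP => j; rewrite (key z0 j Dz0).
under eq_bigr do rewrite (pairing_constant _ _ Dz0 Dz).
rewrite -(key z j Dz).
have [_ _ fr _ _] := af; have [[ff _ _] [fX fY _]] := fr z Dz.
rewrite /frame_map ff [ipw _ (vs f z) _]ipwC fX [ipw _ (Y z) _]ipwC fY.
by rewrite !mul0r !scale0r !addr0 opprK scale1r.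
Qed.

End AdaptedFrame.

(** * First derivatives of a minimal immersion *)

Section MinimalArith.
Variable R : realFieldType.

(** The differential (p, q) of the height satisfies (p + i q)^2 = 4 (s + i c)^2 as a
    consequence of conformality and of the Hopf differential.  The moduli give
    p^2 + q^2 = 4, hence p^2, q^2 and p q separately. *)
Lemma height_arith (c s ct st a b m p q l : R) : c * c + s * s = 1 ->
  ct = c * c - s * s -> st = 2 * (s * c) ->
  a + p * p = l -> b + q * q = l -> m + p * q = 0 ->
  (a - b) / 4 = ct -> - (m / 2) = st ->
  [/\ c * p - s * q = 0, (s * p + c * q) * (s * p + c * q) = 4,
     a = l - 4 * (s * s), b = l - 4 * (c * c) & m = - (4 * (s * c))].
Proof.
move=> cs ctE stE ha hb hm h1 h2.
have mE : m = - (4 * (s * c)) by move: h2; rewrite stE; lra.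
have pq : p * q = 4 * (s * c) by move: hm; rewrite mE; lra.
have d : p * p - q * q = - (4 * (c * c - s * s)) by move: h1; rewrite ctE; lra.
have sum2 : (p * p + q * q) ^+ 2 = 4 ^+ 2.
  transitivity ((p * p - q * q) ^+ 2 + 4 * (p * q) ^+ 2); first by ring.
  rewrite d pq; transitivity ((4 * (c * c + s * s)) ^+ 2); first by ring.
  by rewrite cs mulr1.
have sum : p * p + q * q = 4.
  move/eqP: sum2; rewrite eqf_sqr => /orP[/eqP//|/eqP h].
  have : 0 <= p * p + q * q by rewrite addr_ge0// -expr2 sqr_ge0.
  by rewrite h oppr_ge0 lern0.
have pp : p * p = 4 * (s * s) by move: sum d cs; lra.
have qq : q * q = 4 * (c * c) by move: sum d cs; lra.
split.
- apply/eqP; rewrite -sqrf_eq0; apply/eqP.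
  transitivity (c * c * (p * p) + s * s * (q * q) - 2 * (s * c) * (p * q)); first by ring.
  by rewrite pp qq pq; ring.
- transitivity (s * s * (p * p) + c * c * (q * q) + 2 * (s * c) * (p * q)); first by ring.
  rewrite pp qq pq; transitivity (4 * (c * c + s * s) ^+ 2); first by ring.
  by rewrite cs expr1n mulr1.
- by rewrite -ha pp; ring.
- by rewrite -hb qq; ring.
- exact: mE.
Qed.

(** The Gram matrix of the derivatives of f in the directions d_s and d_r. *)
Lemma rotated_gram_arith (c s l : R) : c * c + s * s = 1 ->
  [/\ c * (c * (l - 4 * (s * s)) + - s * - (4 * (s * c))) + - s * (c * - (4 * (s * c)) + - s * (l - 4 * (c * c))) = l,
      s * (s * (l - 4 * (s * s)) + c * - (4 * (s * c))) + c * (s * - (4 * (s * c)) + c * (l - 4 * (c * c))) = l - 4 &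
      c * (s * (l - 4 * (s * s)) + c * - (4 * (s * c))) + - s * (s * - (4 * (s * c)) + c * (l - 4 * (c * c))) = 0].
Proof.
move=> cs; split.
- by transitivity (l * (c * c + s * s)); [ring|rewrite cs mulr1].
- transitivity (l * (c * c + s * s) - 4 * (c * c + s * s) ^+ 2); first by ring.
  by rewrite cs expr1n !mulr1.
- by ring.
Qed.

End MinimalArith.

Section CurveDerivatives.
Context {R : realType} {V : normedModType R}.

Lemma isd_unique {W : normedModType R} (f : V -> W) z v a b :
  is_derive z v f a -> is_derive z v f b -> a = b.
Proof. by move=> [_ <-] [_ <-]. Qed.

Lemma isd_linear_form n (G : 'rV[R]_n -> R) (M : V -> 'rV[R]_n) z v dM :
  (forall a b, G (a + b) = G a + G b) -> (forall k a, G (k *: a) = k * G a) ->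
  is_derive z v M dM -> is_derive z v (fun w => G (M w)) (G dM).
Proof.
move=> GD GZ /is_derive_mxP hM.
have G0 : G 0 = 0 by rewrite -[X in G X](scale0r 0) GZ mul0r.
have GE a : G a = \sum_k a 0 k * G (delta_mx 0 k).
  rewrite {1}(row_sum_delta a) (big_morph G GD G0).
  by apply: eq_bigr => k _; rewrite GZ.
rewrite GE (_ : (fun w => _) = fun w => \sum_k M w 0 k * G (delta_mx 0 k)); last first.
  by apply/funext => w; exact: GE.
apply: dvsum => k; apply: dv_eq (dvM (hM 0 k) (dvC _ _ _)) _.
by rewrite mulr0 addr0.
Qed.

Lemma isd_crd (M : V -> 'M[R]_4) z v dM : is_derive z v M dM ->
  is_derive z v (fun w => crd (M w)) (crd dM).
Proof.
move=> /is_derive_mxP hM; apply/is_derive_mxP => i j; rewrite (ord1 i); move: j.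
apply: (@ord3P (fun j => is_derive z v (fun w => crd (M w) 0 j) (crd dM 0 j))); rewrite mxE /=.
- by rewrite (_ : (fun w => _) = fun w => M w 0 1); [exact: hM|apply/funext => w; rewrite mxE].
- by rewrite (_ : (fun w => _) = fun w => M w 0 2); [exact: hM|apply/funext => w; rewrite mxE].
- by rewrite (_ : (fun w => _) = fun w => M w 0 3); [exact: hM|apply/funext => w; rewrite mxE].
Qed.

Lemma isd_near (f g : V -> R) z v d : is_derive z v f d ->
  (\forall w \near z, f w = g w) -> is_derive z v g d.
Proof.
move=> [f1 <-] fg; split; first exact: near_eq_derivable fg f1.
by apply/esym; exact: near_eq_derive fg.
Qed.

Lemma isd_Lambda_plus (M : V -> 'M[R]_4) z v dM : is_derive z v M dM ->
  (\forall w \near z, Lambda_plus (M w)) -> Lambda_plus dM.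
Proof.
move=> /is_derive_mxP hM hL.
have N i j k l : (forall w, Lambda_plus (M w) -> - M w k l = M w i j) -> dM i j = - dM k l.
  move=> e; apply: isd_unique (hM i j) _.
  by apply: isd_near (dvN (hM k l)) _; apply: filterS hL => w; exact: e.
have P i j k l : (forall w, Lambda_plus (M w) -> M w k l = M w i j) -> dM i j = dM k l.
  move=> e; apply: isd_unique (hM i j) _.
  by apply: isd_near (hM k l) _; apply: filterS hL => w; exact: e.
apply/Lambda_plusP; split.
  apply/matrixP => i j; rewrite !mxE; apply: N => w.
  by move=> /Lambda_plusP[/bivectorE h _]; rewrite [RHS]h.
by split; [apply: N|apply: N|apply: P] => w /Lambda_plusP[_ []].
Qed.

End CurveDerivatives.

Section LambdaDerivatives.
Context {R : realType}.
Variable D : set (R * R).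
Hypothesis oD : open D.

Lemma Lambda_plus_derivative (M : R * R -> 'M[R]_4) z : smooth D M ->
  (forall w, D w -> Lambda_plus (M w)) -> D z -> Lambda_plus (dx M z) /\ Lambda_plus (dy M z).
Proof.
move=> hM hL Dz; have hn : \forall w \near z, Lambda_plus (M w).
  by apply: filterS hL _; exact: near_D.
by split; [exact: isd_Lambda_plus (smooth_isdx hM Dz) hn|exact: isd_Lambda_plus (smooth_isdy hM Dz) hn].
Qed.

Lemma smooth_crd (M : R * R -> 'M[R]_4) : smooth D M -> smooth D (fun w => crd (M w)).
Proof.
move=> hM; apply/(smooth_mxP oD) => i k; rewrite ord1.
have hE : forall k : 'I_3, smooth D (fun w => nth 0 [:: M w 0 1; M w 0 2; M w 0 3] k).
  by apply: (@ord3P (fun k => smooth D (fun w => nth 0 [:: M w 0 1; M w 0 2; M w 0 3] k))); exact: smooth_entry.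
by apply: (smooth_ext oD _ (hE k)) => z _; rewrite mxE.
Qed.

Lemma dx_crd (M : R * R -> 'M[R]_4) z : smooth D M -> D z -> dx (fun w => crd (M w)) z = crd (dx M z).
Proof. by move=> hM Dz; exact: dx_val (isd_crd (smooth_isdx hM Dz)). Qed.
Lemma dy_crd (M : R * R -> 'M[R]_4) z : smooth D M -> D z -> dy (fun w => crd (M w)) z = crd (dy M z).
Proof. by move=> hM Dz; exact: dy_val (isd_crd (smooth_isdy hM Dz)). Qed.

Lemma smooth_cross (f g : R * R -> 'rV[R]_3) : smooth D f -> smooth D g ->
  smooth D (fun w => cross (f w) (g w)).
Proof.
move=> hf hg; apply: (smooth_scale oD (smooth_cst oD _)).
apply/(smooth_mxP oD) => i k; rewrite ord1.
have F l := smooth_entry oD hf 0 l; have G l := smooth_entry oD hg 0 l.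
have m l l' : smooth D (fun w => f w 0 l * g w 0 l' - f w 0 l' * g w 0 l).
  exact: (smoothD oD (smoothM oD (F l) (G l')) (smoothN oD (smoothM oD (F l') (G l)))).
have hE : forall k : 'I_3, smooth D (fun w => nth 0 [:: - (f w 0 1 * g w 0 2 - f w 0 2 * g w 0 1);
     f w 0 2 * g w 0 0 - f w 0 0 * g w 0 2; f w 0 0 * g w 0 1 - f w 0 1 * g w 0 0] k).
  apply: (@ord3P (fun k => smooth D (fun w => nth 0 [:: - (f w 0 1 * g w 0 2 - f w 0 2 * g w 0 1);
     f w 0 2 * g w 0 0 - f w 0 0 * g w 0 2; f w 0 0 * g w 0 1 - f w 0 1 * g w 0 0] k))) => /=.
  - exact: (smoothN oD (m 1 2)).
  - exact: m.
  - exact: m.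
by apply: (smooth_ext oD _ (hE k)) => z _; rewrite mxE.
Qed.

End LambdaDerivatives.

(** * The frame of a minimal immersion *)

Section MinimalSurface.
Context {R : realType}.
Variables (D : set (R * R)) (u : R * R -> R) (t : R) (Phi : R * R -> 'M[R]_4 * R).
Hypotheses (oD : open D) (cD : connected D) (hu : smooth D u) (sg : sinh_gordon D u).
Hypothesis am : associated_minimal D u t Phi.
Local Notation B := (ipw (eta3 R)).

Let c := cos (t / 2).
Let s := sin (t / 2).
Let E w := exp_sum u w + 2.
Let S := exp_diff u.
Let F w := (Phi w).1.
Let h w := (Phi w).2.
Let f w := crd (F w).
Let X := vd c (- s) f.
Let Z := vd s c f.
Let hr := sd s c h.

Let cs1 : c * c + s * s = 1. Proof. by rewrite -!expr2 cos2Dsin2. Qed.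
Let cosE : cos t = c * c - s * s.
Proof. by rewrite {1}(_ : t = t / 2 + t / 2) ?cosD// -splitr. Qed.
Let sinE : sin t = 2 * (s * c).
Proof. by rewrite {1}(_ : t = t / 2 + t / 2) ?sinD -?splitr// [cos _ * _]mulrC -mulr2n mulr_natl. Qed.

Let hP : smooth D Phi. Proof. by have [[]] := am. Qed.
Let hF : smooth D F. Proof. by have [] := (smooth_pairP oD Phi).1 hP. Qed.
Let hh : smooth D h. Proof. by have [] := (smooth_pairP oD Phi).1 hP. Qed.
Let inH w : D w -> H2 (F w). Proof. by have [[_ H]] := am => _ _ _; exact: H. Qed.
Let FL w : D w -> Lambda_plus (F w). Proof. by move=> /inH[]. Qed.
Let hf : smooth D f. Proof. exact: smooth_crd. Qed.
Let hX : smooth D X. Proof. exact: smooth_vd. Qed.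
Let hZ : smooth D Z. Proof. exact: smooth_vd. Qed.
Let hhr : smooth D hr. Proof. exact: smooth_sd. Qed.
Let hE : smooth D E.
Proof. have h1 := smooth_exp_sum oD hu; rewrite /E; smooth_tac. Qed.
Let E0 w : 0 < E w. Proof. exact: exp_sum_gt0. Qed.
Let dFL w : D w -> Lambda_plus (dx F w) /\ Lambda_plus (dy F w).
Proof. by move=> Dw; exact: (Lambda_plus_derivative oD hF FL Dw). Qed.
Let dxf w : D w -> dx f w = crd (dx F w). Proof. by move=> Dw; exact: (dx_crd hF Dw). Qed.
Let dyf w : D w -> dy f w = crd (dy F w). Proof. by move=> Dw; exact: (dy_crd hF Dw). Qed.

Let ff w : D w -> B (f w) (f w) = -1.
Proof. by move=> Dw; have [L n _] := inH Dw; rewrite -gbiv_crd. Qed.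

Let gram w : D w ->
  [/\ c * dx h w - s * dy h w = 0, hr w * hr w = 4,
      B (dx f w) (dx f w) = E w - 4 * (s * s), B (dy f w) (dy f w) = E w - 4 * (c * c) &
      B (dx f w) (dy f w) = - (4 * (s * c))].
Proof.
move=> Dw; have [_ conf _ hopf] := am.
have [_ c1 c2 c3] := conf w Dw.
have Px := pair_dx hP Dw; have Py := pair_dy hP Dw.
have [xL yL] := dFL Dw.
have ch : 4 * cosh (u w) ^+ 2 = E w := cosh_sq_exp_sum u w.
have g1 : gbiv (dx F w) (dx F w) + dx h w * dx h w = E w.
  exact (etrans (congr2 (@gH2R R) (esym Px) (esym Px)) (etrans c1 ch)).
have g2 : gbiv (dy F w) (dy F w) + dy h w * dy h w = E w.
  exact (etrans (congr2 (@gH2R R) (esym Py) (esym Py)) (etrans c2 ch)).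
have g3 : gbiv (dx F w) (dy F w) + dx h w * dy h w = 0.
  exact (etrans (congr2 (@gH2R R) (esym Px) (esym Py)) c3).
have := etrans (esym (gbiv_mx_z hF Dw)) (hopf w Dw).
rewrite /expi => /complex_inj[h1 h2].
have [q1 q2 q3 q4 q5] := height_arith cs1 cosE sinE g1 g2 g3 h1 h2.
have xy a b a' b' : Lambda_plus a' -> Lambda_plus b' -> a = crd a' -> b = crd b' -> B a b = gbiv a' b'.
  by move=> La Lb -> ->; rewrite gbiv_crd.
split; [exact q1|exact q2| | |].
- exact (etrans (xy _ _ _ _ xL xL (dxf Dw) (dxf Dw)) q3).
- exact (etrans (xy _ _ _ _ yL yL (dyf Dw) (dyf Dw)) q4).
- exact (etrans (xy _ _ _ _ xL yL (dxf Dw) (dyf Dw)) q5).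
Qed.

Let rotate_gram (x y : 'rV[R]_3) a b a' b' p q r : B x x = p -> B y y = q -> B x y = r ->
  B (a *: x + b *: y) (a' *: x + b' *: y) = a * (a' * p + b' * r) + b * (a' * r + b' * q).
Proof. by move=> <- <- <-; rewrite ipwDl !ipwZl !ipwDr !ipwZr [B y x]ipwC. Qed.

Let XZ w : D w -> [/\ B (X w) (X w) = E w, B (Z w) (Z w) = E w - 4 & B (X w) (Z w) = 0].
Proof.
move=> Dw; have [_ _ g1 g2 g3] := gram Dw; have [a1 a2 a3] := rotated_gram_arith (E w) cs1.
split.
- exact (etrans (rotate_gram c (- s) c (- s) g1 g2 g3) a1).
- exact (etrans (rotate_gram s c s c g1 g2 g3) a2).
- exact (etrans (rotate_gram c (- s) s c g1 g2 g3) a3).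
Qed.

Let Xf w : D w -> B (f w) (X w) = 0.
Proof.
by move=> Dw; rewrite ipwC (sd_ipw_self oD c (- s) hf (h := fun=> -1) ff Dw) sd_cst mul0r.
Qed.
Let Zf w : D w -> B (f w) (Z w) = 0.
Proof.
by move=> Dw; rewrite ipwC (sd_ipw_self oD s c hf (h := fun=> -1) ff Dw) sd_cst mul0r.
Qed.

Let Y0 w := cross (f w) (X w).
Let tau w := B (Z w) (Y0 w).
Let hY0 : smooth D Y0. Proof. exact: smooth_cross. Qed.
Let htau : smooth D tau. Proof. exact: smooth_ipw. Qed.
Let frame0 w : D w -> orthoframe (E w) (f w) (X w) (Y0 w).
Proof.
move=> Dw; have [XX _ _] := XZ Dw; have fX := Xf Dw.
split; split=> //.
- exact: ff.
- by rewrite (cross_norm (ff Dw) fX).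
- exact: cross_orth1.
- exact: cross_orth2.
Qed.
Let ZE w : D w -> Z w = (tau w / E w) *: Y0 w.
Proof.
move=> Dw; rewrite {1}(frame_expand (E0 w) (frame0 Dw) (Z w)).
have [_ _ xz] := XZ Dw.
by rewrite [B (Z w) (f w)]ipwC (Zf Dw) [B (Z w) (X w)]ipwC xz oppr0 mul0r !scale0r !add0r.
Qed.
Let tau_sq w : D w -> tau w ^+ 2 = S w ^+ 2.
Proof.
move=> Dw; have [_ zz _] := XZ Dw.
have e : tau w / E w * tau w = E w - 4.
  by rewrite -zz {1}(ZE Dw) ipwZl [B (Y0 w) _]ipwC.
apply: etrans _ (exp_diff_sq u w); rewrite -/(E w) -e expr2.
by field; rewrite gt_eqF// E0.
Qed.

Let hr_constant z w : D z -> D w -> hr z = hr w.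
Proof.
have hr0 y : D y -> hr y != 0.
  move=> Dy; have [_ q _ _ _] := gram Dy; apply/eqP => e; move: q; rewrite e mul0r => /eqP.
  by rewrite eq_sym pnatr_eq0.
have dhr y d : D y -> d * hr y + hr y * d = 0 -> d = 0.
  move=> /hr0 n /eqP; rewrite [hr y * d]mulrC -mulr2n mulrn_eq0 mulf_eq0 (negbTE n) orbF.
  by move=> /eqP.
apply: (constant_on_domain oD cD) => y Dy.
  apply: dv_eq (smooth_isdx hhr Dy) _; apply: dhr (Dy) _.
  rewrite -(dxM hhr hhr Dy) -(dx_cst 4 y); apply: (dx_ext oD) Dy => v Dv.
  by have [_ q _ _ _] := gram Dv.
apply: dv_eq (smooth_isdy hhr Dy) _; apply: dhr (Dy) _.
rewrite -(dyM hhr hhr Dy) -(dy_cst 4 y); apply: (dy_ext oD) Dy => v Dv.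
by have [_ q _ _ _] := gram Dv.
Qed.

Let height_gradient w : D w -> dx h w = s * hr w /\ dy h w = c * hr w.
Proof.
move=> Dw; have [q _ _ _ _] := gram Dw; rewrite /hr /sd.
move: (dx h w) (dy h w) q => a b q; split.
  rewrite -[LHS]mul1r -cs1; transitivity (c * (c * a - s * b) + s * (s * a + c * b)); first by ring.
  by rewrite q mulr0 add0r.
rewrite -[LHS]mul1r -cs1; transitivity (- s * (c * a - s * b) + c * (s * a + c * b)); first by ring.
by rewrite q mulr0 add0r.
Qed.

Let height_hessian w : D w -> dx (dx h) w = 0 /\ dy (dy h) w = 0.
Proof.
move=> Dw; split.
  apply: etrans (dx_ext oD (g := fun=> s * hr w) _ Dw) (dx_cst _ _) => y Dy.
  by have [-> _] := height_gradient Dy; rewrite (hr_constant Dy Dw).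
apply: etrans (dy_ext oD (g := fun=> c * hr w) _ Dw) (dy_cst _ _) => y Dy.
by have [_ ->] := height_gradient Dy; rewrite (hr_constant Dy Dw).
Qed.

Let frame_gradient w : D w -> dx f w = c *: X w + s *: Z w /\ dy f w = - s *: X w + c *: Z w.
Proof.
move=> Dw; rewrite /X /Z /vd; move: (dx f w) (dy f w) => a b.
split; apply/rowP => i; rewrite !mxE; move: (a 0 i) (b 0 i) => x y.
  by rewrite -[LHS]mul1r -cs1; ring.
by rewrite -[LHS]mul1r -cs1; ring.
Qed.

Let harmonic_arith (k x y z1 z2 p q l : R) : l != 0 -> k != 0 -> z1 = 0 -> z2 = 0 ->
  ((k * x + z1 * p) + (k * y + z2 * q)) / l = 0 -> x + y = 0.
Proof.
move=> l0 k0 -> -> /eqP; rewrite !mul0r !addr0 -mulrDr mulf_eq0 invr_eq0 (negbTE l0) orbF.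
by rewrite mulf_eq0 (negbTE k0) => /eqP.
Qed.

Let unit_arith (r n e q : R) : n != 0 -> n ^+ 2 = r * r * e + q ^+ 2 ->
  r / n * (r / n * e) + - (q / n) * - (q / n) = 1.
Proof.
move=> n0 nn; transitivity ((r * r * e + q ^+ 2) / n ^+ 2); first by field.
by rewrite -nn divff// sqrf_eq0.
Qed.

Let orth_arith (r n q a : R) : n != 0 -> r / n * (a * q) + a * r * - (q / n) = 0.
Proof. by move=> n0; field. Qed.

Let gbiv_normal a (v : 'rV[R]_3) k : Lambda_plus a -> gbiv a (k *: uncrd v) = k * B (crd a) v.
Proof. by move=> La; rewrite gbivZr gbiv_crd ?uncrdK//; exact: uncrd_Lambda. Qed.

Let gH2R_normal a (v : 'rV[R]_3) p k q b : Lambda_plus a -> crd a = b ->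
  gH2R (a, p) (k *: uncrd v, q) = k * B b v + p * q.
Proof. by move=> La <-; exact (congr1 (fun x => x + p * q) (gbiv_normal v k La)). Qed.

(** Mean curvature along the unit normal proportional to (h_r Y0, - tau).  It has a
    nonzero component on Y0 since h_r^2 = 4, and h has zero Hessian. *)
Lemma minimal_harmonic w : D w -> B (vd c (- s) X w + vd s c Z w) (Y0 w) = 0.
Proof.
move=> Dw; have [_ conf mn _] := am.
have [l0 c1 c2 c3] := conf w Dw.
have [[_ _ yy] [_ fY XY]] := frame0 Dw.
have [xL yL] := dFL Dw.
have [_ hr4 _ _ _] := gram Dw.
have hr0 : hr w != 0 by apply/eqP => e; move: hr4; rewrite e mul0r => /eqP; rewrite eq_sym pnatr_eq0.
pose m := hr w * hr w * E w + tau w ^+ 2.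
have m0 : 0 < m by rewrite /m hr4 ltr_pwDl// ?sqr_ge0// mulr_gt0// E0.
pose n := Num.sqrt m.
have n0 : n != 0 by rewrite gt_eqF// sqrtr_gt0.
have nn : n ^+ 2 = m by rewrite sqr_sqrtr// ltW.
have k0 : hr w / n != 0 by rewrite mulf_neq0// invr_eq0.
have [gx gy] := frame_gradient Dw.
have Bx : B (dx f w) (Y0 w) = s * tau w.
  by rewrite gx ipwDl !ipwZl XY mulr0 add0r.
have By : B (dy f w) (Y0 w) = c * tau w.
  by rewrite gy ipwDl !ipwZl XY mulr0 add0r.
have [hx hy] := height_gradient Dw.
pose xi := ((hr w / n) *: uncrd (Y0 w), - (tau w / n)).
have o1 : tangent_H2R (Phi w) xi.
  split; first by apply: Lambda_plusZ; exact: uncrd_Lambda.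
  exact (etrans (gbiv_normal _ _ (FL Dw)) (etrans (congr1 _ fY) (mulr0 _))).
have o2 : gH2R xi xi = 1.
  have e : crd ((hr w / n) *: uncrd (Y0 w)) = (hr w / n) *: Y0 w.
    rewrite -[in RHS](uncrdK (Y0 w)); move: (hr w / n) (uncrd (Y0 w)) => k a.
    by apply/rowP; apply: (@ord3P (fun i => crd (k *: a) 0 i = (k *: crd a) 0 i)); rewrite !mxE /= ?mxE.
  apply: etrans (gH2R_normal _ _ _ _ (Lambda_plusZ _ (uncrd_Lambda _)) e) _.
  by rewrite ipwZl yy; exact: unit_arith.
have o3 : gH2R (dx Phi w) xi = 0.
  apply: etrans (congr1 (fun v => gH2R v xi) (pair_dx hP Dw)) _.
  apply: etrans (gH2R_normal _ _ _ _ xL (esym (dxf Dw))) _.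
  by rewrite Bx hx; exact: orth_arith.
have o4 : gH2R (dy Phi w) xi = 0.
  apply: etrans (congr1 (fun v => gH2R v xi) (pair_dy hP Dw)) _.
  apply: etrans (gH2R_normal _ _ _ _ yL (esym (dyf Dw))) _.
  by rewrite By hy; exact: orth_arith.
have mc := etrans (esym (mean_curvature_conformal (B := @gH2R R) xi l0 c1 c2 c3)) (mn w Dw xi o1 o2 o3 o4).
have dxf' : forall y, D y -> crd (dx F y) = dx f y by move=> y Dy; rewrite (dxf Dy).
have dyf' : forall y, D y -> crd (dy F y) = dy f y by move=> y Dy; rewrite (dyf Dy).
have xx := etrans (esym (dx_crd (smooth_dx hF) Dw)) (dx_ext oD dxf' Dw).
have yy' := etrans (esym (dy_crd (smooth_dy hF) Dw)) (dy_ext oD dyf' Dw).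
have xL' : forall y, D y -> Lambda_plus (dx F y) by move=> y /dFL[].
have yL' : forall y, D y -> Lambda_plus (dy F y) by move=> y /dFL[].
have [xxL _] := Lambda_plus_derivative oD (smooth_dx hF) xL' Dw.
have [_ yyL] := Lambda_plus_derivative oD (smooth_dy hF) yL' Dw.
have gxx := etrans (congr1 (fun v => gH2R v xi) (pair_dxx oD hP Dw)) (gH2R_normal (Y0 w) _ _ _ xxL xx).
have gyy := etrans (congr1 (fun v => gH2R v xi) (pair_dyy oD hP Dw)) (gH2R_normal (Y0 w) _ _ _ yyL yy').
have [hxx hyy] := height_hessian Dw.
have lam0 : 2 * (4 * cosh (u w) ^+ 2) != 0 by rewrite mulf_neq0 ?pnatr_eq0// gt_eqF.
have key := harmonic_arith lam0 k0 hxx hyy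
  (etrans (congr1 (fun x => x / _) (congr2 +%R (esym gxx) (esym gyy))) mc).
have lap : vd c (- s) X w + vd s c Z w = dx (dx f) w + dy (dy f) w.
  exact (etrans (congr2 +%R (vd_vd _ _ _ _ hf Dw) (vd_vd _ _ _ _ hf Dw)) (rotated_laplacian _ _ _ _ cs1)).
exact (etrans (congr1 (fun v => B v (Y0 w)) lap) (etrans (ipwDl _ _ _ _) key)).
Qed.

(** The sign between tau and S is constant by [smooth_square_root]; it is absorbed in Y. *)
Theorem minimal_adapted z0 : D z0 -> exists Y eps,
  [/\ adapted D c s E S f Y, eps * eps = 1 &
     forall w, D w -> dx h w = eps * (2 * s) /\ dy h w = eps * (2 * c)].
Proof.
move=> Dz0.
have [k kk tauE] : exists2 k, k * k = 1 & forall w, D w -> tau w = k * S w.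
  have [H|H] := smooth_square_root oD cD (smooth_exp_diff oD hu) (smooth_potential oD hu)
    (laplacian_exp_diff oD hu sg) htau tau_sq.
    by exists 1; rewrite ?mulr1// => w Dw; rewrite mul1r; exact: H.
  by exists (-1); rewrite ?mulrNN ?mulr1// => w Dw; rewrite mulN1r; exact: H.
exists (fun w => k *: Y0 w), (hr z0 / 2); split.
- split.
  + exact: hf.
  + exact: (smooth_scale oD (smooth_cst oD k) hY0).
  + move=> w Dw; have [[a1 a2 a3] [b1 b2 b3]] := frame0 Dw.
    split; split=> //.
    * by rewrite ipwZl ipwZr mulrA kk mul1r.
    * by rewrite ipwZr b2 mulr0.
    * by rewrite ipwZr b3 mulr0.
  + move=> w Dw; apply: etrans (ZE Dw) _; rewrite (tauE w Dw) [RHS]scalerA.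
    by apply: (congr1 (fun x => x *: Y0 w)); rewrite [RHS]mulrC mulrA.
  + by move=> w Dw; rewrite ipwZr minimal_harmonic// mulr0.
- have [_ q _ _ _] := gram Dz0; transitivity (hr z0 * hr z0 / 4); first by field.
  by rewrite q divff// pnatr_eq0.
- move=> w Dw; have [-> ->] := height_gradient Dw; rewrite (hr_constant Dw Dz0).
  by split; field.
Qed.

End MinimalSurface.

(** * Congruence of associated minimal immersions *)

Section Sheet.
Context {R : realType}.
Local Notation B := (ipw (eta3 R)).
Implicit Types a b : 'rV[R]_3.

(** Reversed Cauchy-Schwarz inequality for two vectors in the future cone. *)
Lemma sheet_arith (a0 a1 a2 b0 b1 b2 : R) : 0 < a0 -> 0 < b0 ->
  2 * (- (a0 * a0) + a1 * a1 + a2 * a2) = -1 -> 2 * (- (b0 * b0) + b1 * b1 + b2 * b2) = -1 ->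
  2 * (- (a0 * b0) + a1 * b1 + a2 * b2) < 0.
Proof.
move=> a00 b00 aa bb.
pose m := a1 * b1 + a2 * b2.
have cs : m ^+ 2 <= (a0 * a0 - 2^-1) * (b0 * b0 - 2^-1).
  have -> : a0 * a0 - 2^-1 = a1 * a1 + a2 * a2 by lra.
  have -> : b0 * b0 - 2^-1 = b1 * b1 + b2 * b2 by lra.
  rewrite -subr_ge0.
  have -> : (a1 * a1 + a2 * a2) * (b1 * b1 + b2 * b2) - m ^+ 2 = (a1 * b2 - a2 * b1) ^+ 2 by rewrite /m; ring.
  exact: sqr_ge0.
have a2p : 0 <= a0 * a0 - 2^-1 by have := sqr_ge0 a1; have := sqr_ge0 a2; rewrite !expr2; lra.
have b2p : 0 <= b0 * b0 - 2^-1 by have := sqr_ge0 b1; have := sqr_ge0 b2; rewrite !expr2; lra.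
have lt : m ^+ 2 < (a0 * b0) ^+ 2.
  apply: le_lt_trans cs _; rewrite -subr_gt0.
  have -> : (a0 * b0) ^+ 2 - (a0 * a0 - 2^-1) * (b0 * b0 - 2^-1) =
     2^-1 * (a0 * a0 - 2^-1) + 2^-1 * (b0 * b0 - 2^-1) + 2^-1 * 2^-1 by field.
  by rewrite ltr_wpDl ?mulr_gt0 ?invr_gt0// addr_ge0// mulr_ge0.
have mlt : m < a0 * b0.
  have [//|ge] := ltP m (a0 * b0).
  by move: lt; rewrite ltNge lerXn2r// ?nnegrE ?(le_trans _ ge)// mulr_ge0// ltW.
by move: mlt; rewrite /m; lra.
Qed.

Lemma sheet_neg a b : B a a = -1 -> B b b = -1 -> 0 < a 0 0 -> 0 < b 0 0 -> B a b < 0.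
Proof. by rewrite !ip3E => aa bb a0 b0; exact: sheet_arith. Qed.

(** Otherwise - b would lie in the same sheet as a, and [sheet_neg] would give
    B(a, b) > 0. *)
Lemma sheet_pos a b : B a a = -1 -> B b b = -1 -> 0 < a 0 0 -> B a b < 0 -> 0 < b 0 0.
Proof.
move=> aa bb a0 ab; have [//|b0|b0] := ltgtP 0 (b 0 0).
  have : B a (- b) < 0.
    by apply: sheet_neg => //; [rewrite ipwNl ipwNr opprK|rewrite mxE oppr_gt0].
  by rewrite ipwNr oppr_lt0 ltNge ltW.
move: bb; rewrite ip3E -b0 mul0r oppr0 add0r => bb.
have : 0 <= 2 * (b 0 1 * b 0 1 + b 0 2 * b 0 2) by rewrite mulr_ge0// addr_ge0// -expr2 sqr_ge0.
by rewrite bb oppr_ge0 ler10.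
Qed.

Lemma H2_crd (M : 'M[R]_4) : H2 M -> B (crd M) (crd M) = -1 /\ 0 < crd M 0 0.
Proof. by move=> [L n p]; rewrite -gbiv_crd// mxE. Qed.

Lemma H2_uncrd (v : 'rV[R]_3) : B v v = -1 -> 0 < v 0 0 -> H2 (uncrd v).
Proof.
move=> n p; split; [exact: uncrd_Lambda|by rewrite gbiv_uncrd|].
by rewrite -(uncrdK v) mxE in p.
Qed.

End Sheet.

Section FrameLinear.
Context {R : realType}.
Variables (E : R) (f X Y g X' Y' : 'rV[R]_3).
Local Notation L := (frame_map E f X Y g X' Y').

Lemma frame_mapD v w : L (v + w) = L v + L w.
Proof.
rewrite /frame_map !ipwDr; move: (ipw _ f v) (ipw _ X v) (ipw _ Y v) (ipw _ f w) (ipw _ X w) (ipw _ Y w) => *.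
by apply/rowP => i; rewrite !mxE; ring.
Qed.
Lemma frame_mapZ k v : L (k *: v) = k *: L v.
Proof.
rewrite /frame_map !ipwZr; move: (ipw _ f v) (ipw _ X v) (ipw _ Y v) => *.
by apply/rowP => i; rewrite !mxE; ring.
Qed.
Lemma uncrdD (v w : 'rV[R]_3) i j : uncrd (v + w) i j = uncrd v i j + uncrd w i j.
Proof.
by move: i j; apply: (@mx4P (fun i j => uncrd (v + w) i j = uncrd v i j + uncrd w i j));
  rewrite !mxE /= ?opprD ?addr0.
Qed.
Lemma uncrdZ k (v : 'rV[R]_3) i j : uncrd (k *: v) i j = k * uncrd v i j.
Proof.
by move: i j; apply: (@mx4P (fun i j => uncrd (k *: v) i j = k * uncrd v i j));
  rewrite !mxE /= ?mulrN ?mulr0.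
Qed.

End FrameLinear.

Section AmbientIsometry.
Context {R : realType}.
Local Notation B := (ipw (eta3 R)).
Variables (E : R) (f X Y g X' Y' : 'rV[R]_3) (eps c0 : R).
Hypotheses (E0 : 0 < E) (F1 : orthoframe E f X Y) (F2 : orthoframe E g X' Y').
Hypotheses (f0 : 0 < f 0 0) (g0 : 0 < g 0 0) (eps2 : eps * eps = 1).
Local Notation L := (frame_map E f X Y g X' Y').

Definition ambient_map (p : 'M[R]_4 * R) : 'M[R]_4 * R :=
  (uncrd (L (crd p.1)), eps * p.2 + c0).

(** A linear isometry could exchange the two sheets; this one maps f, which is in
    the upper sheet, to g, which also is. *)
Lemma frame_map_sheet v : B v v = -1 -> 0 < v 0 0 -> B (L v) (L v) = -1 /\ 0 < L v 0 0.
Proof.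
move=> vv v0; have n : B (L v) (L v) = -1 by rewrite frame_map_isometry.
split=> //; have [[ff _ _] _] := F1; have [[gg _ _] _] := F2.
apply: (sheet_pos gg n g0); have [-> _ _] := frame_map_pair f X Y E0 F2 v.
exact: sheet_neg.
Qed.

End AmbientIsometry.

(** By linearity the image of a curve has the image velocity; velocities of curves
    in H^2 lie in Lambda_+, on which the coordinates are isometric. *)
Lemma ambient_isometry (R : realType) (E : R) (f X Y g X' Y' : 'rV[R]_3) (eps c0 : R) :
  0 < E -> orthoframe E f X Y -> orthoframe E g X' Y' -> 0 < f 0 0 -> 0 < g 0 0 -> eps * eps = 1 ->
  isometry_H2R (ambient_map E f X Y g X' Y' eps c0).
Proof.
move=> E0 F1 F2 f0 g0 eps2.
set L := frame_map E f X Y g X' Y'; set T := ambient_map _ _ _ _ _ _ _ _ _.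
set L' := frame_map E g X' Y' f X Y.
have H2L p : H2 p -> H2 (uncrd (L (crd p))).
  by move=> /H2_crd[n q]; have [] := frame_map_sheet E0 F1 F2 f0 g0 n q; exact: H2_uncrd.
have H2L' p : H2 p -> H2 (uncrd (L' (crd p))).
  by move=> /H2_crd[n q]; have [] := frame_map_sheet E0 F2 F1 g0 f0 n q; exact: H2_uncrd.
have LK p : H2 p -> uncrd (L' (crd (uncrd (L (crd p))))) = p.
  by move=> [lp _ _]; rewrite uncrdK /L /L' frame_mapK// crdK.
have L'K p : H2 p -> uncrd (L (crd (uncrd (L' (crd p))))) = p.
  by move=> [lp _ _]; rewrite uncrdK /L /L' frame_mapK// crdK.
split.
  split.
  - by move=> p; exact: H2L.
  - move=> p q /set_mem hp /set_mem hq e.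
    have e1 : uncrd (L (crd p.1)) = uncrd (L (crd q.1)) := congr1 fst e.
    have e2 : eps * p.2 + c0 = eps * q.2 + c0 := congr1 snd e.
    rewrite (surjective_pairing p) (surjective_pairing q); congr pair.
      by rewrite -(LK p.1 hp) e1 LK.
    by rewrite -[p.2]mul1r -[q.2]mul1r -eps2 -!mulrA (addIr _ e2).
  - move=> p hp; exists (uncrd (L' (crd p.1)), eps * (p.2 - c0)); first exact: H2L'.
    rewrite [RHS]surjective_pairing; congr pair; first exact: L'K.
    by rewrite /= mulrA eps2 mul1r subrK.
move=> c s hc dc.
have /is_derive_pairP[d1 d2] := derivableP dc.
set d := 'D_1 c s in d1 d2 *.
have dL : Lambda_plus d.1 by apply: isd_Lambda_plus d1 _;
  apply: (@filterS _ (nbhs s) _ setT) (@filterT _ _ _) => w _; have [] := hc w.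
have D1 : is_derive s 1 (fun r => uncrd (L (crd (c r).1))) (uncrd (L (crd d.1))).
  apply/is_derive_mxP => i j.
  apply: (isd_linear_form (G := fun v => uncrd (L v) i j)) (isd_crd d1).
    by move=> a b; rewrite /L frame_mapD uncrdD.
  by move=> k a; rewrite /L frame_mapZ uncrdZ.
have D2 : is_derive s 1 (fun r => eps * (c r).2 + c0) (eps * d.2).
  by apply: dv_eq (dvD (dvM (dvC eps _ _) d2) (dvC c0 _ _)) _; rewrite mul0r add0r addr0.
have DT : is_derive s 1 (T \o c) (uncrd (L (crd d.1)), eps * d.2).
  by apply/is_derive_pairP; split.
have [DT1 ->] := DT; split=> //.
have g1 : gbiv (uncrd (L (crd d.1))) (uncrd (L (crd d.1))) = gbiv d.1 d.1.
  by rewrite gbiv_uncrd /L frame_map_isometry// -gbiv_crd.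
apply: (congr2 +%R g1).
by rewrite /= mulrACA eps2 mul1r.
Qed.

(** Both immersions have adapted frames for the same functions, so their horizontal
    parts are related by [adapted_rigidity]; the differentials of the heights agree up
    to a sign. *)
Theorem minimal_congruence (R : realType) (D : set (R * R)) (u : R * R -> R) (t : R)
    (Phi Psi : R * R -> 'M[R]_4 * R) :
  domain D -> smooth D u -> sinh_gordon D u ->
  associated_minimal D u t Phi -> associated_minimal D u t Psi ->
  exists T, isometry_H2R T /\ forall z, D z -> Psi z = T (Phi z).
Proof.
move=> [[z0 Dz0] oD cD] hu sg aP aQ.
have [Y [a [adP aa hP]]] := minimal_adapted oD cD hu sg aP Dz0.
have [Y' [b [adQ bb hQ]]] := minimal_adapted oD cD hu sg aQ Dz0.
set c := cos (t / 2) in adP hP adQ hQ *; set s := sin (t / 2) in adP hP adQ hQ *.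
set E := (fun w => exp_sum u w + 2) in adP adQ *.
set f := (fun w => crd (Phi w).1) in adP *; set g := (fun w => crd (Psi w).1) in adQ *.
have cs1 : c * c + s * s = 1 by rewrite -!expr2 cos2Dsin2.
have hE : smooth D E by have h1 := smooth_exp_sum oD hu; rewrite /E; smooth_tac.
have E0 w : 0 < E w by exact: exp_sum_gt0.
have rigid z : D z -> g z = frame_map (E z0) (f z0) (vd c (- s) f z0) (Y z0)
    (g z0) (vd c (- s) g z0) (Y' z0) (f z).
  by move=> Dz; exact (adapted_rigidity oD cD cs1 hE (fun w _ => E0 w) adP adQ Dz0 Dz).
have [_ _ frP _ _] := adP; have [_ _ frQ _ _] := adQ.
have [[smP inP] _ _ _] := aP; have [[smQ inQ] _ _ _] := aQ.
have [_ shP] := (smooth_pairP oD Phi).1 smP; have [_ shQ] := (smooth_pairP oD Psi).1 smQ.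
pose k w := (Psi w).2 + - (a * b * (Phi w).2).
have ab2 : a * b * (a * b) = 1 by rewrite mulrACA aa bb mulr1.
have kc z : D z -> k z = k z0.
  move=> Dz; apply: (constant_on_domain oD cD) => // w Dw.
    have [px _] := hP w Dw; have [qx _] := hQ w Dw.
    apply: dv_eq (dvD (smooth_isdx shQ Dw) (dvN (dvM (dvC (a * b) _ _) (smooth_isdx shP Dw)))) _.
    rewrite px qx mul0r add0r [a * b]mulrC -mulrA [a * _]mulrA aa mul1r; exact: subrr.
  have [_ py] := hP w Dw; have [_ qy] := hQ w Dw.
  apply: dv_eq (dvD (smooth_isdy shQ Dw) (dvN (dvM (dvC (a * b) _ _) (smooth_isdy shP Dw)))) _.
  rewrite py qy mul0r add0r [a * b]mulrC -mulrA [a * _]mulrA aa mul1r; exact: subrr.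
exists (ambient_map (E z0) (f z0) (vd c (- s) f z0) (Y z0) (g z0) (vd c (- s) g z0) (Y' z0) (a * b) (k z0)).
split.
  apply: ambient_isometry => //; [exact: frP|exact: frQ| |].
    by have [] := H2_crd (inP _ Dz0).
  by have [] := H2_crd (inQ _ Dz0).
move=> z Dz; rewrite (surjective_pairing (Psi z)); congr pair.
  have [QL _ _] := inQ z Dz.
  by apply: etrans (esym (crdK QL)) _; rewrite /= -/(f z) -rigid.
by rewrite -(kc z Dz) /k /= addrC subrK.
Qed.

Theorem corollary1 (R : realType) (D : set (R * R)) (u : R * R -> R)
    (phi N e1 e2 : R -> R * R -> 'rV[R]_4)
    (domD : domain D)
    (smooth_u : smooth D u)
    (sinh_gordon_u : sinh_gordon D u) :
  let Phi := fun (t : R) (z : R * R) =>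
    (to_sheet (nu_plus (phi t) (N t) (e1 t) (e2 t) z),
     2 * complex.Im (toC z * expi (t / 2))) in
  forall t : R,
    associated_maximal D u t (phi t) (N t) ->
    oriented_frame D (phi t) (e1 t) (e2 t) ->
    associated_minimal D u t (Phi t) /\
    (forall Psi : R * R -> 'M[R]_4 * R, associated_minimal D u t Psi ->
       exists T : 'M[R]_4 * R -> 'M[R]_4 * R,
         isometry_H2R T /\ forall z, D z -> Psi z = T (Phi t z)).
Proof.
move=> Phi t am ofr; have [D0 oD cD] := domD.
have aP : associated_minimal D u t (Phi t) by exact: (gauss_map_minimal oD smooth_u am cD ofr D0).
by split=> // Psi; exact: minimal_congruence domD smooth_u sinh_gordon_u aP.
Qed.
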